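(* Let $(X,T)$ be a subshift of finite type, $g\in C(X)$ and $d\ge1$. (1) For fixed $(s_1,\ldots,s_d)\in\Lambda_d$, any locally constant cocycle $A$ is a continuity point of the pressure map $B\mapsto P_g(B,(s_1,\ldots,s_d))$ on $\mathcal{M}(X,d)$. (2) For each locally constant cocycle $A\in\mathcal{M}(X,d)$ taking values in $GL_d(\mathbb{R})$ and each $(s_1,\ldots,s_d)\in\Lambda_d$, the pair $(A,(s_1,\ldots,s_d))$ is a continuity point of the pressure map $P_g(\cdot,\cdot)$ on $\mathcal{M}(X,d)\times\Lambda_d$. Here $\mathcal{M}(X,d)$ carries the $L^\infty(X,\mathbb{R}^{d\times d})$ topology.
   Context: Subshifts of finite type are over a finite alphabet; $T$ is the left shift, points are written $x=(x_1,x_2,\ldots)$. $X^*_n$ is the set of words of length $n$ allowed in $X$, and $[\mathbf{i}]$ is the cylinder of points of $X$ starting with $\mathbf{i}$. $C(X)$ is the set of real continuous functions on $X$; $S_ng(x)=\sum_{i=0}^{n-1}g(T^ix)$. $\mathcal{M}(X,d)$ is the collection of all $d\times d$ matrix cocycles on $X$, i.e. all maps $A:X\to\mathbb{R}^{d\times d}$ (not necessarily continuous), with $A(x,n)=A(T^{n-1}x)\cdots A(x)$; the $L^\infty$ topology is that of uniform closeness on $X$. $A$ is locally constant if $A(x)$ depends only on $x_1$. $\Lambda_d=\{(s_1,\ldots,s_d):s_1\ge\cdots\ge s_d\ge0\}$. For $(s_1,\ldots,s_d)\in\Lambda_d$ and a matrix $M\in\mathbb{R}^{d\times d}$ with singular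 values $\alpha_1(M)\ge\cdots\ge\alpha_d(M)$, the generalized singular value function is $\phi^{s_1,\ldots,s_d}(M)=\alpha_1(M)^{s_1}\cdots\alpha_d(M)^{s_d}$ with the convention $0^0=1$; it is sub-multiplicative. The pressure is $$P_g(A,(s_1,\ldots,s_d))=\lim_{n\to\infty}\frac1n\log\Big(\sum_{\mathbf{i}\in X^*_n}\ \sup_{y\in[\mathbf{i}]}\exp(S_ng(y))\,\phi^{s_1,\ldots,s_d}(A(y,n))\Big),$$ which exists by sub-multiplicativity and may equal $-\infty$. *)

(* Defs.v *)
From HB Require Import structures.
From mathcomp Require Import all_boot all_order all_algebra.
From mathcomp Require Import polyrcf.
From mathcomp Require Import all_classical all_reals all_analysis.

Set Implicit Arguments.
Unset Strict Implicit.
Unset Printing Implicit Defensive.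

Import Order.TTheory GRing.Theory Num.Theory.
Import numFieldNormedType.Exports.

Local Open Scope classical_set_scope.
Local Open Scope ring_scope.

(* One-sided sequences over the finite alphabet K, with the product of the
   discrete topologies.  The coordinate x_i (i >= 1) is x i.-1 here. *)
Notation full_shift K := {ptws nat -> discrete_topology K}.

Section Subshift.
Variable K : finType.

Definition shift (x : full_shift K) : full_shift K := fun n => x n.+1.

Definition occurs_at n (w : n.-tuple K) (x : full_shift K) (k : nat) : Prop :=
  forall i : 'I_n, x (k + i)%N = tnth w i.

Definition subshift_of_finite_type (X : set (full_shift K)) : Prop :=
  exists F : seq (seq K),
    X = [set x | forall w, w \in F -> forall k, ~ occurs_at (in_tuple w) x k].

Definition allowed (X : set (full_shift K)) n : set (n.-tuple K) :=
  [set w | exists2 x, X x & exists k, occurs_at w x k].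

Definition cylinder (X : set (full_shift K)) n (w : n.-tuple K) :
    set (full_shift K) :=
  [set x | X x /\ occurs_at w x 0].

End Subshift.

(* The matrix cocycles on X, with the topology of uniform convergence on X.
   An element is a map on the whole full shift, but only its restriction to X
   matters: the topology, the hypotheses and the pressure see nothing else. *)
Notation matrix_cocycle R d X := {uniform` X -> 'M[R]_d}.

Section Pressure.
Variables (R : realType) (K : finType) (X : set (full_shift K)) (d : nat).
Implicit Types (A : full_shift K -> 'M[R]_d) (g : full_shift K -> R).

Fixpoint cocycle A (x : full_shift K) (n : nat) : 'M[R]_d :=
  if n is m.+1 then A (iter m (@shift K) x) *m cocycle A x m else 1%:M.

Definition birkhoff_sum g (n : nat) (x : full_shift K) : R :=
  \sum_(i < n) g (iter i (@shift K) x).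

Definition locally_constant A : Prop :=
  forall x y, X x -> X y -> x 0%N = y 0%N -> A x = A y.

Definition GL_valued A : Prop := forall x, X x -> A x \in unitmx.

(* The square roots of the eigenvalues of M^T M, listed with multiplicity in
   nonincreasing order (rootsR lists the distinct real roots increasingly). *)
Definition singular_values (M : 'M[R]_d) : seq R :=
  let p := char_poly (M^T *m M) in
  rev (flatten [seq nseq (mup a p) (Num.sqrt a) | a <- rootsR p]).

Definition Lambda : set 'rV[R]_d :=
  [set s | (forall i j : 'I_d, (i <= j)%N -> s 0 j <= s 0 i) /\
           (forall i : 'I_d, 0 <= s 0 i)].

(* powR satisfies 0 `^ 0 = 1, and 0 `^ t = 0 for t != 0. *)
Definition phi (s : 'rV[R]_d) (M : 'M[R]_d) : R :=
  \prod_(i < d) (singular_values M)`_i `^ (s 0 i).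

Definition partition_sum g A (s : 'rV[R]_d) (n : nat) : \bar R :=
  (\sum_(w : n.-tuple K | `[< allowed X w >])
    ereal_sup [set (expR (birkhoff_sum g n y) * phi s (cocycle A y n))%:E
              | y in cylinder X w])%E.

(* Extended-real valued; lne 0 = -oo. *)
Definition pressure g A (s : 'rV[R]_d) : \bar R :=
  limn (fun n => ((n%:R^-1)%:E * lne (partition_sum g A s n))%E).

End Pressure.

(* Main.v *)
Require Import Defs.
From HB Require Import structures.
From mathcomp Require Import all_boot all_order all_algebra all_fingroup.
From mathcomp Require Import polyrcf.
From mathcomp Require complex.
From mathcomp Require Import all_classical all_reals all_analysis.
From mathcomp Require Import ring lra zify.

Set Implicit Arguments.
Unset Strict Implicit.
Unset Printing Implicit Defensive.

Import Order.TTheory GRing.Theory Num.Theory.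
Import numFieldNormedType.Exports.

Local Open Scope ring_scope.

(* Let N_k(M) be the l1 norm of the k-th compound matrix of M; it is
   comparable to alpha_1(M) ... alpha_k(M), so phi^s may be replaced by
   psi_t = prod_k N_k^(t_k) with t_k = s_k - s_(k+1), and the pressure is the
   infimum over n of (1/n) log Z_n for a submultiplicative sequence Z_n.  Each
   Z_n is upper semicontinuous in the cocycle, hence so is the pressure.

   For lower semicontinuity at a locally constant A, truncate the norms below
   at exp(-L n) and replace t by a nearby t* at which the convex pressure is
   nearly differentiable.  By Chernoff's bound nearly all the weight then lies
   on words along which all the truncated norms grow at fixed rates al_k.
   Where al is strictly concave at k ("gap"), long words have k-th compounds
   close to rank 1.  Cutting a word into K pieces, with K larger than a product
   of dimensions, produces a block whose rank 1 approximations pair well with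
   themselves: otherwise a large matrix of low rank would be nearly triangular
   with large entries.  By the pigeonhole principle, freely concatenable blocks
   with common rank 1 approximations carry almost all the pressure, and for
   their concatenations the norms at the gaps are nearly multiplicative, which
   persists under small perturbations.  Between the gaps al is nearly affine
   while log N_k is nearly concave in k, so a discrete maximum principle gives
   the missing lower bounds.

   When A takes values in GL_d, log N_k is bounded by a constant times n, so
   near A the pressure is Lipschitz in s uniformly in the cocycle. *)

(** * Compound matrices and singular values *)

(** The obstacle is that A may be singular and reducible: norms of products can collapse, and
    closeness to A controls only products of a bounded length. The proof must therefore find one
    finite family of words, freely concatenable in X, whose products keep their norm by a mechanism
    that is open in the cocycle. The pairing of nearly rank 1 matrices is such a mechanism. It is
    required at all gaps at once, together with a return of the first M letters: the pairings at the
    different gaps and the indicator of the return are multiplied into one array, whose rank is at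
    most the product of the ranks, so that a number of blocks independent of their length suffices.
    All losses are then e^(O(rho m)) for blocks of length m, with rho chosen late and small. The
    truncation level L has to be fixed before rho, from the data alone: it is so large that some gap
    lies at or above the last order that enters psi, because the maximum principle needs control at
    an upper end of the range of orders, order 0 being the lower end. *)

Section CauchyBinet.
Variable R : comNzRingType.

Lemma det_mxsub_noninj m n k (A : 'M[R]_(m, n)) (f : 'I_k -> 'I_m)
    (g : 'I_k -> 'I_n) : ~~ injectiveb f -> \det (mxsub f g A) = 0.
Proof.
case/injectivePn => i [j ij fij]; apply: (determinant_alternate ij) => h.
by rewrite !mxE fij.
Qed.

Lemma det_mxsub_perm m n k (A : 'M[R]_(m, n)) (f : 'I_k -> 'I_m)
    (g : 'I_k -> 'I_n) (s : 'S_k) :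
  \det (mxsub (f \o s) g A) = (-1) ^+ s * \det (mxsub f g A).
Proof.
have -> : mxsub (f \o s) g A = row_perm s (mxsub f g A).
  by apply/matrixP => i j; rewrite !mxE.
by rewrite row_permE det_mulmx det_perm.
Qed.

(** Only the left factor is expanded, by multilinearity in the rows; the minors of [B] stay whole,
    ready to be antisymmetrized against those of [A]. *)
Lemma det_mxsub_mul m n p k (A : 'M[R]_(m, n)) (B : 'M[R]_(n, p))
    (f : 'I_k -> 'I_m) (g : 'I_k -> 'I_p) :
  \det (mxsub f g (A *m B))
  = \sum_(h : {ffun 'I_k -> 'I_n})
      (\prod_i A (f i) (h i)) * \det (mxsub h g B).
Proof.
transitivity (\sum_(h : {ffun 'I_k -> 'I_n}) \sum_(s : 'S_k)
    (-1) ^+ s * \prod_i (A (f i) (h i) * B (h i) (g (s i)))).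
  rewrite exchange_big; apply: eq_bigr => /= s _; rewrite -big_distrr /=.
  congr (_ * _).
  rewrite -(bigA_distr_bigA (fun i j => A (f i) j * B j (g (s i)))) /=.
  by apply: eq_bigr => i _; rewrite !mxE.
apply: eq_bigr => h _; rewrite big_distrr /=; apply: eq_bigr => s _.
rewrite mulrCA big_split //=; congr (_ * (_ * _)).
by apply: eq_bigr => x _; rewrite mxE.
Qed.

(** The sum meets each k-subset in all its orderings, and the non-injective terms vanish; this
    accounts for the k!. Every permutation in the Leibniz expansion of the left minor is absorbed by
    reindexing [h] and contributes one copy of the right side. *)
Lemma cauchy_binet m n p k (A : 'M[R]_(m, n)) (B : 'M[R]_(n, p))
    (f : 'I_k -> 'I_m) (g : 'I_k -> 'I_p) :
  \sum_(h : {ffun 'I_k -> 'I_n}) \det (mxsub f h A) * \det (mxsub h g B)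
  = k`!%:R * \det (mxsub f g (A *m B)).
Proof.
transitivity (\sum_(s : 'S_k) \det (mxsub f g (A *m B))); last first.
  by rewrite sumr_const card_Sn mulr_natl.
under eq_bigr do rewrite mulr_suml.
rewrite exchange_big; apply: eq_bigr => s _ /=.
pose F (h : {ffun 'I_k -> 'I_n}) := [ffun i => h ((s^-1)%g i)].
have Finj : injective F.
  move=> h h' /ffunP hh; apply/ffunP => i; have := hh (s i).
  by rewrite !ffunE permK.
rewrite (reindex_inj Finj) det_mxsub_mul; apply: eq_bigr => h _.
have -> : mxsub (F h) g B = mxsub (h \o (s^-1)%g) g B.
  by apply/matrixP => i j; rewrite !mxE ffunE.
rewrite det_mxsub_perm odd_permV mulrACA -expr2 sqrr_sign mul1r; congr (_ * _).
by apply: eq_bigr => i _; rewrite !mxE ffunE permK.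
Qed.

End CauchyBinet.

Section Pminors.
Variable R : comNzRingType.

(* Each principal minor is counted k! times. *)
Definition pminors n k (A : 'M[R]_n) : R :=
  \sum_(f : {ffun 'I_k -> 'I_n}) \det (mxsub f f A).

Lemma pminors_diag n k (x : 'rV[R]_n) :
  pminors k (diag_mx x)
  = \sum_(f : {ffun 'I_k -> 'I_n} | injectiveb f) \prod_i x 0 (f i).
Proof.
rewrite /pminors (bigID (fun f : {ffun _ -> _} => injectiveb f)) /=.
rewrite [X in _ + X]big1 ?addr0; last by move=> f; exact: det_mxsub_noninj.
apply: eq_bigr => f /injectiveP finj.
have -> : mxsub f f (diag_mx x) = diag_mx (\row_i x 0 (f i)).
  by apply/matrixP => i j; rewrite !mxE (inj_eq finj).
by rewrite det_diag; apply: eq_bigr => i _; rewrite mxE.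
Qed.

Lemma sum_minors_mul n m k (A : 'M[R]_(n, m)) (B : 'M[R]_(m, n)) :
  \sum_(f : {ffun 'I_k -> 'I_n}) \sum_(g : {ffun 'I_k -> 'I_m})
    \det (mxsub f g A) * \det (mxsub g f B)
  = k`!%:R * pminors k (A *m B).
Proof.
by rewrite /pminors big_distrr /=; apply: eq_bigr => f _; rewrite cauchy_binet.
Qed.

End Pminors.

(** This is the cyclic invariance of the trace of a compound. After multiplication by k! both sides
    are the same double sum of products of minors. *)
Lemma pminors_mulC (F : numDomainType) n m k (A : 'M[F]_(n, m)) (B : 'M[F]_(m, n)) :
  pminors k (A *m B) = pminors k (B *m A).
Proof.
have k0 : k`!%:R != 0 :> F by rewrite pnatr_eq0 -lt0n fact_gt0.
apply: (mulfI k0); rewrite -!sum_minors_mul exchange_big /=.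
by apply: eq_bigr => g _; apply: eq_bigr => f _; rewrite mulrC.
Qed.

Lemma pminors_map (R S : comNzRingType) (h : {rmorphism R -> S}) n k (A : 'M[R]_n) :
  pminors k (map_mx h A) = h (pminors k A).
Proof.
rewrite rmorph_sum; apply: eq_bigr => f _.
by rewrite -det_map_mx; congr determinant; apply/matrixP => i j; rewrite !mxE.
Qed.

Lemma char_poly_conj (F : comUnitRingType) n (P D : 'M[F]_n) : P \in unitmx ->
  char_poly (invmx P *m D *m P) = char_poly D.
Proof.
move=> Pu; have E : map_mx polyC (invmx P) *m map_mx polyC P = 1%:M.
  by rewrite -map_mxM mulVmx // map_mx1.
rewrite /char_poly.
have -> : char_poly_mx (invmx P *m D *m P)
    = map_mx polyC (invmx P) *m char_poly_mx D *m map_mx polyC P.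
  rewrite /char_poly_mx mulmxBr mulmxBl scalar_mxC -[_ *m _ *m map_mx _ P]mulmxA E mulmx1.
  by rewrite !map_mxM.
rewrite !det_mulmx mulrAC -det_mulmx E det1 mul1r //.
Qed.

Section Spectrum.
Variable R : rcfType.
Import complex.
Local Open Scope complex_scope.
Local Open Scope sesquilinear_scope.

(** The spectral theorem is applied to the hermitian matrix [Gc] and pulled back along the embedding
    of [R]; the eigenvalues are nonnegative because [diag_mx y] has the form Z Z^*. Up to the factor
    k!, the last two sums are the traces of the k-th compound of the Gram matrix and of its square,
    written as elementary symmetric functions. *)
Lemma gram_spectrum n (A : 'M[R]_n) : exists x : 'rV[R]_n,
  [/\ forall i, 0 <= x 0 i,
      char_poly (A^T *m A) = \prod_(i < n) ('X - (x 0 i)%:P),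
      forall k, pminors k (A^T *m A) =
        \sum_(f : {ffun 'I_k -> 'I_n} | injectiveb f) \prod_i x 0 (f i) &
      forall k, pminors k ((A^T *m A) *m (A^T *m A)) =
        \sum_(f : {ffun 'I_k -> 'I_n} | injectiveb f) \prod_i (x 0 (f i)) ^+ 2].
Proof.
pose h := real_complex R.
set G := A^T *m A; pose Gc := map_mx h G; pose Ac := map_mx h A.
have hreal (u : R) : (h u) \is Num.real by apply/complex_realP; exists u.
have Greal : Gc \is a realmx by apply/mxOverP => i j; rewrite mxE.
have Gsym : Gc \is symmetricmx.
  apply/is_hermitianmxP; rewrite expr0 scale1r map_mx_id // /Gc map_trmx.
  by rewrite /G trmx_mul trmxK.
have Gherm := realsym_hermsym Gsym Greal.
have /hermitian_normalmx/orthomx_spectralP := Gherm.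
have := hermitian_spectral_diag_real Gherm.
have := spectral_unitarymx Gc; have := spectral_unit Gc.
set P := spectralmx Gc; set y := spectral_diag Gc => Pu Puni yreal GE.
have Act : Ac^T ^t* = Ac.
  by apply/matrixP => i j; rewrite !mxE (CrealP (hreal _)).
have DE : diag_mx y = (P *m Ac^T) *m (P *m Ac^T)^t*.
  rewrite trmx_mul map_mxM Act mulmxA -[P *m Ac^T *m Ac]mulmxA.
  rewrite (_ : Ac^T *m Ac = Gc); last by rewrite /Gc map_mxM map_trmx.
  by rewrite GE -(invmx_unitary Puni) !mulmxA mulmxV // mul1mx mulmxK.
have y0 i : 0 <= y 0 i.
  have /matrixP/(_ i i) := DE; rewrite !mxE eqxx mulr1n => ->.
  by apply: sumr_ge0 => j _; rewrite [X in _ * X]mxE [X in _ * X^*]mxE mul_conjC_ge0.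
have yE i : y 0 i = h (complex.Re (y 0 i)).
  have /mxOverP/(_ 0 i)/complex_realP [u uE] := yreal; by rewrite uE.
exists (\row_i complex.Re (y 0 i)); split.
- by move=> i; have := y0 i; rewrite yE mxE -[0]/(h 0) ler0c.
- apply: (map_poly_inj h); rewrite map_char_poly -/Gc GE char_poly_conj //.
  rewrite char_poly_trig; last by apply: diag_mx_is_trig.
  rewrite rmorph_prod; apply: eq_bigr => i _ /=.
  by rewrite rmorphB /= map_polyX map_polyC /= !mxE eqxx mulr1n yE.
- move=> k; apply: (fmorph_inj h); rewrite -pminors_map -/Gc GE -mulmxA pminors_mulC.
  rewrite mulmxK // pminors_diag rmorph_sum; apply: eq_bigr => f _.
  by rewrite rmorph_prod; apply: eq_bigr => i _; rewrite mxE; exact: yE.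
- move=> k; apply: (fmorph_inj h); rewrite -pminors_map map_mxM -/Gc.
  rewrite {2}GE !mulmxA -pminors_mulC GE !mulmxA mulmxV // mul1mx mulmxK //.
  rewrite mulmx_diag pminors_diag rmorph_sum; apply: eq_bigr => f _.
  rewrite rmorph_prod; apply: eq_bigr => i _.
  by rewrite !mxE expr2 rmorphM; congr (_ * _); exact: yE.
Qed.
End Spectrum.

Lemma mup_prod_XsubC (F : fieldType) (a : F) (xs : seq F) :
  mup a (\prod_(b <- xs) ('X - b%:P)) = count_mem a xs.
Proof.
elim: xs => [|b xs IH]; first by rewrite big_nil mupNroot // root1.
rewrite big_cons mupM ?polyXsubC_eq0 ?monic_neq0 ?monic_prod_XsubC //.
rewrite IH /= -[X in mup _ X]expr1 mup_XsubCX [b == a]eq_sym.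
by case: eqVneq.
Qed.

Section SingularValues.
Variable R : realType.

Lemma singular_valuesP d (A : 'M[R]_d) (x : 'rV[R]_d) :
  (forall i, 0 <= x 0 i) ->
  char_poly (A^T *m A) = \prod_(i < d) ('X - (x 0 i)%:P) ->
  perm_eq (singular_values A) [seq Num.sqrt (x 0 i) | i <- enum 'I_d].
Proof.
move=> x0 pE; set p := char_poly _ in pE.
pose xs := [seq x 0 i | i <- enum 'I_d].
have pE' : p = \prod_(b <- xs) ('X - b%:P).
  by rewrite pE big_map big_enum.
have p0 : p != 0 by rewrite pE' monic_neq0 // monic_prod_XsubC.
have rperm : perm_eq (rootsR p) (undup xs).
  apply: uniq_perm; rewrite ?undup_uniq ?uniq_roots // => a.
  by rewrite -roots_on_rootsR // mem_undup -root_prod_XsubC -pE' in_itv.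
rewrite /singular_values perm_rev.
rewrite -/p (map_comp Num.sqrt) -/xs.
rewrite -(permPr (perm_map Num.sqrt (perm_count_undup xs))).
rewrite map_flatten -map_comp.
rewrite (permPl (perm_flatten (perm_map _ rperm))).
rewrite (@eq_map _ _ _ (map Num.sqrt \o (fun a => nseq (count_mem a xs) a))) // => a.
by rewrite /= pE' mup_prod_XsubC map_nseq.
Qed.

Lemma singular_values_sorted d (A : 'M[R]_d) :
  sorted >=%R (singular_values A).
Proof.
rewrite rev_sorted; set p := char_poly _.
have : sorted <%R (rootsR p) by exact: sorted_roots.
rewrite sorted_pairwise; last exact: lt_trans.
have ge_tr : transitive (fun x y : R => y >= x) by move=> u v w; exact: le_trans.
rewrite sorted_pairwise //.
elim: (rootsR p) => //= a r IH /andP[/allP ar /IH {}IH].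
rewrite pairwise_cat IH andbT; apply/andP; split.
  apply/allrelP => u v /nseqP[-> _] /flattenP[w /mapP[b /ar ab ->]] /nseqP[-> _].
  by rewrite ler_wsqrtr // ltW.
elim: (mup a p) => //= m ->; rewrite andbT; apply/allP => u /nseqP[-> _].
exact: lexx.
Qed.
End SingularValues.

Section TopProducts.
Variables (R : realDomainType) (b : nat -> R).
Hypothesis b0 : forall i, 0 <= b i.
Hypothesis bD : forall i j, (i <= j)%N -> b j <= b i.

(** By pigeonhole, one of k + 1 distinct indices is at least k; its factor is at most [b k] and is
    split off. *)
Lemma prod_inj_le_top k (f : 'I_k -> nat) : injective f ->
  \prod_i b (f i) <= \prod_(i < k) b i.
Proof.
elim: k f => [|k IH] f finj; first by rewrite !big_ord0.
have [j jmax] : exists j, (k <= f j)%N.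
  apply: contrapT => /forallNP H.
  have lt i : (f i < k)%N by rewrite ltnNge; apply/negP/H.
  have /leq_card : injective (fun i => Ordinal (lt i)).
    by move=> i i' /(congr1 val) /= /finj.
  by rewrite !card_ord ltnn.
rewrite (bigD1_ord j) //= big_ord_recr /= mulrC ler_pM ?prodr_ge0 ?bD //.
by apply: IH => i i' /finj /lift_inj.
Qed.

Lemma prod_inj_le_top_skip k (f : 'I_k.+1 -> nat) j : injective f ->
  (k < f j)%N -> \prod_i b (f i) <= \prod_(i < k) b i * b k.+1.
Proof.
move=> finj kj; rewrite (bigD1_ord j) //= mulrC ler_pM ?prodr_ge0 ?bD //.
by apply: prod_inj_le_top => i i' /finj /lift_inj.
Qed.

Variable (d : nat).
Local Notation S1 k p := (\sum_(f : {ffun 'I_k -> 'I_d} | injectiveb f) \prod_i b (f i) ^+ p).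

Lemma sum_inj_le k : S1 k 1 <= #|{ffun 'I_k -> 'I_d}|%:R * \prod_(i < k) b i.
Proof.
rewrite mulr_natl -sumr_const.
rewrite [leRHS](bigID (fun f : {ffun 'I_k -> 'I_d} => injectiveb f)) /=.
rewrite ler_wpDr //; first by apply: sumr_ge0 => f _; exact: prodr_ge0.
apply: ler_sum => f /injectiveP finj.
by apply: (@prod_inj_le_top _ (fun i => val (f i))) => i j /val_inj/finj.
Qed.

Lemma sum_inj_ge k : (k <= d)%N -> \prod_(i < k) b i <= S1 k 1.
Proof.
move=> kd; rewrite (bigD1 [ffun i => widen_ord kd i]) /=; last first.
  by apply/injectiveP => i j; rewrite !ffunE => /(congr1 val)/= /val_inj.
rewrite ler_wpDr //; first by apply: sumr_ge0 => f _; apply: prodr_ge0 => i _; exact: exprn_ge0.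
by apply: ler_prod => i _; rewrite b0 /= ffunE.
Qed.

(** Two injections of a k-element set into {0, ..., k-1} are bijections and differ by a
    permutation. *)
Lemma inj_images_differ k (f f' : {ffun 'I_k -> 'I_d}) :
  injective f -> injective f' -> (forall s : 'S_k, f' <> [ffun i => f (s i)]) ->
  (exists j, (k <= f j)%N) \/ (exists j, (k <= f' j)%N).
Proof.
move=> finj f'inj H.
apply: contrapT => /not_orP[/forallNP h1 /forallNP h2].
have lt i : (f i < k)%N by rewrite ltnNge; apply/negP/h1.
have lt' i : (f' i < k)%N by rewrite ltnNge; apply/negP/h2.
have i1 : injective (fun i => Ordinal (lt i)).
  by move=> i i' /(congr1 val) /= /val_inj /finj.
have i2 : injective (fun i => Ordinal (lt' i)).
  by move=> i i' /(congr1 val) /= /val_inj /f'inj.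
apply: (H (perm i2 * (perm i1)^-1)%g); apply/ffunP => i; rewrite ffunE permM.
set j := ((perm i1)^-1)%g (perm i2 i); have : perm i1 j = perm i2 i by rewrite permKV.
by rewrite !permE => /(congr1 val)/= /val_inj.
Qed.

(** When the square is expanded, the pairs (f, g) with g a reordering of f give exactly the
    subtracted term. In any other pair one of the two images leaves {0, ..., k}, so its product
    misses the largest value and has [b k.+1] in place of [b k]. *)
Lemma sum_inj_off_orbit k :
  (S1 k.+1 1) ^+ 2 - k.+1`!%:R * S1 k.+1 2 <=
  #|{ffun 'I_k.+1 -> 'I_d}|%:R ^+ 2 *
    (\prod_(i < k) b i * \prod_(i < k.+2) b i).
Proof.
set n := k.+1; pose y (f : {ffun 'I_n -> 'I_d}) := \prod_i b (f i).
have y0 f : 0 <= y f by exact: prodr_ge0.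
pose B := \prod_(i < k) b i * \prod_(i < k.+2) b i.
have B0 : 0 <= B by rewrite mulr_ge0 ?prodr_ge0.
have -> : S1 n 1 = \sum_(f : {ffun 'I_n -> 'I_d} | injectiveb f) y f by [].
have -> : S1 n 2 = \sum_(f : {ffun 'I_n -> 'I_d} | injectiveb f) y f ^+ 2.
  by apply: eq_bigr => f _; rewrite prodrXl.
rewrite expr2 mulr_suml mulr_sumr -sumrB.
apply: (@le_trans _ _ (\sum_(f : {ffun 'I_n -> 'I_d} | injectiveb f)
   #|{ffun 'I_n -> 'I_d}|%:R * B)).
  apply: ler_sum => f /injectiveP finj.
  pose o (s : 'S_n) : {ffun 'I_n -> 'I_d} := [ffun i => f (s i)].
  have oinj : injective o.
    by move=> s t /ffunP E; apply/permP => i; have := E i; rewrite !ffunE => /finj.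
  have osum : \sum_(g in [set o s | s in [set: 'S_n]]) y g = n`!%:R * y f.
    rewrite big_imset; last by move=> s t _ _ /oinj.
    rewrite (eq_bigr (fun=> y f)) ?sumr_const ?cardsT ?card_Sn ?mulr_natl //=.
    move=> s _; rewrite /y [RHS](reindex_inj (@perm_inj _ s)).
    by apply: eq_bigr => i _; rewrite ffunE.
  rewrite (bigID (fun g => g \in [set o s | s in [set: 'S_n]])) /=.
  rewrite (eq_bigl (fun g => g \in [set o s | s in [set: 'S_n]])); last first.
    move=> g; apply/andb_idl => /imsetP[s _ ->]; apply/injectiveP => i j.
    by rewrite !ffunE => /finj/perm_inj.
  rewrite osum mulrDr expr2 mulrCA addrAC subrr add0r mulr_sumr.
  rewrite [leRHS]mulr_natl -[leRHS]sumr_const.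
  rewrite [leRHS](bigID (fun g : {ffun 'I_n -> 'I_d} => injectiveb g &&
     (g \notin [set o s | s in [set: 'S_n]]))) /=.
  rewrite ler_wpDr ?sumr_ge0 //; apply: ler_sum => g /andP[/injectiveP ginj gN].
  have finj' : injective (fun i => val (f i)) by move=> i j /val_inj/finj.
  have ginj' : injective (fun i => val (g i)) by move=> i j /val_inj/ginj.
  have E : B = (\prod_(i < k) b i * b k.+1) * \prod_(i < k.+1) b i.
    by rewrite /B [in LHS]big_ord_recr /=; ring.
  have [s gs|[j fj]|[j gj]] := inj_images_differ finj ginj.
  - by move: gN; rewrite gs imset_f.
  - rewrite E ler_pM ?y0 //; first exact: (prod_inj_le_top_skip finj' fj).
    exact: prod_inj_le_top.
  - rewrite E mulrC ler_pM ?y0 //; first exact: (prod_inj_le_top_skip ginj' gj).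
    exact: prod_inj_le_top.
rewrite -/B expr2 -mulrA [leRHS]mulr_natl -[leRHS]sumr_const.
rewrite [leRHS](bigID (fun f : {ffun 'I_n -> 'I_d} => injectiveb f)) /=.
by rewrite ler_wpDr // ?sumr_ge0 // => *; rewrite mulr_ge0.
Qed.
End TopProducts.

Section Kernels.
Variables (R : realType) (I : finType).
Implicit Types M N : I -> I -> R.

(** Matrices are functions on an arbitrary finite type because the compounds are indexed by
    functions ['I_k -> 'I_d]. *)
Definition kmul M N : I -> I -> R := fun f g => \sum_h M f h * N h g.
Definition nrm M : R := \sum_f \sum_g `|M f g|.

Lemma nrm_ge0 M : 0 <= nrm M.
Proof. by do 2!apply: sumr_ge0 => ? _. Qed.

Lemma le_nrm M f g : `|M f g| <= nrm M.
Proof.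
rewrite /nrm (bigD1 f) //= (bigD1 g) //= -addrA ler_wpDr // addr_ge0 //.
  exact: sumr_ge0.
by do 2!apply: sumr_ge0 => ? _.
Qed.

Lemma nrm_le M x : (forall f g, `|M f g| <= x) -> nrm M <= #|I|%:R ^+ 2 * x.
Proof.
move=> H; apply: (@le_trans _ _ (\sum_(f : I) \sum_(g : I) x)).
  by apply: ler_sum => f _; apply: ler_sum => g _.
by rewrite !sumr_const -mulrnA -[leLHS]mulr_natl natrM expr2.
Qed.

Lemma nrm_kmul M N : nrm (kmul M N) <= nrm M * nrm N.
Proof.
apply: (@le_trans _ _ (\sum_f \sum_g \sum_h `|M f h| * `|N h g|)).
  apply: ler_sum => f _; apply: ler_sum => g _.
  by rewrite (le_trans (ler_norm_sum _ _ _)) //; apply: ler_sum => h _; rewrite normrM.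
rewrite /nrm mulr_suml; apply: ler_sum => f _.
rewrite exchange_big mulr_suml; apply: ler_sum => h _.
rewrite -mulr_sumr ler_wpM2l // [leRHS](bigD1 h) //= ler_wpDr //.
by do 2!apply: sumr_ge0 => ? _.
Qed.

End Kernels.

Section Compound.
Variables (R : realType) (d : nat).
Implicit Types A B : 'M[R]_d.

(* The division by k! makes cmp k multiplicative although every k-subset is
   indexed by its k! orderings. *)
Definition cmp k A (f g : {ffun 'I_k -> 'I_d}) : R :=
  \det (mxsub f g A) / k`!%:R.

Definition cnorm k A : R := nrm (cmp (k := k) A).

Definition sv A i : R := (singular_values A)`_i.
Definition top k A : R := \prod_(i < k) sv A i.

Lemma factr_gt0 k : 0 < k`!%:R :> R.
Proof. by rewrite ltr0n fact_gt0. Qed.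

Lemma cmp_mul k A B : cmp (k := k) (A *m B) = kmul (cmp A) (cmp B).
Proof.
apply/funext => f; apply/funext => g; rewrite /kmul /cmp.
under eq_bigr do rewrite mulrACA.
rewrite -mulr_suml cauchy_binet; have /lt0r_neq0 := factr_gt0 k.
by move=> k0; field.
Qed.

Lemma cnorm_ge0 k A : 0 <= cnorm k A. Proof. exact: nrm_ge0. Qed.

Lemma cnorm_mul k A B : cnorm k (A *m B) <= cnorm k A * cnorm k B.
Proof. by rewrite /cnorm cmp_mul nrm_kmul. Qed.

Lemma cnorm0 A : cnorm 0 A = 1.
Proof.
have E : forall f g : {ffun 'I_0 -> 'I_d}, `|cmp A f g| = 1.
  by move=> f g; rewrite /cmp det_mx00 fact0 divr1 normr1.
rewrite /cnorm /nrm; under eq_bigr do under eq_bigr do rewrite E.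
have E1 : #|{: {ffun 'I_0 -> 'I_d}}| = 1%N by rewrite card_ffun !card_ord expn0.
by rewrite !sumr_const !E1.
Qed.

Lemma noninj_ffun k (f : {ffun 'I_k -> 'I_d}) : (d < k)%N -> ~~ injectiveb f.
Proof.
by move=> dk; apply/negP => /injectiveP/leq_card; rewrite !card_ord leqNgt dk.
Qed.

Lemma cnorm_gt k A : (d < k)%N -> cnorm k A = 0.
Proof.
move=> dk; rewrite /cnorm /nrm big1 // => f _; rewrite big1 // => g _.
by rewrite /cmp det_mxsub_noninj ?noninj_ffun // mul0r normr0.
Qed.

(** Symmetric functions do not see the order of the eigenvalues, so they can be rewritten with the
    sorted list [singular_values]. Beyond d the default value makes [sv] zero. *)
Lemma gram_sv A : [/\ size (singular_values A) = d, forall i, 0 <= sv A i,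
  forall k, pminors k (A^T *m A) =
    \sum_(f : {ffun 'I_k -> 'I_d} | injectiveb f) \prod_i (sv A (f i) ^+ 2) ^+ 1 &
  forall k, pminors k ((A^T *m A) *m (A^T *m A)) =
    \sum_(f : {ffun 'I_k -> 'I_d} | injectiveb f) \prod_i (sv A (f i) ^+ 2) ^+ 2].
Proof.
have [x [x0 xc xe xe2]] := gram_spectrum A.
pose t := [tuple Num.sqrt (x 0 i) | i < d].
have tE : tval t = [seq Num.sqrt (x 0 i) | i <- enum 'I_d] by [].
have /tuple_permP[p pE] : perm_eq (singular_values A) t.
  by rewrite tE; exact: singular_valuesP.
have size_sv : size (singular_values A) = d by rewrite pE size_tuple.
have svE (i : 'I_d) : sv A i = Num.sqrt (x 0 (p i)).
  rewrite /sv pE -[_`_i]/(nth 0 [tuple tnth t (p j) | j < d] i) -tnth_nth.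
  by rewrite !tnth_mktuple.
have sv2 (i : 'I_d) : sv A i ^+ 2 = x 0 (p i) by rewrite svE sqr_sqrtr.
have reix k (F : R -> R) :
    \sum_(f : {ffun 'I_k -> 'I_d} | injectiveb f) \prod_i F (x 0 (f i)) =
    \sum_(f : {ffun 'I_k -> 'I_d} | injectiveb f) \prod_i F (sv A (f i) ^+ 2).
  have oinj : injective (fun f : {ffun 'I_k -> 'I_d} => [ffun i => p (f i)]).
    by move=> f g /ffunP E; apply/ffunP => i; have := E i; rewrite !ffunE => /perm_inj.
  rewrite (reindex_inj oinj) /=; apply: eq_big => [f|f _].
    apply/injectiveP/injectiveP => H i j; last by rewrite !ffunE => /perm_inj/H.
    by move=> E; apply: H; rewrite !ffunE E.
  by apply: eq_bigr => i _; rewrite sv2 ffunE.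
split=> //.
- move=> i; have [id|di] := ltnP i d; last by rewrite /sv nth_default // size_sv.
  by rewrite (svE (Ordinal id)) sqrtr_ge0.
- by move=> k; rewrite xe (reix k id).
- by move=> k; rewrite xe2 (reix k (fun u => u ^+ 2)).
Qed.

Lemma size_singular_values A : size (singular_values A) = d.
Proof. by case: (gram_sv A). Qed.

Lemma sv_ge0 A i : 0 <= sv A i.
Proof. by case: (gram_sv A). Qed.

Lemma sv_le A i j : (i <= j)%N -> sv A j <= sv A i.
Proof.
move=> ij; have [jd|dj] := ltnP j d; last first.
  by rewrite /sv nth_default ?size_singular_values // sv_ge0.
have := singular_values_sorted A.
have ge_tr : transitive (fun x y : R => y <= x) by move=> u v w uv vw; exact: le_trans vw uv.
have ge_rf : reflexive (fun x y : R => y <= x) by [].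
move/(sorted_leq_nth ge_tr ge_rf 0); apply => //.
  by rewrite inE size_singular_values (leq_ltn_trans ij).
by rewrite inE size_singular_values.
Qed.

Lemma top_ge0 k A : 0 <= top k A.
Proof. by apply: prodr_ge0 => i _; exact: sv_ge0. Qed.

Lemma top_gt k A : (d < k)%N -> top k A = 0.
Proof.
case: k => // k dk; rewrite /top big_ord_recr /= /sv nth_default ?mulr0 //.
by rewrite size_singular_values.
Qed.

Lemma topS k A : top k.+1 A = top k A * sv A k.
Proof. by rewrite /top big_ord_recr. Qed.

Lemma sv2_ge0 A i : 0 <= sv A i ^+ 2. Proof. by rewrite exprn_ge0 ?sv_ge0. Qed.
Lemma sv2_le A i j : (i <= j)%N -> sv A j ^+ 2 <= sv A i ^+ 2.
Proof. by move=> ij; rewrite ler_pXn2r ?nnegrE ?sv_ge0 ?sv_le. Qed.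

Lemma prod_sv2 k A : \prod_(i < k) sv A i ^+ 2 = top k A ^+ 2.
Proof. by rewrite prodrXl. Qed.

Lemma sum_minors2 k A :
  \sum_(f : {ffun 'I_k -> 'I_d}) \sum_(g : {ffun 'I_k -> 'I_d})
    \det (mxsub f g A) ^+ 2 = k`!%:R * pminors k (A^T *m A).
Proof.
rewrite -sum_minors_mul exchange_big; apply: eq_bigr => g _ /=.
apply: eq_bigr => f _; rewrite expr2; congr (_ * _).
by rewrite -[LHS]det_tr; congr determinant; apply/matrixP => i j; rewrite !mxE.
Qed.

Lemma sqr_nrm_le (I : finType) (M : I -> I -> R) :
  \sum_f \sum_g M f g ^+ 2 <= nrm M ^+ 2 /\
  nrm M <= #|I|%:R ^+ 2 * Num.sqrt (\sum_f \sum_g M f g ^+ 2).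
Proof.
split.
  rewrite expr2 /nrm pair_big /= [X in X * _]pair_big /= mulr_suml.
  rewrite pair_big /=; apply: ler_sum => i _.
  rewrite -real_normK ?num_real // expr2 ler_wpM2l //.
  by rewrite [leRHS](bigD1 i) //= ler_wpDr //; exact: sumr_ge0.
apply: nrm_le => f g; rewrite -[leLHS]normr_id -sqrtr_sqr ler_sqrt; last first.
  by do 2!apply: sumr_ge0 => ? _; rewrite sqr_ge0.
rewrite real_normK ?num_real // (bigD1 f) //= (bigD1 g) //= -addrA ler_wpDr // addr_ge0 //.
  by apply: sumr_ge0 => *; rewrite sqr_ge0.
by do 2!apply: sumr_ge0 => ? _; rewrite sqr_ge0.
Qed.

End Compound.

Section Comparison.
Variables (R : realType) (d : nat).
Implicit Types A B : 'M[R]_d.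
Local Notation F k := {ffun 'I_k -> 'I_d}.

Lemma sum_cmp2 k A : \sum_(f : F k) \sum_(g : F k) cmp A f g ^+ 2 =
  (\sum_(f : F k | injectiveb f) \prod_i (sv A (f i) ^+ 2) ^+ 1) / k`!%:R.
Proof.
have [_ _ <- _] := gram_sv A; have /lt0r_neq0 k0 := factr_gt0 R k.
have -> : pminors k (A^T *m A) / k`!%:R = k`!%:R * pminors k (A^T *m A) / k`!%:R ^+ 2.
  by field.
rewrite -sum_minors2 mulr_suml; apply: eq_bigr => f _; rewrite mulr_suml.
by apply: eq_bigr => g _; rewrite /cmp exprMn exprVn.
Qed.

(** By [sum_cmp2] the squared entries of the compound sum to S1 / k!, where S1 lies between the
    square of [top] and a cardinal times it; the l1 norm and the Hilbert-Schmidt norm differ by a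
    bounded factor. For k > d both quantities vanish. *)
Lemma cnorm_top k : exists2 C : R, 1 <= C &
  forall A, top k A <= C * cnorm k A /\ cnorm k A <= C * top k A.
Proof.
pose n : R := #|{: F k}|%:R; pose C := Num.max k`!%:R (Num.max 1 (n ^+ 3)).
exists C; first by rewrite !le_max lexx orbT.
move=> A; have [kd|dk] := leqP k d; last by rewrite cnorm_gt // top_gt // !mulr0.
have [lo hi] := sqr_nrm_le (cmp (k := k) A).
have k1 : 1 <= k`!%:R :> R by rewrite ler1n fact_gt0.
have n0 : 0 <= n by exact: ler0n.
have S1ge := sum_inj_ge (sv2_ge0 A) kd.
have S1le := sum_inj_le (sv2_ge0 A) (@sv2_le _ _ A) d k.
rewrite sum_cmp2 !prod_sv2 in lo hi S1ge S1le.
move: lo hi S1ge S1le; set S1 := \sum_(_ | _) _; rewrite -/n -/(cnorm k A) => lo hi S1ge S1le.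
split.
  apply: (@le_trans _ _ (k`!%:R * cnorm k A)); last first.
    by rewrite ler_wpM2r ?cnorm_ge0 // le_max lexx.
  rewrite -(@ler_pXn2r _ 2) ?nnegrE ?top_ge0 ?mulr_ge0 ?cnorm_ge0 ?ler0n //.
  rewrite exprMn; apply: (le_trans S1ge).
  rewrite ler_pdivrMr ?factr_gt0 // in lo; apply: (le_trans lo).
  rewrite mulrC ler_wpM2r ?sqr_ge0 // expr2 ler_peMl // ler0n.
apply: (@le_trans _ _ (n ^+ 3 * top k A)); last first.
  by rewrite ler_wpM2r ?top_ge0 // !le_max lexx !orbT.
apply: (le_trans hi); rewrite -/n.
rewrite (_ : n ^+ 3 * _ = n ^+ 2 * (n * top k A)); last by rewrite exprSr mulrA.
rewrite ler_wpM2l ?sqr_ge0 //.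
rewrite -(@ler_pXn2r _ 2) ?nnegrE ?sqrtr_ge0 ?mulr_ge0 ?top_ge0 //.
rewrite sqr_sqrtr ?divr_ge0 ?ler0n //; last by rewrite (le_trans _ S1ge) ?sqr_ge0.
rewrite ler_pdivrMr ?factr_gt0 // exprMn.
apply: (le_trans S1le).
have [->|nN0] := eqVneq n 0; first by rewrite !mul0r expr0n /= mul0r.
have n1 : 1 <= n by rewrite /n ler1n lt0n -(eqr_nat R).
rewrite -[leLHS]mulr1 ler_pM ?mulr_ge0 ?top_ge0 ?sqr_ge0 //.
by rewrite ler_wpM2r ?sqr_ge0 // expr2 ler_peMl.
Qed.

Lemma lagrange (I : finType) (a b : I -> R) :
  \sum_f \sum_f' (a f * b f' - b f * a f') ^+ 2 =
  2 * ((\sum_f a f ^+ 2) * (\sum_f b f ^+ 2) - (\sum_f a f * b f) ^+ 2).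
Proof.
transitivity (\sum_f \sum_f' (a f ^+ 2 * b f' ^+ 2) + \sum_f \sum_f' (b f ^+ 2 * a f' ^+ 2)
   - 2 * \sum_f \sum_f' (a f * b f) * (a f' * b f')).
  rewrite mulr_sumr -big_split -sumrB; apply: eq_bigr => f _ /=.
  rewrite mulr_sumr -big_split -sumrB; apply: eq_bigr => f' _ /=; ring.
have E (u v : I -> R) : \sum_f \sum_f' u f * v f' = (\sum_f u f) * (\sum_f v f).
  by rewrite mulr_suml; apply: eq_bigr => f _; rewrite mulr_sumr.
by rewrite !E; ring.
Qed.

(** Lagrange's identity turns the sum of the squares of all 2 x 2 minors of the compound into a
    multiple of S1^2 - (k+1)! S2. The contribution of the dominant singular value of the compound
    cancels there, and [sum_inj_off_orbit] bounds the rest. So a k+1-st compound is close to rank 1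
    as soon as its squared norm dominates the product of the neighbouring norms. *)
Lemma cmp_minor2 k : exists2 C : R, 0 <= C & forall A (f f' g g' : F k.+1),
  `|cmp A f g * cmp A f' g' - cmp A f g' * cmp A f' g| <=
  C * (cnorm k A * cnorm k.+2 A).
Proof.
pose n : R := #|{: F k.+1}|%:R.
have [C1 C11 H1] := cnorm_top k; have [C2 C21 H2] := cnorm_top k.+2.
have n0 : 0 <= n by exact: ler0n.
have C10 := le_trans ler01 C11; have C20 := le_trans ler01 C21.
exists (2 * n * (C1 * C2)); first by rewrite !mulr_ge0.
move=> A f f' g g'.
have {}H1 := (H1 A).1; have {}H2 := (H2 A).1.
have t1 := top_ge0 k A; have t2 := top_ge0 k.+2 A.
apply: (@le_trans _ _ (2 * n * (top k A * top k.+2 A))); last first.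
  rewrite -[leRHS]mulrA ler_wpM2l ?mulr_ge0 // [leRHS]mulrACA ler_pM //.
rewrite -(@ler_pXn2r _ 2) ?nnegrE ?mulr_ge0 // real_normK ?num_real //.
pose T := \sum_(g : F k.+1) \sum_(g' : F k.+1) \sum_f \sum_f'
   (cmp A f g * cmp A f' g' - cmp A f g' * cmp A f' g) ^+ 2.
apply: (@le_trans _ _ T).
  rewrite /T (bigD1 g) //= (bigD1 g') //= (bigD1 f) //= (bigD1 f') //= -!addrA.
  by rewrite lerDl !addr_ge0 //; do ?[apply: sumr_ge0 => ? _]; rewrite ?sqr_ge0.
have [_ _ _ e2] := gram_sv A.
have /lt0r_neq0 k0 := factr_gt0 R k.+1.
pose S1 := \sum_(f : F k.+1 | injectiveb f) \prod_i (sv A (f i) ^+ 2) ^+ 1.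
pose S2 := \sum_(f : F k.+1 | injectiveb f) \prod_i (sv A (f i) ^+ 2) ^+ 2.
have TE : T = 2 / k.+1`!%:R ^+ 2 * (S1 ^+ 2 - k.+1`!%:R * S2).
  transitivity (2 * ((\sum_(f : F k.+1) \sum_(g : F k.+1) cmp A f g ^+ 2) ^+ 2 -
     k.+1`!%:R * S2 / k.+1`!%:R ^+ 2)); last first.
    by rewrite sum_cmp2 -/S1; field.
  rewrite /T; under eq_bigr do under eq_bigr do rewrite (lagrange (cmp A ^~ _) (cmp A ^~ _)).
  under eq_bigr do rewrite -mulr_sumr; rewrite -mulr_sumr; congr (_ * _).
  under eq_bigr do rewrite sumrB; rewrite sumrB; congr (_ - _).
    rewrite [in RHS]exchange_big expr2 mulr_suml; apply: eq_bigr => h _.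
    by rewrite -mulr_sumr.
  rewrite /S2 -e2 -sum_minors_mul mulr_suml; apply: eq_bigr => h _.
  rewrite mulr_suml; apply: eq_bigr => h' _.
  have E h1 h2 : \sum_(f : F k.+1) cmp A f h1 * cmp A f h2 =
     \det (mxsub h1 h2 (A^T *m A)) / k.+1`!%:R.
    apply: (mulfI k0); apply: (mulfI k0).
    transitivity (k.+1`!%:R * \det (mxsub h1 h2 (A^T *m A))); last by field.
    rewrite -cauchy_binet !mulr_sumr; apply: eq_bigr => f0 _.
    rewrite -[\det (mxsub h1 f0 _)]det_tr (_ : (mxsub h1 f0 A^T)^T = mxsub f0 h1 A).
      by rewrite /cmp; field.
    by apply/matrixP => i j; rewrite !mxE.
  have E' : \sum_(f : F k.+1) cmp A f h * cmp A f h' =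
     \det (mxsub h' h (A^T *m A)) / k.+1`!%:R.
    by rewrite -E; apply: eq_bigr => f0 _; rewrite mulrC.
  by rewrite [LHS]expr2 {1}E E'; field.
have := sum_inj_off_orbit (sv2_ge0 A) (@sv2_le _ _ A) d k.
rewrite -/S1 -/S2 -/n !prod_sv2 => S12.
rewrite TE; apply: (@le_trans _ _ (2 * (n ^+ 2 * (top k A ^+ 2 * top k.+2 A ^+ 2)))).
  have k1 : 1 <= k.+1`!%:R :> R by rewrite ler1n fact_gt0.
  have W0 : 0 <= n ^+ 2 * (top k A ^+ 2 * top k.+2 A ^+ 2) by rewrite !mulr_ge0 ?sqr_ge0.
  rewrite -mulrA ler_wpM2l // mulrC ler_pdivrMr ?exprn_gt0 ?factr_gt0 //.
  apply: (le_trans S12); rewrite ler_peMr // exprn_ege1 //.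
rewrite (_ : (2 * n * (top k A * top k.+2 A)) ^+ 2 = 4 * (n ^+ 2 * (top k A ^+ 2 * top k.+2 A ^+ 2))); last by ring.
by rewrite ler_wpM2r ?mulr_ge0 ?sqr_ge0 // ler_nat.
Qed.

(** In terms of [top] this is [sv A k.+1 <= sv A k]. It makes ln (cnorm k A) concave in k up to a
    constant. *)
Lemma cnorm_logconcave k : exists2 C : R, 1 <= C & forall A,
  cnorm k A * cnorm k.+2 A <= C * cnorm k.+1 A ^+ 2.
Proof.
have [C1 C11 H1] := cnorm_top k; have [C2 C21 H2] := cnorm_top k.+2.
have [C3 C31 H3] := cnorm_top k.+1.
have C10 := le_trans ler01 C11; have C20 := le_trans ler01 C21.
have C30 := le_trans ler01 C31.
exists (C1 * C2 * C3 ^+ 2) => [|A]; first by rewrite !mulr_ege1 ?exprn_ege1.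
have {}H1 := (H1 A).2; have {}H2 := (H2 A).2; have {}H3 := (H3 A).1.
have t1 := top_ge0 k A; have t2 := top_ge0 k.+2 A; have t3 := top_ge0 k.+1 A.
apply: (@le_trans _ _ (C1 * C2 * top k.+1 A ^+ 2)); last first.
  rewrite -[leRHS]mulrA ler_wpM2l ?mulr_ge0 // -exprMn ler_pXn2r ?nnegrE //.
  by rewrite mulr_ge0 ?cnorm_ge0.
apply: (@le_trans _ _ ((C1 * top k A) * (C2 * top k.+2 A))).
  by rewrite ler_pM ?cnorm_ge0.
rewrite mulrACA ler_wpM2l ?mulr_ge0 // !topS expr2.
have := sv_le A (leqnSn k); have := sv_ge0 A k; have := sv_ge0 A k.+1.
move=> s1 s0 s10; rewrite !mulrA [X in X * sv A k.+1]mulrAC.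
by rewrite ler_wpM2l ?mulr_ge0.
Qed.

Lemma cnormS_le k : exists2 C : R, 1 <= C & forall A,
  cnorm k.+1 A <= C * (cnorm k A * cnorm 1 A).
Proof.
have [C1 C11 H1] := cnorm_top k; have [C2 C21 H2] := cnorm_top 1.
have [C3 C31 H3] := cnorm_top k.+1.
have C10 := le_trans ler01 C11; have C20 := le_trans ler01 C21.
have C30 := le_trans ler01 C31.
exists (C3 * (C1 * C2)) => [|A]; first by rewrite !mulr_ege1.
have {}H1 := (H1 A).1; have {}H2 := (H2 A).1; have {}H3 := (H3 A).2.
apply: (le_trans H3); rewrite -mulrA ler_wpM2l // mulrACA topS.
have -> : sv A k <= top 1 A -> top k A * sv A k <= C1 * cnorm k A * (C2 * cnorm 1 A).
  by move=> h; rewrite ler_pM ?top_ge0 ?sv_ge0 // (le_trans h).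
by [].
by rewrite /top big_ord1 sv_le.
Qed.
End Comparison.

(** * Products of matrices close to rank 1 *)

Section RankOne.
Variables (R : realType) (I : finType).
Implicit Types (M N : I -> I -> R) (u v x : I -> R).
Local Notation D := (#|I|%:R : R).

Definition dot v x : R := \sum_h v h * x h.
Definition app M x : I -> R := fun f => \sum_g M f g * x g.
Definition sub1 u := forall f, `|u f| <= 1.

(** The error is relative to the norm and the vectors are bounded independently of it, so that
    matrices of different norms can share the same [u] and [v]. *)
Definition near_rank1 M u v (t : R) :=
  [/\ sub1 u, sub1 v & forall f g, `|M f g - nrm M * (u f * v g)| <= nrm M * t].

Lemma app_kmul M N x : app (kmul M N) x = app M (app N x).
Proof.
apply/funext => f; rewrite /app /kmul.
under eq_bigr do rewrite mulr_suml.
rewrite exchange_big; apply: eq_bigr => h _ /=.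
by rewrite mulr_sumr; apply: eq_bigr => g _; rewrite mulrA.
Qed.

Lemma dot_le v x X : sub1 v -> (forall f, `|x f| <= X) -> `|dot v x| <= D * X.
Proof.
move=> v1 xX; apply: (le_trans (ler_norm_sum _ _ _)).
rewrite mulr_natl -sumr_const; apply: ler_sum => h _.
by rewrite normrM -[leRHS]mul1r ler_pM.
Qed.

Lemma dot_app_le v M x : sub1 v -> sub1 x -> `|dot v (app M x)| <= nrm M.
Proof.
move=> v1 x1; apply: (le_trans (ler_norm_sum _ _ _)); apply: ler_sum => f _.
rewrite normrM -[leRHS]mul1r ler_pM // (le_trans (ler_norm_sum _ _ _)) //.
by apply: ler_sum => g _; rewrite normrM -[leRHS]mulr1 ler_pM.
Qed.

Lemma near_rank1_le M u v t t' : t <= t' -> near_rank1 M u v t -> near_rank1 M u v t'.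
Proof.
move=> tt' [? ? H]; split=> // f g; apply: (le_trans (H f g)).
by rewrite ler_wpM2l ?nrm_ge0.
Qed.

(** The pivot is an entry [mu] of largest modulus. Subtracting the product of its column and its
    row, divided by [mu], leaves a 2 x 2 minor over [mu], and [mu] is comparable to the norm. *)
Lemma near_rank1_minor2 M Q : 0 < nrm M ->
  (forall f f' g g', `|M f g * M f' g' - M f g' * M f' g| <= Q) ->
  exists u v, near_rank1 M u v (D ^+ 2 * Q / nrm M ^+ 2).
Proof.
move=> M0 HQ.
have [p0 pmax] : exists p0 : I * I, forall f g, `|M f g| <= `|M p0.1 p0.2|.
  have [p0 _|I0] := pickP (fun _ : I * I => true); last first.
    move: M0; rewrite /nrm big1 ?ltxx // => f _; rewrite big1 // => g _.
    by have := I0 (f, g).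
  exists [arg max_(p > p0) `|M p.1 p.2|]%O => f g; case: arg_maxP => // i _ H.
  exact: (H (f, g)).
case: p0 pmax => f0 g0 /= pmax; set mu := M f0 g0 in pmax.
have mubig : nrm M <= D ^+ 2 * `|mu| by exact: nrm_le.
have mu0 : 0 < `|mu|.
  by rewrite normr_gt0; apply: contraTneq M0 => mu0; rewrite -leNgt (le_trans mubig) // mu0 normr0 mulr0.
have muN : mu != 0 by rewrite -normr_gt0.
have /lt0r_neq0 MN := M0.
exists (fun f => M f g0 / nrm M), (fun g => M f0 g / mu); split.
- by move=> f; rewrite normrM normfV (gtr0_norm M0) ler_pdivrMr // mul1r le_nrm.
- by move=> g; rewrite normrM normfV ler_pdivrMr // mul1r.
move=> f g; have -> : M f g - nrm M * (M f g0 / nrm M * (M f0 g / mu)) =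
    (M f g * M f0 g0 - M f g0 * M f0 g) / mu by rewrite -/mu; field; rewrite muN MN.
rewrite normrM normfV ler_pdivrMr // (le_trans (HQ _ _ _ _)) //.
have Q0 : 0 <= Q by apply: le_trans (HQ f f g g).
rewrite (_ : _ * _ * `|mu| = Q * (D ^+ 2 * `|mu| / nrm M)); last by field.
by rewrite ler_peMr // ler_pdivlMr // mul1r.
Qed.

(** The main part of an entry of the product is a multiple of [dot v1 u2]; the three cross terms
    with an error cost at most t each, at every one of the D summation indices. *)
Lemma pairing_of_product M1 M2 u1 v1 u2 v2 t z : 0 < nrm M1 -> 0 < nrm M2 ->
  t <= 1 -> near_rank1 M1 u1 v1 t -> near_rank1 M2 u2 v2 t ->
  z * (nrm M1 * nrm M2) <= nrm (kmul M1 M2) ->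
  z <= D ^+ 2 * (`|dot v1 u2| + 3 * D * t).
Proof.
move=> n1 n2 t1 [a1 b1 H1] [a2 b2 H2] H.
have n12 := mulr_gt0 n1 n2.
rewrite -(ler_pM2r n12); apply: (le_trans H); rewrite -[leRHS]mulrA.
apply: nrm_le => f g.
pose e1 h := M1 f h - nrm M1 * (u1 f * v1 h).
pose e2 h := M2 h g - nrm M2 * (u2 h * v2 g).
have -> : kmul M1 M2 f g = nrm M1 * nrm M2 * (u1 f * dot v1 u2 * v2 g) +
   \sum_h (nrm M1 * (u1 f * v1 h) * e2 h + e1 h * (nrm M2 * (u2 h * v2 g)) + e1 h * e2 h).
  rewrite /kmul /dot mulr_sumr mulr_suml mulr_sumr -big_split; apply: eq_bigr => h _ /=.
  by rewrite /e1 /e2; ring.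
rewrite mulrDl (le_trans (ler_normD _ _)) // lerD //.
  rewrite mulrC normrM (gtr0_norm n12) ler_wpM2r ?(ltW n12) //.
  rewrite !normrM -[leRHS]mulr1 ler_pM ?mulr_ge0 // -[leRHS]mul1r ler_pM //.
apply: (le_trans (ler_norm_sum _ _ _)).
rewrite (_ : 3 * D * t * _ = D * (3 * t * (nrm M1 * nrm M2))); last by ring.
rewrite mulr_natl -sumr_const; apply: ler_sum => h _.
have h1 := H1 f h; have h2 := H2 h g; rewrite -/(e1 h) -/(e2 h) in h1 h2.
have t0 : 0 <= t by have := le_trans (normr_ge0 _) h1; rewrite pmulr_rge0.
have q1 : `|nrm M1 * (u1 f * v1 h)| <= nrm M1.
  rewrite normrM (gtr0_norm n1) ler_piMr ?(ltW n1) // normrM.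
  by rewrite -[leRHS]mulr1 ler_pM.
have q2 : `|nrm M2 * (u2 h * v2 g)| <= nrm M2.
  rewrite normrM (gtr0_norm n2) ler_piMr ?(ltW n2) // normrM.
  by rewrite -[leRHS]mulr1 ler_pM.
have -> : 3 * t * (nrm M1 * nrm M2) = nrm M1 * (nrm M2 * t) + nrm M1 * t * nrm M2
   + nrm M1 * t * nrm M2 by ring.
rewrite (le_trans (ler_normD _ _)) // lerD //.
  rewrite (le_trans (ler_normD _ _)) // lerD // normrM ler_pM //.
rewrite normrM ler_pM // (le_trans h2) // ler_piMr // ltW //.
Qed.

Section Chain.
Variables (M : nat -> I -> I -> R) (u v : nat -> I -> R) (r : nat) (k t : R).
Hypotheses (k0 : 0 < k) (k1 : k <= 1) (kt : 8 * D ^+ 2 * t <= k ^+ 2).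
Hypothesis Hr1 : forall i, (i < r)%N -> near_rank1 (M i.+1) (u i.+1) (v i.+1) t.
Hypothesis Hpos : forall i, (i < r)%N -> 0 < nrm (M i.+1).
Hypotheses (Hu0 : sub1 (u 0)) (Hv : sub1 (v r.+1)).
Hypothesis Hk : forall i, (i <= r)%N -> k <= `|dot (v i.+1) (u i)|.

Fixpoint orbit_vec i : I -> R :=
  if i is j.+1 then app (M i) (orbit_vec j) else u 0.

(** The invariant says that the vector pairs with the next [v] by at least k/2 times its own size X.
    Writing s for this pairing, one has X <= 2 s / k, so 8 D^2 t <= k^2 keeps the error of the next
    step below a quarter of k s times the norm; since k <= 1 the pairing 3 k / 4 that remains
    restores the invariant. *)
Lemma chain_aux i : (i <= r)%N -> exists X : R,
  [/\ forall f, `|orbit_vec i f| <= X, k / 2 * X <= `|dot (v i.+1) (orbit_vec i)| &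
  k * \prod_(j < i) (nrm (M j.+1) * (k / 2)) <= `|dot (v i.+1) (orbit_vec i)|].
Proof.
have k0' := k0; have k1' := k1.
elim: i => [_|i IH ir].
  exists 1; split; [exact: Hu0 | rewrite mulr1 | by rewrite big_ord0 mulr1 Hk].
  apply: (le_trans _ (Hk (leq0n r))); lra.
have [X [xX sX s0]] := IH (ltnW ir); set x := orbit_vec i in xX sX s0.
set s := `|dot (v i.+1) x| in sX s0.
have [a1 b1 H] := Hr1 ir; have n0 := Hpos ir.
have b2 : sub1 (v i.+2).
  by move: (ir); rewrite leq_eqVlt => /predU1P[->//|/Hr1[]].
have D0 : 0 <= D by exact: ler0n.
have t0 : 0 < s -> 0 <= t.
  move=> _; have [f _|I0] := pickP (@predT I).
    by have := le_trans (normr_ge0 _) (H f f); rewrite pmulr_rge0.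
  by move: n0; rewrite /nrm big1 ?ltxx // => f _; have := I0 f.
have s_gt0 : 0 < s.
  apply: lt_le_trans s0; rewrite mulr_gt0 // prodr_gt0 // => j _.
  by rewrite mulr_gt0 ?Hpos ?(ltn_trans _ ir) // divr_gt0.
have {}t0 := t0 s_gt0.
pose e f := \sum_g (M i.+1 f g - nrm (M i.+1) * (u i.+1 f * v i.+1 g)) * x g.
have eB f : D * `|e f| <= nrm (M i.+1) * (s * (k / 4)).
  have e1 : `|e f| <= D * (nrm (M i.+1) * t * X).
    apply: (le_trans (ler_norm_sum _ _ _)); rewrite mulr_natl -sumr_const.
    by apply: ler_sum => g _; rewrite normrM ler_pM.
  apply: (le_trans (ler_wpM2l D0 e1)).
  rewrite (_ : D * (D * (nrm (M i.+1) * t * X)) = nrm (M i.+1) * (D ^+ 2 * t * X)); last by ring.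
  rewrite ler_wpM2l ?(ltW n0) //.
  have X0 : 0 <= D ^+ 2 * t * X -> D ^+ 2 * t * X <= s * (k / 4).
    move=> _; have XX : X <= 2 / k * s.
      by rewrite -ler_pdivrMl ?divr_gt0 // invf_div.
    apply: (@le_trans _ _ (D ^+ 2 * t * (2 / k * s))).
      by rewrite ler_wpM2l // mulr_ge0 ?sqr_ge0.
    rewrite (_ : _ * (2 / k * s) = (8 * D ^+ 2 * t) * (s / (4 * k))); last first.
      by field; rewrite gt_eqF.
    apply: (@le_trans _ _ (k ^+ 2 * (s / (4 * k)))).
      by rewrite ler_wpM2r // divr_ge0 ?(ltW s_gt0) // mulr_ge0 // ltW.
    by rewrite le_eqVlt; apply/orP; left; apply/eqP; field; rewrite gt_eqF.
  have [|/ltW neg] := leP 0 (D ^+ 2 * t * X); first exact: X0.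
  by rewrite (le_trans neg) // mulr_ge0 ?(ltW s_gt0) // divr_ge0 // ltW.
have D1 : 1 <= D.
  rewrite ler1n; apply/card_gt0P.
  have [f _|I0] := pickP (@predT I); first by exists f.
  by move: n0; rewrite /nrm big1 ?ltxx // => f _; have := I0 f.
have eB1 f : `|e f| <= nrm (M i.+1) * (s * (k / 4)).
  by apply: le_trans (eB f); rewrite ler_peMl.
have xE f : orbit_vec i.+1 f = nrm (M i.+1) * u i.+1 f * dot (v i.+1) x + e f.
  rewrite /= /app /dot /e mulr_sumr -big_split; apply: eq_bigr => g _ /=.
  by rewrite -/x; ring.
have dE : `|dot (v i.+2) (orbit_vec i.+1)| >= nrm (M i.+1) * s * (3 / 4 * k).
  have -> : dot (v i.+2) (orbit_vec i.+1) =
     nrm (M i.+1) * dot (v i.+1) x * dot (v i.+2) (u i.+1) + dot (v i.+2) e.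
    rewrite {1 3 4}/dot mulr_sumr -big_split; apply: eq_bigr => f _.
    by rewrite xE [RHS]/=; ring.
  have de : `|dot (v i.+2) e| <= nrm (M i.+1) * (s * (k / 4)).
    apply: (le_trans (ler_norm_sum _ _ _)).
    apply: (@le_trans _ _ (\sum_(f : I) D^-1 * (nrm (M i.+1) * (s * (k / 4))))).
      apply: ler_sum => f _; rewrite normrM ler_pdivlMl ?(lt_le_trans ltr01 D1) //.
      by rewrite (le_trans _ (eB f)) // ler_wpM2l // ler_piMl.
    rewrite sumr_const -[leLHS]mulr_natl mulrA mulfV ?mul1r // gt_eqF //.
    exact: lt_le_trans D1.
  apply: le_trans (lerB_normD _ _).
  have : nrm (M i.+1) * s * k <= `|nrm (M i.+1) * dot (v i.+1) x * dot (v i.+2) (u i.+1)|.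
    rewrite !normrM (gtr0_norm n0) -/s ler_wpM2l ?Hk // mulr_ge0 // ltW //.
  lra.
exists (nrm (M i.+1) * s * (1 + k / 4)); split.
- move=> f; rewrite xE (le_trans (ler_normD _ _)) // mulrDr mulr1 lerD //.
    rewrite !normrM (gtr0_norm n0) -/s ler_wpM2r ?normr_ge0 // ler_piMr ?(ltW n0) //.
  by rewrite -mulrA.
- apply: le_trans dE; rewrite mulrCA ler_wpM2l ?mulr_ge0 ?(ltW n0) ?(ltW s_gt0) //.
  by nra.
- apply: le_trans dE; rewrite big_ord_recr /= mulrA.
  apply: (@le_trans _ _ (s * (nrm (M i.+1) * (k / 2)))).
    by rewrite ler_wpM2r // mulr_ge0 ?(ltW n0) // divr_ge0 // ltW.
  rewrite [s * _]mulrCA -mulrA ler_wpM2l ?(ltW n0) // ler_wpM2l ?(ltW s_gt0) //.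
  lra.
Qed.

Lemma chain_nrm (P : nat -> I -> I -> R) : (0 < r)%N -> P 1%N = M 1%N ->
  (forall i, (0 < i < r)%N -> P i.+1 = kmul (M i.+1) (P i)) ->
  k * \prod_(j < r) (nrm (M j.+1) * (k / 2)) <= nrm (P r).
Proof.
move=> r0 P1 PS; have [X [_ _ H]] := chain_aux (leqnn r).
apply: (le_trans H).
have E i : (0 < i <= r)%N -> orbit_vec i = app (P i) (u 0).
  elim: i => // -[_ _|i IH /andP[_ ir]]; first by rewrite P1.
  by rewrite PS ?ir // app_kmul -IH // (ltnW ir).
by rewrite E ?r0 ?leqnn //; exact: dot_app_le.
Qed.

End Chain.
End RankOne.

(** * Arrays of low rank *)

Section LowRank.
Variable R : realType.
Implicit Types G : nat -> nat -> R.

(** Rank at most D is expressed by a factorization, so that the factors of an entrywise product are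
    simply tensored. *)
Definition low_rank D G := exists (I : finType) (u v : nat -> I -> R),
  (#|I| <= D)%N /\ forall a b, G a b = \sum_i u a i * v b i.

Lemma low_rankM D E G H : low_rank D G -> low_rank E H ->
  low_rank (D * E) (fun a b => G a b * H a b).
Proof.
case=> I [u [v [ID GE]]] [J [w [z [JE HE]]]].
exists (I * J)%type, (fun a p => u a p.1 * w a p.2), (fun b p => v b p.1 * z b p.2).
split=> [|a b]; first by rewrite card_prod leq_mul.
rewrite GE HE mulr_suml -(pair_big xpredT xpredT (fun i j => u a i * w a j * (v b i * z b j))) /=.
apply: eq_bigr => i _; rewrite mulr_sumr; apply: eq_bigr => j _.
by rewrite mulrACA.
Qed.

Lemma low_rank_prod D (r : seq nat) (G : nat -> nat -> nat -> R) :
  (forall k, k \in r -> low_rank D (G k)) ->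
  low_rank (D ^ size r) (fun a b => \prod_(k <- r) G k a b).
Proof.
elim: r => [_|k r IH H].
  exists unit, (fun _ _ => 1), (fun _ _ => 1); split=> [|a b]; first by rewrite card_unit.
  by rewrite big_nil (eq_bigr (fun=> 1)) ?sumr_const ?card_unit // => *; rewrite mulr1.
have /low_rankM M := H k (mem_head _ _).
have /M {M}[I [u [v [ID GE]]]] := IH (fun j jr => H j (@mem_behead _ (k :: r) j jr)).
exists I, u, v; split=> [|a b]; first by rewrite expnS.
by rewrite big_cons GE.
Qed.

Lemma low_rank_indic (S : finType) (x y : nat -> S) :
  low_rank #|S| (fun a b => (x a == y b)%:R).
Proof.
exists S, (fun a i => (x a == i)%:R), (fun b i => (y b == i)%:R); split=> // a b.
rewrite (bigD1 (y b)) //= eqxx mulr1 big1 ?addr0 // => i.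
by rewrite eq_sym => /negbTE ->; rewrite mulr0.
Qed.

Lemma low_rank_dot (I : finType) (u v : nat -> I -> R) :
  low_rank #|I| (fun a b => dot (v b) (u a)).
Proof.
exists I, u, v; split=> // a b; by apply: eq_bigr => i _; rewrite mulrC.
Qed.

Lemma perm_descent n (s : 'S_n) : s != 1%g -> exists i, (s i < i)%N.
Proof.
apply: contraNP => /forallNP H; apply/eqP/permP => i; rewrite perm1.
have le (j : 'I_n) : (j <= s j)%N by rewrite leqNgt; apply/negP/H.
have [_] := leqif_sum (fun (j : 'I_n) (_ : true) => leqif_eq (le j)).
rewrite [X in X == _](reindex_inj (@perm_inj _ s)) eqxx => /esym/forallP/(_ i)/eqP E.
by apply: val_inj.
Qed.

(* A bounded array of rank below n cannot have large entries on its
   superdiagonal and only tiny ones on and below the diagonal: the n x n minor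
   sitting on the superdiagonal would be nearly the product of these entries. *)
Lemma low_rank_return D n G (k B : R) : (D < n)%N -> low_rank D G ->
  0 < k -> 1 <= B -> (forall a b, (a <= n)%N -> (b <= n)%N -> `|G a b| <= B) ->
  (forall a, (a < n)%N -> k <= `|G a a.+1|) ->
  exists a b, [/\ (0 < b <= a)%N, (a < n)%N & k ^+ n / (n`!%:R * B ^+ n) <= `|G a b|].
Proof.
move=> Dn [I [u [v [ID GE]]]] k0 B1 GB Gk.
have B0 : 0 < B := lt_le_trans ltr01 B1.
set eta := k ^+ n / _.
have eta0 : 0 < eta by rewrite divr_gt0 ?mulr_gt0 ?exprn_gt0 // ltr0n fact_gt0.
apply: contrapT => H.
have small (a b : nat) : (0 < b)%N -> (b <= a)%N -> (a < n)%N -> `|G a b| <= eta.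
  move=> b0 ba an; rewrite leNgt; apply/negP => /ltW E; apply: H.
  by exists a, b; rewrite b0 ba an.
pose M : 'M[R]_n := \matrix_(i, j) G i j.+1.
have M0 : \det M = 0.
  pose U : 'M[R]_(n, #|I|) := \matrix_(i, j) u i (enum_val j).
  pose V : 'M[R]_(#|I|, n) := \matrix_(i, j) v j.+1 (enum_val i).
  have MUV : M = U *m V.
    apply/matrixP => i j; rewrite !mxE GE.
    rewrite (reindex_omap (@enum_val I predT) (fun x => Some (enum_rank x))) /=.
      by apply: eq_big => [x|x _]; rewrite ?enum_valK ?eqxx // !mxE.
    by move=> x _; rewrite enum_rankK.
  apply/eqP; rewrite -[_ == 0]negbK -unitfE -unitmxE -row_full_unit /row_full.
  rewrite neq_ltn; apply/orP; left; rewrite MUV.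
  by rewrite (leq_ltn_trans (mxrankM_maxl _ _)) // (leq_ltn_trans (rank_leq_col _)) // (leq_ltn_trans ID).
move: M0; rewrite /determinant (bigD1 1%g) //= odd_perm1 expr0 mul1r => /eqP.
rewrite addr_eq0 => /eqP /(congr1 Num.norm); rewrite normrN => E.
have L : k ^+ n <= `|\prod_(i < n) M i ((1%g : 'S_n) i)|.
  rewrite normr_prod -[X in k ^+ X](card_ord n) -prodr_const.
  by apply: ler_prod => i _; rewrite (ltW k0) mxE perm1 Gk.
have etaB : 0 <= eta * B ^+ n by rewrite (mulr_ge0 (ltW eta0)) // exprn_ge0 // ltW.
have U : `|\sum_(s : 'S_n | s != 1%g) (-1) ^+ s * \prod_(i < n) M i (s i)| <= (n`!%:R - 1) * (eta * B ^+ n).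
  apply: (le_trans (ler_norm_sum _ _ _)).
  apply: (@le_trans _ _ (\sum_(s : 'S_n | s != 1%g) eta * B ^+ n)); last first.
    rewrite sumr_const -[leLHS]mulr_natl ler_wpM2r //.
    rewrite (_ : n`!%:R - 1 = n`!.-1%:R); last first.
      by rewrite -[in LHS](prednK (fact_gt0 n)) -natr1 addrK.
    rewrite ler_nat -ltnS (prednK (fact_gt0 n)) -card_Sn [X in (_ < X)%N](cardD1 1%g) inE add1n ltnS.
    by apply: eq_leq; apply: eq_card => s; rewrite !inE andbT.
  (* The column j of [M] is the column j + 1 of [G], so a descent s i < i meets an entry of [G] on
     or below the diagonal. The value of [eta] makes n! such terms add up to k^n. *)
  apply: ler_sum => s /perm_descent[i si].
  rewrite normrM normrX normrN1 expr1n mul1r normr_prod (bigD1 i) //=.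
  rewrite ler_pM //; first exact: prodr_ge0.
    by rewrite mxE small.
  apply: (@le_trans _ _ (\prod_(j < n | j != i) B)).
    by apply: ler_prod => j _; rewrite normr_ge0 mxE GB // ltnW.
  rewrite prodr_const ler_weXn2l // -[X in (_ <= X)%N](card_ord n).
  exact: max_card.
move: L; rewrite E => /le_trans/(_ U).
rewrite mulrBl mul1r lerBrDr.
have -> : n`!%:R * (eta * B ^+ n) = k ^+ n.
  rewrite /eta; field; rewrite !gt_eqF ?ltr0n ?fact_gt0 ?exprn_gt0 //.
by rewrite gerDl leNgt (mulr_gt0 eta0) // exprn_gt0.
Qed.

End LowRank.

Lemma prodr_const_seq (R : pzSemiRingType) (I : Type) (r : seq I) (x : R) :
  \prod_(k <- r) x = x ^+ size r.
Proof. by elim: r => [|k r IH]; rewrite ?big_nil // big_cons IH exprS. Qed.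

Section SeqProducts.
Variables (R : realDomainType) (r : seq nat) (F : nat -> R).

Lemma prod_seq_le E : (forall k, k \in r -> 0 <= F k <= E) ->
  \prod_(k <- r) F k <= E ^+ size r.
Proof.
move=> H; rewrite -prodr_const_seq big_seq [leRHS]big_seq.
exact: ler_prod.
Qed.

Lemma prod_seq_ge c : 0 <= c -> (forall k, k \in r -> c <= F k) ->
  c ^+ size r <= \prod_(k <- r) F k.
Proof.
move=> c0 H; rewrite -prodr_const_seq big_seq [leRHS]big_seq.
by apply: ler_prod => k /H ->; rewrite c0.
Qed.

Lemma prod_seq_le_factor E k0 : 1 <= E -> (forall k, k \in r -> 0 <= F k <= E) ->
  k0 \in r -> \prod_(k <- r) F k <= F k0 * E ^+ size r.
Proof.
move=> E1 H k0r; have E0 := le_trans ler01 E1.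
rewrite (big_rem k0) //= ler_wpM2l //; first by have /andP[] := H _ k0r.
apply: (@le_trans _ _ (E ^+ size (rem k0 r))); last first.
  by apply: ler_weXn2l => //; rewrite size_rem // leq_pred.
rewrite -prodr_const_seq [leLHS]big_seq [leRHS]big_seq; apply: ler_prod => k kr.
exact: H (mem_rem kr).
Qed.
End SeqProducts.

Lemma low_rank_le (R : realType) D E (G : nat -> nat -> R) : (D <= E)%N ->
  low_rank D G -> low_rank E G.
Proof.
by move=> DE [I [u [v [ID GE]]]]; exists I, u, v; split=> //; exact: leq_trans DE.
Qed.

(** * Blocks that pair with themselves *)

Section SelfCompatible.
Variables (R : realType) (d : nat).

Fixpoint mprod (B : nat -> 'M[R]_d) l : 'M[R]_d :=
  if l is j.+1 then B j *m mprod B j else 1%:M.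

Lemma mprod_add B l1 l2 :
  mprod B (l1 + l2) = mprod (fun i => B (l1 + i)%N) l2 *m mprod B l1.
Proof.
elim: l2 => [|l2 IH]; first by rewrite addn0 mul1mx.
by rewrite addnS /= IH mulmxA.
Qed.

Lemma eq_mprod B C l : (forall i, (i < l)%N -> B i = C i) -> mprod B l = mprod C l.
Proof.
elim: l => //= l IH H; rewrite H // IH // => i il; exact: H (ltnW il).
Qed.

Lemma cnorm_mprod k B l : (0 < l)%N ->
  cnorm k (mprod B l) <= \prod_(i < l) cnorm k (B i).
Proof.
elim: l => // -[|l] IH _; first by rewrite /= mulmx1 big_ord1.
rewrite big_ord_recr /= mulrC (le_trans (cnorm_mul _ _ _)) //.
by rewrite ler_wpM2l ?cnorm_ge0 // IH.
Qed.

Lemma card_index k : (k <= d)%N -> (#|{: {ffun 'I_k -> 'I_d}}| <= d.+1 ^ d.+1)%N.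
Proof.
move=> kd; rewrite card_ffun !card_ord; case: k kd => [|k] kd; first by rewrite expn_gt0.
rewrite (@leq_trans (d.+1 ^ k.+1)) ?leq_exp2r // leq_pexp2l //.
exact: ltnW.
Qed.

(* (d + 1)^(d + 1) bounds the number of indices of a k-th compound, k <= d. *)
Definition return_len (s g : nat) := (s * (d.+1 ^ d.+1) ^ g).+1.

(* low_rank_return applies to the array whose (a, b) entry is the product over
   Gam of the pairings of the blocks a and b, or 0 if the state after the block
   a is not the state before the block b. *)
Lemma self_compatible (S : finType) (g : nat) :
  exists (c : R) (e : nat), 0 < c /\ c <= 1 /\
  forall (z t : R) (Gam : seq nat) (B : nat -> 'M[R]_d) (st : nat -> S),
  let n := return_len #|S| g in let k' := c * z ^+ e in
  let P b l := mprod (fun i => B (b + i)%N) l in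
  0 < z -> z <= 1 -> 0 <= t -> t <= c * k' ^+ 2 ->
  size Gam = g -> (forall k, k \in Gam -> (k <= d)%N) ->
  (forall k, k \in Gam -> forall b l, (0 < l)%N -> (b + l <= n.+1)%N ->
     0 < cnorm k (P b l) /\ exists u v, near_rank1 (cmp (k := k) (P b l)) u v t) ->
  (forall k, k \in Gam -> forall i, (i < n)%N ->
     z * (cnorm k (B i.+1) * cnorm k (B i)) <= cnorm k (B i.+1 *m B i)) ->
  exists b l, [/\ (0 < l)%N, (b + l <= n)%N, st b = st (b + l)%N &
    forall k, k \in Gam -> exists u v,
      near_rank1 (cmp (k := k) (P b l)) u v t /\ k' <= `|dot v u|].
Proof.
set n := return_len #|S| g.
have Dn : (#|S| * (d.+1 ^ d.+1) ^ g < n)%N by exact: ltnSn.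
have n_gt0 : (0 < n)%N by [].
clearbody n.
pose E : R := (d.+1 ^ d.+1)%:R.
have E1 : 1 <= E by rewrite ler1n expn_gt0.
have E0 : 0 < E := lt_le_trans ltr01 E1.
pose c1 := (2 * E ^+ 2)^-1.
have c10 : 0 < c1 by rewrite invr_gt0 mulr_gt0 ?exprn_gt0.
have c1l : c1 <= 1.
  by rewrite invf_le1 ?mulr_gt0 ?exprn_gt0 //; have := exprn_ege1 2 E1; lra.
have nf1 : 1 <= n`!%:R :> R by rewrite ler1n fact_gt0.
have Eg1 : 1 <= E ^+ g by exact: exprn_ege1.
have EE1 : 1 <= (E ^+ g) ^+ n * E ^+ g by rewrite mulr_ege1 ?exprn_ege1.
have den0 : 0 < n`!%:R * ((E ^+ g) ^+ n * E ^+ g).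
  by rewrite (lt_le_trans ltr01) // mulr_ege1.
(* This is the bound of [low_rank_return] for superdiagonal entries (c1 z)^g and entries at most
   E^g, without its power of z. The additional E^g pays for extracting one pairing from the product
   over [Gam]. *)
pose c3 := (c1 ^+ g) ^+ n / (n`!%:R * ((E ^+ g) ^+ n * E ^+ g)).
have c30 : 0 < c3.
  by rewrite divr_gt0 ?exprn_gt0.
have c3l : c3 <= (c1 ^+ g) ^+ n.
  rewrite ler_pdivrMr // ler_peMr //; last exact: mulr_ege1.
  by do 2!apply: exprn_ge0; exact: ltW.
have c3l1 : c3 <= 1 by rewrite (le_trans c3l) // -exprM exprn_ile1 // ltW.
have c1E : c1 = (2 * E ^+ 2)^-1 by [].
have c3E : c3 = (c1 ^+ g) ^+ n / (n`!%:R * ((E ^+ g) ^+ n * E ^+ g)) by [].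
clearbody c3 c1.
(* With k3 = c3 z^(g n), going twice around the loop of blocks loses at most k3 (k3 / 2)^(2 n). This
   equals 2 E^2 c z^e; the exponent e counts the g n powers of z in each of the 2 n + 1 factors. *)
pose c := c3 * (c3 / 2) ^+ (2 * n) * c1.
pose e := (g * n * (2 * n).+1)%N.
have c32 : 0 < c3 / 2 by rewrite divr_gt0.
have pc : (c3 / 2) ^+ (2 * n) <= 1 by rewrite exprn_ile1 //; lra.
have c0 : 0 < c by rewrite mulr_gt0 // mulr_gt0 ?exprn_gt0.
have c_le1 : c <= c1.
  rewrite ler_piMl ?(ltW c10) // -[leRHS]mulr1 ler_pM ?(ltW c30) ?exprn_ge0 // ltW //.
have c_le3 : c <= c3.
  rewrite /c -mulrA ler_piMr ?(ltW c30) // -[leRHS]mulr1 ler_pM ?exprn_ge0 // ltW //.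
have cE : c = c3 * (c3 / 2) ^+ (2 * n) * c1 by [].
clearbody c.
(* The final constants leave a factor 8 E^2 to spare. *)
exists (c / (8 * E ^+ 3)), e.
have E8 : 1 <= 8 * E ^+ 3 by have := exprn_ege1 3 E1; lra.
have E80 : 0 < 8 * E ^+ 3 := lt_le_trans ltr01 E8.
split; first by rewrite divr_gt0.
split; first by rewrite ler_pdivrMr // mul1r (le_trans _ E8) // (le_trans c_le1).
move=> z t Gam B st /= ; set k' := _ * z ^+ e.
pose P b l := mprod (fun i => B (b + i)%N) l; move=> z0 z1 t0 tk sG Gd h1 h2.
pose w := c * z ^+ e.
have w0 : 0 < w by rewrite /w mulr_gt0 ?exprn_gt0.
have ze1 : z ^+ e <= 1 by rewrite exprn_ile1 // ltW.
have w1 : w <= 1.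
  rewrite -[leRHS]mulr1 /w ler_pM //; first exact: ltW.
    by rewrite exprn_ge0 // ltW.
  exact: le_trans c_le1 c1l.
have k'w : k' <= w by rewrite /k' mulrAC -/w ler_pdivrMr // ler_peMr // ltW.
have k'0 : 0 < k' by rewrite /k' mulr_gt0 ?exprn_gt0 ?divr_gt0.
have tw : 8 * E ^+ 3 * t <= w ^+ 2.
  rewrite -ler_pdivlMl //; apply: (le_trans tk); apply: ler_pM.
  - by rewrite divr_ge0 // ltW.
  - by rewrite exprn_ge0 // ltW.
  - by rewrite ler_pdivrMr // mulVf ?gt_eqF // (le_trans c_le1).
  - by rewrite ler_pXn2r ?nnegrE // ltW.
pose k3 := c3 * (z ^+ g) ^+ n.
have k30 : 0 < k3 by rewrite mulr_gt0 ?exprn_gt0.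
have wk3 : w <= k3.
  rewrite /w /k3 -exprM; apply: ler_pM => //; first exact: ltW.
    by rewrite exprn_ge0 // ltW.
  by apply: ler_wiXn2l => //; [exact: ltW | exact: leq_pmulr].
have k31 : k3 <= 1.
  rewrite -[leRHS]mulr1 /k3 -exprM ler_pM ?(ltW c30) //.
    by rewrite exprn_ge0 // ltW.
  by rewrite exprn_ile1 // ltW.
have Et : 8 * E ^+ 2 * t <= k3 ^+ 2.
  apply: (@le_trans _ _ (8 * E ^+ 3 * t)).
    by rewrite ler_wpM2r // ler_wpM2l // [leRHS]exprSr ler_peMr // exprn_ge0 // ltW.
  by apply: (le_trans tw); rewrite ler_pXn2r ?nnegrE // ltW.
have t3 : 3 * E * t * E ^+ 2 <= w / 2.
  have : w ^+ 2 <= w by rewrite expr2 ler_piMr // ltW.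
  move: tw; rewrite exprSr; have : 0 <= E ^+ 2 * E * t by rewrite !mulr_ge0 ?exprn_ge0 // ltW.
  lra.
have t1 : t <= 1.
  have : t <= 8 * E ^+ 3 * t by rewrite ler_peMl.
  have : w ^+ 2 <= 1 by rewrite exprn_ile1 // ltW.
  lra.
have Gam_gt0 k : k \in Gam -> (0 < g)%N by rewrite -sG; case: (Gam).
have cardE k : k \in Gam -> #|{: {ffun 'I_k -> 'I_d}}|%:R <= E.
  by move=> kG; rewrite ler_nat card_index // Gd.
have P1 i : P i 1%N = B i by rewrite /P /= mulmx1 addn0.
have uvP k : exists uv : nat -> ({ffun 'I_k -> 'I_d} -> R) * ({ffun 'I_k -> 'I_d} -> R),
    k \in Gam -> forall i, (i <= n)%N -> near_rank1 (cmp (B i)) (uv i).1 (uv i).2 t.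
  have [kG|] := boolP (k \in Gam); last by move=> _; exists (fun _ => (fun=> 0, fun=> 0)).
  have H i : exists p : ({ffun 'I_k -> 'I_d} -> R) * ({ffun 'I_k -> 'I_d} -> R),
      (i <= n)%N -> near_rank1 (cmp (B i)) p.1 p.2 t.
    have [le_in|_] := leqP i n; last by exists (fun=> 0, fun=> 0).
    have [|_ [u [v H]]] := h1 k kG i 1%N isT; first by rewrite addn1.
    by exists (u, v); rewrite -P1.
  by have [uv uvH] := choice H; exists uv.
pose uv k := projT1 (cid (uvP k)).
pose u k i := (uv k i).1; pose v k i := (uv k i).2.
have near k i : k \in Gam -> (i <= n)%N -> near_rank1 (cmp (B i)) (u k i) (v k i) t.
  by move=> kG ? ; apply: (projT2 (cid (uvP k))).
have Bpos k i : k \in Gam -> (i <= n)%N -> 0 < cnorm k (B i).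
  by move=> kG le_in; have [|+ _] := h1 k kG i 1%N isT; rewrite ?addn1 // -/(P i 1%N) P1.
pose c1z := c1 * z.
have c1z0 : 0 < c1z by rewrite /c1z mulr_gt0.
have wlem x D : D <= E -> 0 <= D -> 0 <= x -> D ^+ 2 * (x + 3 * D * t) <= E ^+ 2 * x + w / 2.
  move=> DE D0 x0; apply: (@le_trans _ _ (E ^+ 2 * (x + 3 * E * t))).
    apply: ler_pM; rewrite ?exprn_ge0 ?addr_ge0 ?mulr_ge0 //.
      by rewrite ler_pXn2r ?nnegrE // ltW.
    by rewrite lerD2l ler_wpM2r // ler_wpM2l.
  by rewrite mulrDr lerD2l mulrC.
(* A product of neighbours keeps a fraction z of the norms, so their rank 1 vectors pair. This gives
   the superdiagonal of the array. *)
have adj k i : k \in Gam -> (i < n)%N -> c1z <= `|dot (v k i.+1) (u k i)|.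
  move=> kG lt_in; have H := h2 k kG i lt_in.
  rewrite /cnorm cmp_mul in H.
  have := pairing_of_product (Bpos k i.+1 kG lt_in) (Bpos k i kG (ltnW lt_in)) t1
    (near k i.+1 kG lt_in) (near k i kG (ltnW lt_in)) H.
  move=> /le_trans/(_ (wlem _ _ (cardE k kG) (ler0n _ _) (normr_ge0 _))) zle.
  have wz : w <= z.
    have : (0 < e)%N by rewrite /e !muln_gt0 (Gam_gt0 _ kG) n_gt0.
    move=> e0; rewrite /w -[leRHS]mul1r; apply: ler_pM => //; rewrite ?exprn_ge0 ?(ltW c0) ?(ltW z0) //.
      exact: le_trans c1l.
    by rewrite -[leRHS]expr1; apply: ler_wiXn2l => //; exact: ltW.
  rewrite /c1z c1E mulrC ler_pdivrMr; last by rewrite mulr_gt0 ?exprn_gt0.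
  lra.
pose G (a b : nat) : R := (st a.+1 == st b)%:R * \prod_(k <- Gam) dot (v k b) (u k a).
have Glow : low_rank (#|S| * (d.+1 ^ d.+1) ^ g) G.
  rewrite -sG; apply: (low_rankM (low_rank_indic R (fun a => st a.+1) st)).
  apply: (@low_rank_prod _ _ _ (fun k a b => dot (v k b) (u k a))) => k kG.
  by apply: low_rank_le (low_rank_dot _ _); rewrite card_index // Gd.
have dotE k a b : k \in Gam -> (a <= n)%N -> (b <= n)%N -> `|dot (v k b) (u k a)| <= E.
  move=> kG an bn; have [ua _ _] := near k a kG an; have [_ vb _] := near k b kG bn.
  by apply: le_trans (dot_le vb ua) _; rewrite mulr1 cardE.
have GB a b : (a <= n)%N -> (b <= n)%N -> `|G a b| <= E ^+ g.
  move=> an bn; rewrite /G normrM normr_prod -[leRHS]mul1r ler_pM ?prodr_ge0 //.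
    by rewrite ger0_norm // lern1 leq_b1.
  by rewrite -sG; apply: prod_seq_le => k kG; rewrite normr_ge0 dotE.
have Gk a : (a < n)%N -> c1z ^+ g <= `|G a a.+1|.
  move=> an; rewrite /G eqxx mul1r normr_prod -sG.
  by apply: prod_seq_ge => [|k kG]; [exact: ltW | exact: adj].
have c1zg : 0 < c1z ^+ g by exact: exprn_gt0.
have [a [b [/andP[b0 ba] an]]] := low_rank_return Dn Glow c1zg Eg1 GB Gk; clear Dn.
have -> : (c1z ^+ g) ^+ n / (n`!%:R * (E ^+ g) ^+ n) = k3 * E ^+ g.
  rewrite /k3 c3E /c1z !exprMn; field.
  by rewrite !gt_eqF ?exprn_gt0 // (lt_le_trans ltr01).
move=> Gbig.
have Eg0 : 0 < E ^+ g := lt_le_trans ltr01 Eg1.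
have stE : st a.+1 = st b.
  apply/eqP; apply: contraTT Gbig => /negbTE stN; rewrite -ltNge /G stN.
  by rewrite mul0r normr0 mulr_gt0.
have dot3 k : k \in Gam -> k3 <= `|dot (v k b) (u k a)|.
  move=> kG; rewrite -(ler_pM2r Eg0); apply: (le_trans Gbig).
  rewrite /G stE eqxx mul1r normr_prod -sG.
  apply: (@prod_seq_le_factor _ _ (fun k => `|dot (v k b) (u k a)|)) => // j jG.
  by rewrite normr_ge0 dotE ?(ltnW an) // (leq_trans ba) // ltnW.
pose l := (a - b).+1; have bl : (b + l)%N = a.+1 by rewrite /l addnS subnKC.
have ln : (l <= n)%N by rewrite /l (leq_ltn_trans (leq_subr _ _) an).
exists b, l; rewrite bl; split => // k kG.
have [|W0 [uW [vW nW]]] := h1 k kG b l isT; first by rewrite bl ltnW.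
exists uW, vW; split => //; apply: (le_trans k'w).
rewrite -/(P b l) in W0 nW *.
have k3c : k3 <= c1z.
  have gn : (0 < g * n)%N by rewrite muln_gt0 (Gam_gt0 _ kG) n_gt0.
  apply: (@le_trans _ _ (c1z ^+ (g * n))).
    rewrite /c1z exprMn /k3 -!exprM in c3l *.
    by rewrite ler_wpM2r // exprn_ge0 // ltW.
  rewrite -[leRHS]expr1; apply: ler_wiXn2l => //; first exact: ltW.
  by rewrite /c1z -[leRHS]mulr1 ler_pM // ltW.
(* The blocks b, ..., a are run through twice. The pairing found between the last block and the
   first one closes the loop, so [chain_nrm] bounds the norm of the square of their product from
   below, and [pairing_of_product] then gives the pairing of that product with itself. *)
pose q i := (b + i %% l)%N.
have qa i : (q i <= a)%N by rewrite -ltnS -bl /q ltn_add2l ltn_pmod.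
have qn i : (q i <= n)%N := leq_trans (qa i) (ltnW an).
pose M i := cmp (k := k) (B (q i.-1)).
pose U i := if i is j.+1 then u k (q j) else u k a.
pose V i := if i is j.+1 then v k (q j) else v k b.
pose Q i := cmp (k := k) (mprod (fun j => B (q j)) i).
have D8 : 8 * (#|{: {ffun 'I_k -> 'I_d}}|%:R : R) ^+ 2 * t <= k3 ^+ 2.
  apply: le_trans Et; rewrite ler_wpM2r // ler_wpM2l //.
  by rewrite ler_pXn2r ?nnegrE ?(ltW E0) ?(cardE _ kG).
have qS i : q i.+1 = (q i).+1 /\ (q i < a)%N \/ q i.+1 = b /\ q i = a.
  rewrite /q; have := @ltn_pmod i l isT; rewrite leq_eqVlt => /predU1P[E'|lt].
    right; have -> : (i.+1 %% l = 0)%N by rewrite -addn1 -modnDml addn1 E' modnn.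
    by rewrite addn0; split=> //; apply: succn_inj; rewrite -addnS E' bl.
  left; have -> : (i.+1 %% l = (i %% l).+1)%N by rewrite -addn1 -modnDml addn1 modn_small.
  by rewrite addnS; split=> //; rewrite -ltnS -bl -addnS ltn_add2l.
have Hk i : (i <= l + l)%N -> k3 <= `|dot (V i.+1) (U i)|.
  case: i => [_|i _]; rewrite /V /U; first by rewrite /q mod0n addn0 dot3.
  have [[-> lt]|[-> ->]] := qS i; last exact: dot3.
  by apply: (le_trans k3c); apply: adj => //; exact: ltn_trans an.
have U0 : sub1 (U 0) by have [] := near k a kG (ltnW an).
have VL : sub1 (V (l + l).+1) by have [] := near k _ kG (qn (l + l)%N).
have := @chain_nrm R _ M U V (l + l) k3 t k30 k31 D8
  (fun i _ => near k _ kG (qn i)) (fun i _ => Bpos k _ kG (qn i)) U0 VL Hk Q isT.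
have -> : Q 1%N = M 1%N by rewrite /Q /M /= mulmx1.
have -> : Q (l + l)%N = kmul (cmp (P b l)) (cmp (P b l)).
  rewrite /Q -cmp_mul mprod_add; congr (cmp (_ *m _)); apply: eq_mprod => i il.
    by rewrite /q modnDl modn_small.
  by rewrite /q modn_small.
move=> /(_ erefl) CH.
have {CH} CH := CH (fun i _ => cmp_mul k (B (q i)) _).
pose z' := k3 * (k3 / 2) ^+ (2 * n).
have k32 : 0 < k3 / 2 by rewrite divr_gt0.
have Hz : z' * (nrm (cmp (k := k) (P b l)) * nrm (cmp (k := k) (P b l))) <=
    nrm (kmul (cmp (k := k) (P b l)) (cmp (P b l))).
  apply: le_trans CH; rewrite /z' -mulrA ler_wpM2l ?(ltW k30) //.
  rewrite big_split /= prodr_const card_ord mulrC ler_pM ?mulr_ge0 ?nrm_ge0 ?exprn_ge0 ?(ltW k32) //.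
    rewrite big_split_ord /= (eq_bigr (fun i : 'I_l => cnorm k (B (b + i)%N))); last first.
      by move=> i _; rewrite /M /q /= modn_small.
    rewrite [X in _ <= _ * X](eq_bigr (fun i : 'I_l => cnorm k (B (b + i)%N))); last first.
      by move=> i _; rewrite /M /q /= modnDl modn_small.
    by rewrite ler_pM // -/(cnorm k _) ?cnorm_ge0 // cnorm_mprod.
  by apply: ler_wiXn2l; rewrite ?(ltW k32) //; [lra | rewrite mul2n -addnn leq_add].
have := pairing_of_product W0 W0 t1 nW nW Hz.
move=> /le_trans/(_ (wlem _ _ (cardE k kG) (ler0n _ _) (normr_ge0 _))).
have -> : z' = 2 * E ^+ 2 * w.
  have E2 : 2 * E ^+ 2 != 0 by rewrite gt_eqF ?mulr_gt0 ?exprn_gt0.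
  rewrite /z' /w cE c1E /k3 /e mulnS exprD [(c3 * _ / 2) ^+ _](_ : _ = (c3 / 2) ^+ (2 * n) * z ^+ (g * n * (2 * n))).
    by rewrite -!exprM; field.
  by rewrite mulrAC exprMn -!exprM.
have Edot := normr_ge0 (dot vW uW).
have E21 : 1 <= E ^+ 2 by exact: exprn_ege1.
have E20 : 0 < E ^+ 2 by exact: exprn_gt0.
move=> H; rewrite -(ler_pM2l E20).
have : w <= E ^+ 2 * w by rewrite ler_peMl // ltW.
lra.
Qed.
End SelfCompatible.

(** * Growth rates and the pressure *)

Local Open Scope classical_set_scope.
Local Open Scope ring_scope.

Section Extended.
Variable R : realType.

(** At an infinite limit one of the two hypotheses is vacuous, so one criterion serves for finite
    and infinite pressures. *)
Lemma cvge_of_bounds (T : Type) (F : set_system T) (FF : Filter F) (f : T -> \bar R) (l : \bar R) :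
  (forall c : R, (c%:E < l)%E -> \forall x \near F, (c%:E < f x)%E) ->
  (forall c : R, (l < c%:E)%E -> \forall x \near F, (f x < c%:E)%E) ->
  f x @[x --> F] --> l.
Proof.
move=> lo hi A; case: l lo hi => [r| |] lo hi.
- move=> rA; have /nbhs_ballP[e /= e0 eA] : nbhs r (fun y : R => A y%:E) := rA.
  have h1 : \forall x \near F, ((r - e)%:E < f x)%E by apply: lo; rewrite lte_fin; lra.
  have h2 : \forall x \near F, (f x < (r + e)%:E)%E by apply: hi; rewrite lte_fin; lra.
  apply: filterS2 h1 h2 => x; rewrite /=; case: (f x) => [y| |] //.
  rewrite !lte_fin => ye er; apply: eA; rewrite /ball /= ltr_norml; lra.
- move=> [M [_ MA]]; have h := lo M (ltry _).
  by apply: filterS h => x; exact: MA.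
- move=> [M [_ MA]]; have h := hi M (ltNyr _).
  by apply: filterS h => x; exact: MA.
Qed.

Lemma expR_mul_nat (c : R) n : expR (n%:R * c) = expR c ^+ n.
Proof. by rewrite mulrC -expRM_natr. Qed.

Lemma le_scaled_lne n (c y : R) : (0 < n)%N -> 0 <= y ->
  (c%:E <= (n%:R^-1)%:E * lne y%:E)%E = (expR (n%:R * c) <= y).
Proof.
move=> n0 y0; have nR : 0 < n%:R :> R by rewrite ltr0n.
move: y0; rewrite le_eqVlt => /predU1P[<-|y0].
  rewrite le0_lneNy // mulrNy sgrV gtr0_sg // mul1e leNgt ltNyr /=.
  by rewrite leNgt expR_gt0.
rewrite lne_EFin // -EFinM lee_fin mulrC ler_pdivlMr //.
by rewrite -[y in RHS]lnK ?posrE // ler_expR mulrC.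
Qed.

(** For a submultiplicative sequence this is the limit of (1/n) log Z_n. As an infimum, it turns a
    lower bound into a statement about every n and an upper bound into a statement about a single
    n. *)
Definition growth (Z : nat -> R) : \bar R :=
  ereal_inf [set ((n%:R^-1)%:E * lne (Z n)%:E)%E | n in [set n | (0 < n)%N]].

Section Growth.
Variable Z : nat -> R.
Hypothesis Z0 : forall n, 0 <= Z n.

Lemma growth_ge (c : R) :
  (c%:E <= growth Z)%E <-> forall n, (0 < n)%N -> expR (n%:R * c) <= Z n.
Proof.
split=> [/ereal_infP H n n0|H].
  by rewrite -le_scaled_lne //; apply: H; exists n.
by apply/ereal_infP => _ [n /= n0 <-]; rewrite le_scaled_lne ?H.
Qed.

Lemma growth_lt (c : R) : (growth Z < c%:E)%E ->
  exists2 n, (0 < n)%N & Z n < expR (n%:R * c).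
Proof.
rewrite ltNge => /negP H; apply: contrapT => H'; apply: H; apply/growth_ge => n n0.
by rewrite leNgt; apply/negP => Zn; apply: H'; exists n.
Qed.

Hypothesis Zsub : forall n m, Z (n + m) <= Z n * Z m.

Lemma submul_pow m k r : Z (k * m + r) <= Z m ^+ k * Z r.
Proof.
elim: k => [|k IH]; first by rewrite mul0n expr0 mul1r.
rewrite mulSn -addnA exprS (le_trans (Zsub _ _)) // -mulrA.
by rewrite ler_wpM2l.
Qed.

(** Euclidean division of n by m; C collects the finitely many remainders, and the 1 makes it
    positive. *)
Lemma submul_bound m (c : R) : (0 < m)%N -> Z m <= expR (m%:R * c) ->
  exists2 C : R, 0 < C & forall n, Z n <= C * expR (n%:R * c).
Proof.
move=> m0 Zm; pose C := 1 + \sum_(r < m) Z r * expR (- (r%:R * c)).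
have C1 : 1 <= C by rewrite lerDl sumr_ge0 // => r _; rewrite mulr_ge0 ?expR_ge0.
exists C => [|n]; first exact: lt_le_trans C1.
rewrite {1 2}(divn_eq n m) (le_trans (submul_pow _ _ _)) //.
have rm : (n %% m < m)%N by rewrite ltn_mod.
have Zr : Z (n %% m) <= C * expR ((n %% m)%:R * c).
  rewrite -ler_pdivrMr ?expR_gt0 // -expRN /C (bigD1 (Ordinal rm)) //= addrCA lerDl.
  by rewrite addr_ge0 ?sumr_ge0 // => r _; rewrite mulr_ge0 ?expR_ge0.
apply: (@le_trans _ _ (expR (m%:R * c) ^+ (n %/ m) * (C * expR ((n %% m)%:R * c)))).
  by rewrite ler_pM ?exprn_ge0 // lerXn2r ?nnegrE ?expR_ge0.
rewrite -expR_mul_nat mulrCA -expRD natrD natrM le_eqVlt; apply/orP; left.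
by apply/eqP; congr (_ * expR _); ring.
Qed.

(** Fekete's lemma, for a sequence that is only comparable to a submultiplicative one: constant
    factors disappear in the slack between two exponential rates. *)
Lemma lim_scaled_lne (Y : nat -> R) (c1 c2 : R) : 0 < c1 -> 0 < c2 ->
  (forall n, 0 <= Y n) -> (forall n, c1 * Z n <= Y n) -> (forall n, Y n <= c2 * Z n) ->
  limn (fun n => ((n%:R^-1)%:E * lne (Y n)%:E)%E) = growth Z.
Proof.
move=> c10 c20 Y0 YZ ZY; apply/cvg_lim => //.
have expinf (e C : R) : 0 < e -> \forall n \near \oo, C <= expR (n%:R * e).
  move=> e0; near=> n; apply: (@le_trans _ _ (n%:R * e)); last first.
    by apply: le_trans (expR_ge1Dx _); rewrite lerDr.
  rewrite -ler_pdivrMr //; near: n; exact: nbhs_infty_ger.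
apply: cvge_of_bounds => c.
- move=> cl; have [c' cc' /growth_ge c'l] : exists2 c' : R, c < c' & (c'%:E <= growth Z)%E.
    case: (growth Z) cl => [r||] //; last by exists (c + 1); rewrite ?leey // ltrDl.
    by rewrite lte_fin => cr; exists r.
  have [c'' [cc'' c'c'']] : exists c'', c < c'' /\ c'' < c' by exists ((c + c') / 2); lra.
  near=> n; have n0 : (0 < n)%N by near: n; exact: nbhs_infty_gt.
  apply: (@lt_le_trans _ _ c''%:E); first by rewrite lte_fin.
  rewrite le_scaled_lne //; apply: le_trans (YZ n).
  rewrite -ler_pdivrMl //; apply: le_trans (c'l n n0).
  rewrite (_ : n%:R * c' = n%:R * c'' + n%:R * (c' - c'')); last by ring.
  rewrite expRD mulrC ler_wpM2l ?expR_ge0 //.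
  near: n; apply: expinf; lra.
- move=> /[dup] lc /growth_lt[m m0 Zm].
  (* A term Z m = 0 has logarithm -oo; any rate below c then serves. *)
  have [c' c'c Zm'] : exists2 c' : R, c' < c & Z m <= expR (m%:R * c').
    have [Zm0|Zm0] := leP (Z m) 0; first by exists (c - 1); [lra | exact: le_trans (expR_ge0 _)].
    have mR : 0 < m%:R :> R by rewrite ltr0n.
    exists (ln (Z m) / m%:R); last by rewrite mulrC divfK ?gt_eqF // lnK.
    by rewrite ltr_pdivrMr // mulrC -ltr_expR lnK // posrE.
  have [C C0 ZC] := submul_bound m0 Zm'.
  near=> n; have n0 : (0 < n)%N by near: n; exact: nbhs_infty_gt.
  rewrite ltNge le_scaled_lne // -ltNge; apply: le_lt_trans (ZY n) _.
  apply: le_lt_trans (ler_wpM2l (ltW c20) (ZC n)) _; rewrite mulrA.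
  rewrite (_ : n%:R * c = n%:R * c' + n%:R * (c - c')); last by ring.
  rewrite expRD mulrC ltr_pM2l ?expR_gt0 // (@lt_le_trans _ _ (c2 * C + 1)) ?ltrDl //.
  near: n; apply: expinf; lra.
Unshelve. all: by end_near.
Qed.

End Growth.
End Extended.

(** * Sums over words and suprema over cylinders *)

Section WordSums.
Variables (R : realType) (K : finType).
Implicit Types F G : seq K -> R.

(** The summand is a function of sequences; only the summation fixes the length, so that
    concatenated words need no casts. *)
Definition wsum n F : R := \sum_(w : n.-tuple K) F w.

Lemma wsum_add n m F :
  wsum (n + m) F = wsum n (fun u => wsum m (fun v => F (u ++ v))).
Proof.
rewrite /wsum pair_big /=.
rewrite (reindex (fun p : n.-tuple K * m.-tuple K => cat_tuple p.1 p.2)) /=.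
  by apply: eq_bigr => p _.
have sz1 (w : (n + m).-tuple K) : size (take n w) == n.
  by rewrite size_takel // size_tuple leq_addr.
have sz2 (w : (n + m).-tuple K) : size (drop n w) == m.
  by rewrite size_drop size_tuple addKn.
exists (fun w => (Tuple (sz1 w), Tuple (sz2 w))) => [[u v] _|w _] /=.
  by congr pair; apply: val_inj; rewrite /= ?take_size_cat ?drop_size_cat ?size_tuple.
by apply: val_inj; rewrite /= cat_take_drop.
Qed.

Lemma eq_wsum n F G : (forall w, size w = n -> F w = G w) -> wsum n F = wsum n G.
Proof. by move=> H; apply: eq_bigr => w _; rewrite H // size_tuple. Qed.

Lemma le_wsum n F G : (forall w, size w = n -> F w <= G w) -> wsum n F <= wsum n G.
Proof. by move=> H; apply: ler_sum => w _; rewrite H // size_tuple. Qed.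

Lemma wsum_ge0 n F : (forall w, 0 <= F w) -> 0 <= wsum n F.
Proof. by move=> H; apply: sumr_ge0. Qed.

Lemma wsumZ n a F : wsum n (fun w => a * F w) = a * wsum n F.
Proof. by rewrite /wsum mulr_sumr. Qed.

Lemma wsumZr n a F : wsum n (fun w => F w * a) = wsum n F * a.
Proof. by rewrite /wsum mulr_suml. Qed.

Lemma wsum_sum n (I : Type) (r : seq I) (P : pred I) (F : I -> seq K -> R) :
  wsum n (fun w => \sum_(i <- r | P i) F i w) = \sum_(i <- r | P i) wsum n (F i).
Proof. exact: exchange_big. Qed.

Lemma wsumD n F G : wsum n (fun w => F w + G w) = wsum n F + wsum n G.
Proof. exact: big_split. Qed.

Lemma wsum0 F : wsum 0 F = F [::].
Proof.
rewrite /wsum (bigD1 [tuple]) //= big1 ?addr0 // => w /eqP[].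
exact: tuple0.
Qed.

Definition submul F := forall u v, F (u ++ v) <= F u * F v.

Lemma wsum_submul F n m : (forall w, 0 <= F w) -> submul F ->
  wsum (n + m) F <= wsum n F * wsum m F.
Proof.
move=> F0 Fs; rewrite wsum_add -wsumZr; apply: le_wsum => u _.
by rewrite -wsumZ; apply: le_wsum => v _.
Qed.

End WordSums.

Section Cylinders.
Variables (R : realType) (K : finType) (X : set (full_shift K)).
Hypothesis Xshift : forall x, X x -> X (Defs.shift x).

Definition initial (x : full_shift K) n : seq K := mkseq (fun i : nat => x i) n.

Lemma size_initial x n : size (initial x n) = n. Proof. exact: size_mkseq. Qed.

Lemma iter_shiftE n (x : full_shift K) k : iter n (@Defs.shift K) x k = x (n + k)%N.
Proof. by elim: n k => // n IH k; rewrite iterS /Defs.shift IH addnS. Qed.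

Lemma initial_add x n m : initial x (n + m) = initial x n ++ initial (iter n (@Defs.shift K) x) m.
Proof.
rewrite /initial /mkseq iotaD map_cat add0n; congr cat.
rewrite -[X in iota X m]addn0 iotaDl -map_comp; apply: eq_map => i /=.
by rewrite iter_shiftE.
Qed.

Lemma iter_shift_in n x : X x -> X (iter n (@Defs.shift K) x).
Proof. by move=> Xx; elim: n => //= n IH; exact: Xshift. Qed.

Definition cyl (w : seq K) : set (full_shift K) :=
  [set y | X y /\ initial y (size w) = w].

Lemma occurs_initial n (w : n.-tuple K) x k :
  occurs_at w x k <-> initial (iter k (@Defs.shift K) x) n = w.
Proof.
split=> [H|E i].
  apply: (@eq_from_nth _ (x 0%N : K)); rewrite ?size_initial ?size_tuple // => i ni.
  by rewrite nth_mkseq // iter_shiftE (H (Ordinal ni)) (tnth_nth (x 0%N : K)).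
rewrite (tnth_nth (x 0%N : K)) -E nth_mkseq // iter_shiftE.
by [].
Qed.

Lemma cylinder_cyl n (w : n.-tuple K) : cylinder X w = cyl w.
Proof.
rewrite eqEsubset; split=> y [Xy H]; split => //.
  by rewrite size_tuple; apply/(occurs_initial w y 0).
by apply/(occurs_initial w y 0); rewrite -[RHS]H size_tuple.
Qed.

(** An allowed word may occur anywhere in a point; invariance under the shift moves it to the
    front. *)
Lemma allowed_cyl n (w : n.-tuple K) : allowed X w <-> cyl w !=set0.
Proof.
split=> [[x Xx [k /occurs_initial H]]|[x [Xx H]]].
  by exists (iter k (@Defs.shift K) x); split; [exact: iter_shift_in | rewrite size_tuple].
exists x => //; exists 0%N; apply/(occurs_initial w x 0).
by rewrite -[RHS]H size_tuple.
Qed.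

Lemma cyl_cat u v y : cyl (u ++ v) y -> cyl u y /\ cyl v (iter (size u) (@Defs.shift K) y).
Proof.
move=> [Xy]; rewrite size_cat initial_add => /eqP.
rewrite eqseq_cat ?size_initial // => /andP[/eqP H1 /eqP H2].
by split; split => //; exact: iter_shift_in.
Qed.

Implicit Types H : nat -> full_shift K -> R.

Definition bounded_on H := forall n, exists C : R, forall y, X y -> H n y <= C.
(** The supremum of the empty set is 0, so words that are not allowed contribute nothing and sums
    may range over all words. *)
Definition cylsup H (w : seq K) : R := sup [set H (size w) y | y in cyl w].

Section CylSup.
Variable H : nat -> full_shift K -> R.
Hypotheses (H0 : forall n y, 0 <= H n y) (Hb : bounded_on H).

Lemma has_ubound_cylsup w : has_ubound [set H (size w) y | y in cyl w].
Proof. by have [C HC] := Hb (size w); exists C => _ [y [Xy _] <-]; exact: HC. Qed.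

Lemma cylsup_ub w y : cyl w y -> H (size w) y <= cylsup H w.
Proof. by move=> wy; apply: ub_le_sup; [exact: has_ubound_cylsup | exists y]. Qed.

Lemma cylsup_empty w : ~ (cyl w !=set0) -> cylsup H w = 0.
Proof.
move=> /set0P/negP; rewrite negbK => /eqP w0.
by rewrite /cylsup w0 image_set0 sup0.
Qed.

Lemma cylsup_le w C : 0 <= C -> (forall y, cyl w y -> H (size w) y <= C) -> cylsup H w <= C.
Proof.
move=> C0 HC; have [[y wy]|w0] := pselect (cyl w !=set0); last by rewrite cylsup_empty.
by apply: ge_sup; [exists (H (size w) y), y | move=> _ [z wz <-]; exact: HC].
Qed.

Lemma cylsup_ge0 w : 0 <= cylsup H w.
Proof.
have [[y wy]|w0] := pselect (cyl w !=set0); last by rewrite cylsup_empty.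
exact: le_trans (H0 _ y) (cylsup_ub wy).
Qed.

Lemma cylsup_submul :
  (forall n m y, X y -> H (n + m) y <= H n y * H m (iter n (@Defs.shift K) y)) ->
  submul (cylsup H).
Proof.
move=> Hs u v; apply: cylsup_le => [|y /[dup] [[Xy _]] /cyl_cat[uy vy]].
  by rewrite mulr_ge0 ?cylsup_ge0.
rewrite size_cat (le_trans (Hs _ _ _ Xy)) // ler_pM //; exact: cylsup_ub.
Qed.

End CylSup.

Lemma cylsupZ H H' c w : 0 < c -> bounded_on H' -> (forall n y, 0 <= H' n y) ->
  (forall n y, X y -> H n y <= c * H' n y) -> cylsup H w <= c * cylsup H' w.
Proof.
move=> c0 Hb' H'0 HH; apply: cylsup_le => [|y wy].
  by rewrite mulr_ge0 ?(ltW c0) ?cylsup_ge0.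
apply: le_trans (HH _ y wy.1) _.
by rewrite ler_wpM2l ?(ltW c0) //; exact: cylsup_ub.
Qed.

Lemma partition_sum_wsum d g (A : full_shift K -> 'M[R]_d) s n :
  let H n y := expR (birkhoff_sum g n y) * phi s (cocycle A y n) in
  bounded_on H -> partition_sum X g A s n = (wsum n (cylsup H))%:E.
Proof.
move=> H Hb; rewrite /partition_sum /wsum -sumEFin [RHS](bigID (fun w : n.-tuple K => `[< allowed X w >])) /=.
rewrite [X in (_ + X)%E]big1 ?adde0; last first.
  by move=> w /asboolPn Nw; rewrite cylsup_empty // => /allowed_cyl.
apply: eq_bigr => w /asboolP/allowed_cyl w0.
rewrite /cylsup -ereal_sup_EFin.
- congr (ereal_sup _); rewrite cylinder_cyl; apply/seteqP; split.
    move=> _ [y wy <-]; exists (H (size w) y); first by exists y.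
    by rewrite size_tuple.
  by move=> _ [_ [y wy <-] <-]; exists y; [exact: wy | rewrite size_tuple].
- exact: has_ubound_cylsup.
- by have [y wy] := w0; exists (H (size w) y), y.
Qed.

End Cylinders.

Lemma sft_shift (K : finType) (X : set (full_shift K)) :
  subshift_of_finite_type X -> forall x, X x -> X (Defs.shift x).
Proof.
move=> [F ->] x H w wF k occ; apply: (H w wF k.+1) => i.
by rewrite addSn; exact: occ.
Qed.

(** * The pressure in terms of compound norms *)

Section Psi.
Variables (R : realType) (d : nat).
Implicit Types (M N : 'M[R]_d) (s : 'rV[R]_d) (t : nat -> R).

(** With nonnegative exponents the base 0 is covered too: a + b vanishes only if a and b both do. *)
Lemma powRD_ge0 (x a b : R) : 0 <= a -> 0 <= b -> x `^ (a + b) = x `^ a * x `^ b.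
Proof.
move=> a0 b0; have [ab|ab] := eqVneq (a + b) 0; last by apply: powRD; rewrite (negbTE ab).
have -> : a = 0 by lra.
have -> : b = 0 by lra.
by rewrite addr0 powRr0 mulr1.
Qed.

Lemma powR_sum (I : Type) (r : seq I) (P : pred I) (F : I -> R) x :
  (forall i, P i -> 0 <= F i) ->
  \prod_(i <- r | P i) x `^ F i = x `^ (\sum_(i <- r | P i) F i).
Proof.
move=> F0; elim: r => [|i r IH]; first by rewrite !big_nil powRr0.
rewrite !big_cons; case: ifP => // Pi.
by rewrite powRD_ge0 ?IH ?F0 // sumr_ge0.
Qed.

Lemma powR_prod (I : Type) (r : seq I) (P : pred I) (F : I -> R) a :
  (forall i, P i -> 0 <= F i) ->
  (\prod_(i <- r | P i) F i) `^ a = \prod_(i <- r | P i) F i `^ a.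
Proof.
move=> F0; elim: r => [|i r IH]; first by rewrite !big_nil powR1.
by rewrite !big_cons; case: ifP => // Pi; rewrite powRM ?IH ?F0 ?prodr_ge0.
Qed.

Lemma le_powR (x y a : R) : 0 <= a -> 0 <= x -> x <= y -> x `^ a <= y `^ a.
Proof. by move=> a0 x0 xy; apply: ge0_ler_powR => //; rewrite nnegrE // (le_trans x0). Qed.

(* s_k extended by s_k = 0 for k >= d, so that gap_exp s k = s_{k+1} - s_{k+2}
   in the 1-based notation. *)
Definition sext s n : R := if insub n is Some i then s 0 i else 0.
Definition gap_exp s n : R := sext s n - sext s n.+1.

Definition psi t M : R := \prod_(k < d) cnorm k.+1 M `^ t k.

Lemma sext_ord s (i : 'I_d) : sext s i = s 0 i.
Proof. by rewrite /sext valK. Qed.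

Lemma sext_ge s n : (d <= n)%N -> sext s n = 0.
Proof. by move=> dn; rewrite /sext insubF // ltnNge dn. Qed.

Lemma gap_exp_ge0 s n : Lambda s -> 0 <= gap_exp s n.
Proof.
move=> [sD s0]; rewrite /gap_exp subr_ge0.
have [nd|dn] := ltnP n.+1 d; last first.
  rewrite (sext_ge _ dn); have [nd|dn'] := ltnP n d; last by rewrite sext_ge.
  by rewrite (sext_ord s (Ordinal nd)).
by rewrite (sext_ord s (Ordinal nd)) (sext_ord s (Ordinal (ltnW nd))) sD /=.
Qed.

Lemma sum_gap_exp s (i : 'I_d) : \sum_(k < d | (i <= k)%N) gap_exp s k = s 0 i.
Proof.
rewrite -(big_geq_mkord i d xpredT (gap_exp s)).
under eq_bigr do rewrite /gap_exp -opprB.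
by rewrite sumrN telescope_sumr ?(ltnW (ltn_ord i)) // opprB sext_ord (sext_ge _ (leqnn d)) subr0.
Qed.

(** Summation by parts: s_i is the sum of the differences s_k - s_(k+1) over k >= i. This expresses
    phi by products of leading singular values with nonnegative exponents. *)
Lemma phi_top s M : Lambda s -> phi s M = \prod_(k < d) top k.+1 M `^ gap_exp s k.
Proof.
move=> sL; rewrite /phi.
transitivity (\prod_(i < d) \prod_(k < d | (i <= k)%N) sv M i `^ gap_exp s k).
  apply: eq_bigr => i _; rewrite powR_sum ?sum_gap_exp //.
  by move=> k _; exact: gap_exp_ge0.
rewrite (exchange_big_dep xpredT) //=; apply: eq_bigr => k _.
rewrite /top powR_prod; last by move=> *; exact: sv_ge0.
rewrite (big_ord_widen d (fun i => sv M i `^ gap_exp s k)) //=.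
Qed.

Lemma psi_ge0 t M : 0 <= psi t M.
Proof. by apply: prodr_ge0 => k _; exact: powR_ge0. Qed.

Lemma le_psi t M (c : nat -> R) : (forall k, 0 <= t k) ->
  (forall k, (k < d)%N -> cnorm k.+1 M <= c k) -> psi t M <= \prod_(k < d) c k `^ t k.
Proof.
move=> t0 H; apply: ler_prod => k _.
by rewrite powR_ge0 /= le_powR ?cnorm_ge0 ?H.
Qed.

Lemma psi_mul t M N : (forall k, 0 <= t k) -> psi t (M *m N) <= psi t M * psi t N.
Proof.
move=> t0; apply: le_trans (le_psi t0 (fun k _ => cnorm_mul k.+1 M N)) _.
rewrite /psi -big_split /=; apply: ler_prod => k _.
by rewrite powR_ge0 /= powRM ?cnorm_ge0.
Qed.

Lemma psi_phi s : Lambda s -> exists2 c : R, 0 < c &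
  forall M, psi (gap_exp s) M <= c * phi s M /\ phi s M <= c * psi (gap_exp s) M.
Proof.
move=> sL; have s0 k : 0 <= gap_exp s k by exact: gap_exp_ge0.
have ex k : exists c : R, 1 <= c /\
    forall M : 'M[R]_d, top k M <= c * cnorm k M /\ cnorm k M <= c * top k M.
  by have [c c1 H] := cnorm_top R d k; exists c.
have [C HC] := choice ex.
have C0 k : 0 < C k by have [c1 _] := HC k; exact: lt_le_trans c1.
exists (\prod_(k < d) C k.+1 `^ gap_exp s k); first by apply: prodr_gt0 => k _; exact: powR_gt0.
move=> M; rewrite phi_top //; split; rewrite -big_split; apply: ler_prod => k _.
  rewrite powR_ge0 /= -powRM ?(ltW (C0 _)) ?top_ge0 // le_powR ?cnorm_ge0 //.
  by have [_ /(_ M) []] := HC k.+1.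
rewrite powR_ge0 /= -powRM ?(ltW (C0 _)) ?cnorm_ge0 // le_powR ?top_ge0 //.
by have [_ /(_ M) []] := HC k.+1.
Qed.

End Psi.

Section Pressure.
Variables (R : realType) (K : finType) (X : set (full_shift K)) (d : nat).
Hypothesis Xshift : forall x, X x -> X (Defs.shift x).
Variable (g : full_shift K -> R).
Hypothesis gb : exists C : R, forall x, X x -> `|g x| <= C.
Implicit Types (A : full_shift K -> 'M[R]_d) (t : nat -> R).
Local Notation T := (@Defs.shift K).

(** Under this bound the suprema over cylinders are finite; every cocycle uniformly close to a
    locally constant one satisfies it. *)
Definition cbounded A := exists C : R, forall k x, (k <= d)%N -> X x -> cnorm k (A x) <= C.

Lemma cocycle_add A x n m : cocycle A x (n + m) = cocycle A (iter n T x) m *m cocycle A x n.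
Proof.
elim: m => [|m IH]; first by rewrite addn0 mul1mx.
by rewrite addnS /= IH mulmxA -iterD addnC.
Qed.

Lemma birkhoff_add x n m :
  birkhoff_sum g (n + m) x = birkhoff_sum g n x + birkhoff_sum g m (iter n T x).
Proof.
rewrite /birkhoff_sum big_split_ord /=; congr (_ + _).
by apply: eq_bigr => i _; rewrite -iterD addnC.
Qed.

Definition Hpsi A t n y : R := expR (birkhoff_sum g n y) * psi t (cocycle A y n).
Definition Zpsi A t n : R := wsum n (cylsup X (Hpsi A t)).

Lemma Hpsi_ge0 A t n y : 0 <= Hpsi A t n y.
Proof. by rewrite mulr_ge0 ?expR_ge0 ?psi_ge0. Qed.

Lemma cocycle_bound A k n : cbounded A -> (k <= d)%N ->
  exists C : R, forall x, X x -> cnorm k (cocycle A x n) <= C.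
Proof.
move=> [C HC] kd; elim: n => [|n [D HD]]; first by exists (cnorm k (1%:M : 'M[R]_d)).
exists (C * D) => x Xx /=; apply: le_trans (cnorm_mul _ _ _) _.
by rewrite ler_pM ?cnorm_ge0 ?HD ?HC //; exact: iter_shift_in.
Qed.

Lemma birkhoff_bound n : exists C : R, forall x, X x -> `|birkhoff_sum g n x| <= C.
Proof.
have [C HC] := gb; exists (n%:R * C) => x Xx; apply: le_trans (ler_norm_sum _ _ _) _.
rewrite mulr_natl -[X in _ *+ X](card_ord n) -sumr_const; apply: ler_sum => i _.
by apply: HC; exact: iter_shift_in.
Qed.

Lemma Hpsi_bounded A t : (forall k, 0 <= t k) -> cbounded A -> bounded_on X (Hpsi A t).
Proof.
move=> t0 bA n; have [D HD] := birkhoff_bound n.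
have ex k : exists c : R, (k < d)%N -> forall x, X x -> cnorm k.+1 (cocycle A x n) <= c.
  have [kd|] := ltnP k d; last by exists 0.
  by have [c Hc] := cocycle_bound n bA kd; exists c.
have [C HC] := choice ex.
exists (expR D * \prod_(k < d) C k `^ t k) => y Xy.
rewrite ler_pM ?expR_ge0 ?psi_ge0 //.
  by rewrite ler_expR (le_trans (ler_norm _)) ?HD.
by apply: le_psi => // k kd; exact: HC.
Qed.

Lemma Hpsi_submul A t n m y : (forall k, 0 <= t k) -> X y ->
  Hpsi A t (n + m) y <= Hpsi A t n y * Hpsi A t m (iter n T y).
Proof.
move=> t0 Xy; rewrite /Hpsi birkhoff_add cocycle_add expRD mulrACA.
by rewrite ler_wpM2l ?mulr_ge0 ?expR_ge0 // mulrC psi_mul.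
Qed.

Lemma cylsup_psi_submul A t : (forall k, 0 <= t k) -> cbounded A ->
  submul (cylsup X (Hpsi A t)).
Proof.
move=> t0 bA; apply: cylsup_submul => //; first exact: Hpsi_ge0.
  exact: Hpsi_bounded.
by move=> n m y Xy; exact: Hpsi_submul.
Qed.

Lemma cylsup_psi_ge0 A t w : (forall k, 0 <= t k) -> cbounded A ->
  0 <= cylsup X (Hpsi A t) w.
Proof. by move=> t0 bA; apply: cylsup_ge0; [exact: Hpsi_ge0 | exact: Hpsi_bounded]. Qed.

Lemma Zpsi_ge0 A t n : (forall k, 0 <= t k) -> cbounded A -> 0 <= Zpsi A t n.
Proof. by move=> t0 bA; apply: wsum_ge0 => w; exact: cylsup_psi_ge0. Qed.

Lemma Zpsi_submul A t n m : (forall k, 0 <= t k) -> cbounded A ->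
  Zpsi A t (n + m) <= Zpsi A t n * Zpsi A t m.
Proof.
move=> t0 bA; apply: wsum_submul; last exact: cylsup_psi_submul.
by move=> w; exact: cylsup_psi_ge0.
Qed.

(** Replacing phi by psi changes the partition sums by bounded factors only, and psi is
    submultiplicative with constant 1. *)
Lemma pressure_growth A s : Lambda s -> cbounded A ->
  pressure X g A s = growth (Zpsi A (gap_exp s)).
Proof.
move=> sL bA; have t0 k : 0 <= gap_exp s k by exact: gap_exp_ge0.
have [c c0 Hc] := psi_phi sL.
pose H n y := expR (birkhoff_sum g n y) * phi s (cocycle A y n).
have H0 n y : 0 <= H n y.
  by rewrite mulr_ge0 ?expR_ge0 // prodr_ge0 // => i _; exact: powR_ge0.
have Hb : bounded_on X H.
  move=> n; have [C HC] := Hpsi_bounded t0 bA n; exists (c * C) => y Xy.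
  apply: (@le_trans _ _ (c * Hpsi A (gap_exp s) n y)); last by rewrite ler_wpM2l ?(ltW c0) ?HC.
  by rewrite /H /Hpsi mulrCA ler_wpM2l ?expR_ge0 //; have [] := Hc (cocycle A y n).
rewrite /pressure.
under eq_fun => n do rewrite (partition_sum_wsum Xshift n Hb).
have ci : 0 < c^-1 by rewrite invr_gt0.
apply: (lim_scaled_lne _ _ ci c0).
- by move=> n; exact: Zpsi_ge0.
- by move=> n m; exact: Zpsi_submul.
- by move=> n; apply: wsum_ge0 => w; exact: cylsup_ge0.
- move=> n; rewrite ler_pdivrMl // -wsumZ; apply: le_wsum => w _.
  apply: cylsupZ => // m y Xy.
  by rewrite /H /Hpsi mulrCA ler_wpM2l ?expR_ge0 //; have [] := Hc (cocycle A y m).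
- move=> n; rewrite -wsumZ; apply: le_wsum => w _.
  apply: cylsupZ => //; [exact: Hpsi_bounded | exact: Hpsi_ge0 | move=> m y Xy].
  by rewrite /H /Hpsi mulrCA ler_wpM2l ?expR_ge0 //; have [] := Hc (cocycle A y m).
Qed.

End Pressure.

(** * Uniform continuity on a subshift *)

Section Modulus.
Variables (K : finType).
Implicit Types (x y z : full_shift K).
Local Notation T := (@Defs.shift K).

Lemma initialP x y m : initial x m = initial y m <-> forall i, (i < m)%N -> x i = y i.
Proof.
split=> [H i im|H].
  by have := congr1 (nth (x 0%N : K) ^~ i) H; rewrite !nth_mkseq.
by apply/eq_in_map => i; rewrite mem_iota => /andP[_ im]; exact: H.
Qed.

Lemma nbhs_initial z (m : nat) : nbhs z [set y | initial y m = initial z m].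
Proof.
elim: m => [|m IH]; first by apply: filterS filterT => y _.
have mz : nbhs z [set y | y m = z m].
  apply: (@proj_continuous nat (fun=> discrete_topology K) m z [set c | c = z m]).
  by apply: open_nbhs_nbhs; split => //; exact: discrete_open.
apply: filterS (filterI IH mz) => y [/initialP H ym].
by apply/initialP => i; rewrite ltnS leq_eqVlt => /predU1P[->//|]; exact: H.
Qed.

Lemma initial_nbhs z (U : set (full_shift K)) : nbhs z U ->
  exists m : nat, [set y | initial y m = initial z m] `<=` U.
Proof.
pose F := filter_from [set: nat] (fun m => [set y | initial y m = initial z m]).
have FF : Filter F.
  apply: filter_from_filter; first by exists 0%N.
  move=> i j _ _; exists (maxn i j) => // y /initialP H.
  by split; apply/initialP => k ki; apply: H; rewrite leq_max ki ?orbT.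
suff Fz : F --> z by move=> /Fz[m _ mU]; exists m.
apply/cvg_sup => i U'.
have /= -> := @nbhsE (initial_topology (fun f : nat -> discrete_topology K => f i)) z.
case=> B [[C oC <-] /= Cz] /filterS; apply; exists i.+1 => // y /initialP H /=.
by rewrite (H i).
Qed.

Lemma full_shift_compact : compact [set: full_shift K].
Proof.
have := @tychonoff nat (fun=> discrete_topology K) (fun=> setT).
rewrite (_ : [set f : forall i, _ | _] = setT); last by apply/seteqP; split.
by apply => i; apply: finite_compact; exact: finite_finset.
Qed.

Lemma sft_limit (X : set (full_shift K)) z : subshift_of_finite_type X ->
  (forall m, exists2 x, X x & initial x m = initial z m) -> X z.
Proof.
move=> [F ->] H w wF k occ; have [x Xx /initialP xz] := H (k + size w)%N.
apply: (Xx w wF k) => i; have /= <- := occ i.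
by rewrite xz // ltn_add2l.
Qed.

Variables (R : realType) (X : set (full_shift K)) (g : full_shift K -> R).
Hypotheses (hX : subshift_of_finite_type X) (hg : {within X, continuous g}).

(** A sequence of bad pairs would have a cluster point of first components, which lies in X. Along
    it the second components agree with the first on ever longer initial words, hence also approach
    the same point, against continuity there. *)
Lemma uniform_modulus (e : R) : 0 < e -> exists m : nat, forall x y, X x -> X y ->
  initial x m = initial y m -> `|g x - g y| < e.
Proof.
move=> e0; apply: contrapT => /forallNP H.
have bad m : exists p : full_shift K * full_shift K,
    [/\ X p.1, X p.2, initial p.1 m = initial p.2 m & e <= `|g p.1 - g p.2|].
  apply: contrapT => Hm; apply: (H m) => x y Xx Xy xy.
  by rewrite ltNge; apply/negP => le; apply: Hm; exists (x, y).
have [p pP] := choice bad.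
have [z [_ zcl]] := @full_shift_compact ((fst \o p) @ \oo) _ filterT.
have near_z m : exists n, (m <= n)%N /\ initial (p n).1 m = initial z m.
  have S : \forall n \near \oo, [set x | exists2 n, (m <= n)%N & x = (p n).1] ((fst \o p) n).
    by exists m => // n /= mn; exists n.
  have [_ [[n mn ->] E]] := zcl _ _ S (nbhs_initial z m).
  by exists n.
have Xz : X z.
  apply: sft_limit => // m; have [n [_ E]] := near_z m.
  by exists (p n).1 => //; have [] := pP n.
have e20 : 0 < e / 2 by rewrite divr_gt0.
move: hg => /subspace_continuousP /(_ z Xz).
move=> /cvgrPdist_lt /(_ _ e20) /initial_nbhs [m mU].
have [n [mn E]] := near_z m; have [X1 X2 E' big] := pP n.
have E2 : initial (p n).2 m = initial z m.
  by rewrite -E; apply/initialP => i im; move/initialP: E' => ->//; exact: leq_trans mn.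
have h1 := mU _ E X1; have h2 := mU _ E2 X2.
move: big; rewrite leNgt => /negP; apply.
rewrite (_ : _ - _ = (g z - g (p n).2) - (g z - g (p n).1)); last by ring.
rewrite (le_lt_trans (ler_normB _ _)) // (splitr e) ltrD //.
Qed.

Lemma bounded_of_modulus : exists C : R, forall x, X x -> `|g x| <= C.
Proof.
have [m Hm] := uniform_modulus ltr01.
have ex (w : m.-tuple K) : exists o : R, forall x, X x -> initial x m = w -> `|g x| <= o.
  have [[x [Xx xw]]|N] := pselect (exists x, X x /\ initial x m = w); last first.
    by exists 0 => x Xx xw; exfalso; apply: N; exists x.
  exists (`|g x| + 1) => y Xy yw; rewrite -lerBlDl (le_trans (lerB_dist _ _)) // ltW //.
  by apply: Hm => //; rewrite yw.
have [f fP] := choice ex.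
exists (\sum_(w : m.-tuple K) `|f w|) => x Xx.
have sz : size (initial x m) == m by rewrite size_initial.
rewrite (bigD1 (Tuple sz)) //= (le_trans (fP (Tuple sz) x Xx erefl)) //.
by rewrite (le_trans (ler_norm _)) // ler_wpDr // sumr_ge0.
Qed.

End Modulus.

(** * Rates and regular words *)

Section Tilt.
Variables (R : realType) (K : finType) (d : nat).
Variables (G : seq K -> R) (Lf : nat -> seq K -> R).
Hypotheses (G0 : forall w, 0 <= G w) (Gs : submul G).
Hypothesis Ls : forall k u v, Lf k (u ++ v) <= Lf k u + Lf k v.
Implicit Types t : nat -> R.

Definition tq t w : R := G w * expR (\sum_(k < d) t k * Lf k w).

Lemma tq_ge0 t w : 0 <= tq t w.
Proof. by rewrite mulr_ge0 ?expR_ge0. Qed.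

Lemma tq_submul t : (forall k, 0 <= t k) -> submul (tq t).
Proof.
move=> t0 u v; rewrite /tq mulrACA -expRD ler_pM ?expR_ge0 //.
rewrite ler_expR -big_split; apply: ler_sum => k _ /=.
by rewrite -mulrDr ler_wpM2l.
Qed.

Let valid t (x : R) := forall n, (0 < n)%N -> expR (n%:R * x) <= wsum n (tq t).

Lemma tq_bound_of_invalid t x : (forall k, 0 <= t k) -> ~ valid t x ->
  exists2 C : R, 0 < C & forall n, wsum n (tq t) <= C * expR (n%:R * x).
Proof.
move=> t0 Nv; have [n [n0 Zn]] : exists n, (0 < n)%N /\ wsum n (tq t) <= expR (n%:R * x).
  apply: contrapT => H; apply: Nv => n n0; rewrite leNgt; apply/negP => lt.
  by apply: H; exists n; rewrite (ltW lt).
apply: (submul_bound _ _ n0 Zn) => [i|i j].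
  by apply: wsum_ge0 => w; exact: tq_ge0.
by apply: wsum_submul => [w|]; [exact: tq_ge0 | exact: tq_submul].
Qed.

(* An approximate maximiser t of the convex pressure minus a quadratic penalty
   is an approximate point of differentiability: the pressure lies below a
   paraboloid touching it at t, with gradient a.  Tilting t by +-tau in the
   k-th direction then shows, by Chernoff's bound, that the words w with
   Lf k w away from |w| a_k carry an exponentially small part of the sum. *)
Lemma tilt (th : nat -> R) (r P rho : R) (K0 : nat) :
  0 < r -> 0 < rho -> (forall k, r <= th k) ->
  (forall n, (0 < n)%N -> expR (n%:R * P) <= wsum n (tq th)) ->
  exists (t a : nat -> R) (p c eta C : R),
  [/\ forall k, `|t k - th k| <= r, P - rho <= p, 0 < c, 0 <= eta & K0%:R * eta <= c /\ c <= rho] /\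
  [/\ 0 < C, forall n, (0 < n)%N -> expR (n%:R * p) <= wsum n (tq t),
    forall n, wsum n (tq t) <= C * expR (n%:R * (p + eta)) &
    forall k, (k < d)%N -> forall n,
      wsum n (fun w => (rho * n%:R < `|Lf k w - n%:R * a k|)%R%:R * tq t w)
      <= C * expR (n%:R * (p - c))].
Proof.
move=> r0 rho0 rth vP.
pose box t := forall k, `|t k - th k| <= r.
have box0 t : box t -> forall k, 0 <= t k.
  by move=> bt k; have := bt k; have := rth k; rewrite ler_norml; lra.
have bth : box th by move=> k; rewrite subrr normr0 ltW.
have [Pm HPm] : exists Pm : R, forall t x, box t -> valid t x -> x <= Pm.
  (* The words of length 1 already bound every admissible rate over the whole box, since 1 + x <=
     e^x. *)
  pose B := \sum_(w : 1.-tuple K) G w * expR (\sum_(k < d) (th k + r) * `|Lf k w|).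
  exists B => t x bt /(_ 1%N isT); rewrite mul1r => H.
  have := expR_ge1Dx x; suff : wsum 1 (tq t) <= B by lra.
  apply: ler_sum => w _; rewrite ler_wpM2l // ler_expR; apply: ler_sum => k _.
  rewrite (le_trans (ler_norm _)) // normrM ler_wpM2r // ger0_norm ?box0 //.
  by have := bt k; rewrite ler_norml; lra.
have PPm : P <= Pm by exact: (HPm th).
(* The first term makes the penalty confine near-maximisers to the half box, which leaves room for
   the tilts; the second makes tau <= r / 2. *)
pose Cq := (Pm - P + 1) / (r / 2) ^+ 2 + rho / (2 * r).
have Cq0 : 0 < Cq by rewrite ltr_pwDl ?divr_gt0 ?exprn_gt0 ?divr_ge0 ?mulr_ge0 ?ltW //; lra.
have Cq1 : Pm - P + 1 <= Cq * (r / 2) ^+ 2.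
  rewrite -ler_pdivrMr ?exprn_gt0 ?divr_gt0 // lerDl divr_ge0 ?mulr_ge0 ?ltW //.
have Cq2 : rho <= Cq * (2 * r).
  rewrite -ler_pdivrMr ?mulr_gt0 // lerDr divr_ge0 ?exprn_ge0 ?divr_ge0 ?(ltW r0) //; lra.
clearbody Cq.
(* The gain tau rho of a tilt is then four times its quadratic cost Cq tau^2. One copy pays for that
   cost and one for the defect 2 e0 of the maximiser, which leaves 2 Cq tau^2 for the decay rate
   c. *)
pose tau := rho / (4 * Cq).
have tauE : tau * rho = 4 * (Cq * tau ^+ 2) by rewrite /tau; field; rewrite gt_eqF.
have tau0 : 0 < tau by rewrite divr_gt0 ?mulr_gt0.
have taur : tau <= r / 2 by rewrite ler_pdivrMr ?mulr_gt0 //; lra.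
clearbody tau.
pose c := Num.min (2 * (Cq * tau ^+ 2)) rho.
have Cqt : 0 < Cq * tau ^+ 2 by rewrite mulr_gt0 ?exprn_gt0.
have c0 : 0 < c by rewrite lt_min rho0 mulr_gt0.
have cle : c <= 2 * (Cq * tau ^+ 2) by rewrite ge_min lexx.
have crho : c <= rho by rewrite ge_min lexx orbT.
clearbody c.
have [e0 [e00 e01 erho ec eK]] : exists e0 : R, [/\ 0 < e0, e0 <= 1, e0 <= rho,
    2 * e0 <= Cq * tau ^+ 2 & K0%:R * (2 * e0) <= c].
  have KP : 0 < 2 * (K0%:R + 1) :> R by rewrite mulr_gt0 // ltr_wpDl.
  exists (Num.min (Num.min 1 rho) (Num.min (Cq * tau ^+ 2 / 2) (c / (2 * (K0%:R + 1))))).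
  split; rewrite ?lt_min ?ltr01 ?rho0 ?divr_gt0 //; rewrite ?ge_min ?lexx ?orbT //.
    rewrite mulrC -ler_pdivlMr // !ge_min ?lexx ?orbT //.
  have /le_trans-> // : K0%:R * (2 * Num.min (Num.min 1 rho) (Num.min (Cq * tau ^+ 2 / 2) (c / (2 * (K0%:R + 1))))) <=
     K0%:R * (2 * (c / (2 * (K0%:R + 1)))).
    by rewrite ler_wpM2l // ler_wpM2l // !ge_min lexx !orbT.
  rewrite (_ : K0%:R * _ = K0%:R / (K0%:R + 1) * c); last first.
    by field; rewrite gt_eqF // ltr_wpDl.
  by rewrite ler_piMl ?(ltW c0) // ler_pdivrMr ?ltr_wpDl // mul1r lerDl.
pose Q t : R := \sum_(k < d) (t k - th k) ^+ 2.
pose V : set R := fun y => exists t x, [/\ box t, valid t x & y = x - Cq * Q t].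
have V0 : classical_sets.nonempty V.
  exists P, th, P; split => //; rewrite /Q big1 ?mulr0 ?subr0 // => k _.
  by rewrite subrr expr0n.
have Q0 t : 0 <= Q t by apply: sumr_ge0 => k _; exact: sqr_ge0.
have Vub : has_ubound V.
  exists Pm => _ [t [x [bt vx ->]]]; have := HPm _ _ bt vx.
  have := mulr_ge0 (ltW Cq0) (Q0 t); lra.
have [_ [t0 [p [bt0 vp ->]]] near_sup] := sup_adherent e00 (conj V0 Vub).
have maxi t x : box t -> valid t x -> x <= p + Cq * (Q t - Q t0) + e0.
  move=> bt vx; have : x - Cq * Q t <= sup V by apply: ub_le_sup => //; exists t, x.
  by lra.
have Pp : P + Cq * Q t0 <= p + e0.
  have := maxi th P bth vP; have -> : Q th = 0.
    by rewrite /Q big1 // => k _; rewrite subrr expr0n.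
  lra.
(* The penalty sees the first d coordinates only; the others are put back to [th] so that all lie in
   the half box. *)
pose t k := if (k < d)%N then t0 k else th k.
have tq_t0 : tq t = tq t0.
  apply/funext => w; rewrite /tq; congr (_ * expR _); apply: eq_bigr => k _.
  by rewrite /t ltn_ord.
have tr2 k : `|t k - th k| <= r / 2.
  rewrite /t; case: ifP => [kd|_]; last by rewrite subrr normr0 divr_ge0 ?ltW.
  have : (t0 k - th k) ^+ 2 <= Q t0.
    rewrite /Q (bigD1 (Ordinal kd)) //= lerDl sumr_ge0 // => j _; exact: sqr_ge0.
  move=> Hk; rewrite -(@ler_pXn2r _ 2) ?nnegrE ?divr_ge0 ?(ltW r0) //.
  rewrite real_normK ?num_real // (le_trans Hk) // -(ler_pM2l Cq0) (le_trans _ Cq1) //.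
  by have := HPm _ _ bt0 vp; lra.
have Qt : Q t = Q t0 by apply: eq_bigr => k _; rewrite /t ltn_ord.
have bt : box t by move=> k; apply: (le_trans (tr2 k)); lra.
have vpt : valid t p by move=> n n0; rewrite tq_t0; exact: vp.
have [C1 C10 HC1] : exists2 C : R, 0 < C & forall n, wsum n (tq t) <= C * expR (n%:R * (p + 2 * e0)).
  apply: tq_bound_of_invalid; first exact: box0.
  by move=> /(maxi _ _ bt); rewrite Qt; lra.
pose a k := 2 * Cq * (t k - th k).
pose ts (s : R) k j := t j + s * tau * (j == k)%:R.
have bts (s : R) k : `|s| = 1 -> box (ts s k).
  move=> s1 j; rewrite /ts addrAC (le_trans (ler_normD _ _)) // (splitr r) lerD //.
  rewrite !normrM s1 mul1r (gtr0_norm tau0) normr_nat (le_trans _ taur) //.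
  by rewrite ler_piMr ?(ltW tau0) // lern1 leq_b1.
have Qts (s : R) k : (k < d)%N -> s ^+ 2 = 1 ->
    Q (ts s k) = Q t + 2 * s * tau * (t k - th k) + tau ^+ 2.
  move=> kd s1; rewrite /Q (bigD1 (Ordinal kd)) //= [in RHS](bigD1 (Ordinal kd)) //=.
  rewrite (eq_bigr (fun i : 'I_d => (t i - th i) ^+ 2)); last first.
    move=> i /negbTE ik; rewrite /ts (_ : (i : nat) == k = false) ?mulr0 ?addr0 //.
  have -> : tau ^+ 2 = s ^+ 2 * tau ^+ 2 by rewrite s1 mul1r.
  by rewrite /ts eqxx mulr1; ring.
have CTs (s : R) k : (k < d)%N -> `|s| = 1 -> s ^+ 2 = 1 -> exists2 C : R, 0 < C &
    forall n, wsum n (tq (ts s k)) <= C * expR (n%:R * (p + s * tau * a k + Cq * tau ^+ 2 + 2 * e0)).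
  move=> kd s1 s2; apply: tq_bound_of_invalid; first exact: box0 (bts _ _ s1).
  move=> /(maxi _ _ (bts s k s1)); rewrite (Qts _ _ kd s2) Qt /a; lra.
have tqts (s : R) k w : (k < d)%N -> tq (ts s k) w = tq t w * expR (s * tau * Lf k w).
  move=> kd; rewrite /tq -mulrA -expRD; congr (_ * expR _).
  under eq_bigr do rewrite /ts mulrDl.
  rewrite big_split /=; congr (_ + _); rewrite (bigD1 (Ordinal kd)) //= eqxx mulr1 big1 ?addr0 //.
  move=> i /negbTE ik; rewrite (_ : (i : nat) == k = false) ?mulr0 ?mul0r //.
have chernoff (s : R) k : (k < d)%N -> `|s| = 1 -> s ^+ 2 = 1 -> exists2 C : R, 0 < C &
    forall n, wsum n (fun w => (rho * n%:R < s * (Lf k w - n%:R * a k))%R%:R * tq t w)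
      <= C * expR (n%:R * (p - c)).
  move=> kd s1 s2; have [C C0 HC] := CTs s k kd s1 s2; exists C => // n.
  apply: (@le_trans _ _ (wsum n (tq (ts s k)) * expR (- (n%:R * (s * tau * a k + tau * rho))))).
    rewrite -wsumZr; apply: le_wsum => w _; rewrite tqts //.
    case: (ltrP (rho * n%:R)) => [H|_]; last by rewrite mul0r !mulr_ge0 ?expR_ge0.
    rewrite mul1r -mulrA -expRD ler_peMr ?tq_ge0 // -[leLHS]expR0 ler_expR.
    rewrite (_ : _ - _ = tau * (s * (Lf k w - n%:R * a k) - rho * n%:R)); last by ring.
    by rewrite mulr_ge0 ?(ltW tau0) // subr_ge0 ltW.
  rewrite -ler_pdivlMr ?expR_gt0 // -expRN opprK -[leRHS]mulrA -expRD.
  apply: (le_trans (HC n)); rewrite ler_wpM2l ?(ltW C0) // ler_expR -mulrDr ler_wpM2l //.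
  lra.
pose CC k (C : R) := 0 < C /\ (forall n,
  wsum n (fun w => (rho * n%:R < `|Lf k w - n%:R * a k|)%R%:R * tq t w) <= C * expR (n%:R * (p - c))).
have ex k : exists C : R, 0 < C /\ ((k < d)%N -> CC k C).
  have [kd|] := boolP (k < d)%N; last by exists 1.
  have [Ca Ca0 HCa] := chernoff 1 k kd (normr1 _) (expr1n _ _).
  have sN1 : (-1 : R) ^+ 2 = 1 by rewrite sqrrN expr1n.
  have [Cb Cb0 HCb] := chernoff (-1) k kd (normrN1 _) sN1.
  have CabP : 0 < Ca + Cb by exact: addr_gt0.
  exists (Ca + Cb); split=> // _; split=> // n.
  apply: (@le_trans _ _ (wsum n (fun w => (rho * n%:R < 1 * (Lf k w - n%:R * a k))%R%:R * tq t w +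
     (rho * n%:R < -1 * (Lf k w - n%:R * a k))%R%:R * tq t w))).
    apply: le_wsum => w _; rewrite -mulrDl ler_wpM2r ?tq_ge0 // mul1r mulN1r.
    have [x0|x0] := leP 0 (Lf k w - n%:R * a k); first by rewrite ger0_norm // lerDl.
    by rewrite ltr0_norm // lerDr.
  by rewrite wsumD mulrDl lerD.
have [f fP] := choice ex.
exists t, a, p, c, (2 * e0), (C1 + \sum_(k < d) f k).
have sf : 0 <= \sum_(k < d) f k by apply: sumr_ge0 => k _; have [/ltW] := fP k.
split; split => //; first by have := mulr_ge0 (ltW Cq0) (Q0 t0); lra.
- by lra.
- by lra.
- move=> n; apply: (le_trans (HC1 n)).
  by rewrite ler_wpM2r ?expR_ge0 // lerDl.
- move=> k kd n; have [_ /(_ kd) [_ /(_ n) H]] := fP k; apply: (le_trans H).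
  rewrite ler_wpM2r ?expR_ge0 // (bigD1 (Ordinal kd)) //= addrCA lerDl addr_ge0 ?(ltW C10) //.
  by apply: sumr_ge0 => j _; have [/ltW] := fP j.
Qed.

End Tilt.

Section Regular.
Variables (R : realType) (K : finType).
Implicit Types (q f : seq K -> R).

Lemma wsum_middle n1 n2 n3 q f : (forall w, 0 <= q w) -> submul q -> (forall w, 0 <= f w) ->
  wsum (n1 + (n2 + n3)) (fun x => f (take n2 (drop n1 x)) * q x) <=
  wsum n1 q * wsum n2 (fun w => f w * q w) * wsum n3 q.
Proof.
move=> q0 qs f0; rewrite wsum_add -mulrA -wsumZr; apply: le_wsum => u su.
rewrite wsum_add -wsumZr -wsumZ; apply: le_wsum => v sv.
rewrite -!wsumZ; apply: le_wsum => w sw.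
rewrite drop_size_cat // take_size_cat // mulrA mulrCA -mulrA ler_wpM2l //.
by rewrite (le_trans (qs _ _)) // -mulrA ler_wpM2l.
Qed.

Definition seg (m : nat) (x : seq K) b l := take (l * m) (drop (b * m) x).

Variables (d : nat) (Lf : nat -> seq K -> R) (q : seq K -> R) (n : nat).
Variables (a : nat -> R) (rho p c eta C : R).
Hypotheses (q0 : forall w, 0 <= q w) (qs : submul q) (c0 : 0 < c) (eta0 : 0 <= eta).
Hypotheses (etac : (2 * n)%:R * eta <= c) (C0 : 0 < C).
Hypothesis Hlo : forall i, (0 < i)%N -> expR (i%:R * p) <= wsum i q.
Hypothesis Hhi : forall i, wsum i q <= C * expR (i%:R * (p + eta)).
Hypothesis Hdev : forall k, (k < d)%N -> forall i,
  wsum i (fun w => (rho * i%:R < `|Lf k w - i%:R * a k|)%R%:R * q w)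
  <= C * expR (i%:R * (p - c)).

Definition deviant m x (k b l : nat) : bool :=
  rho * (l * m)%:R < `|Lf k (seg m x b l) - (l * m)%:R * a k|.

Definition regular m x : bool :=
  [forall k : 'I_d, forall b : 'I_n, forall l : 'I_n.+1,
    (0 < l)%N && (b + l <= n)%N ==> ~~ deviant m x k b l].

Lemma regularP m x k b l : regular m x -> (k < d)%N -> (0 < l)%N -> (b + l <= n)%N ->
  `|Lf k (seg m x b l) - (l * m)%:R * a k| <= rho * (l * m)%:R.
Proof.
move=> /forallP H kd l0 bl; have bn : (b < n)%N by rewrite (leq_trans _ bl) // -addn1 leq_add2l.
have ln : (l < n.+1)%N by rewrite ltnS (leq_trans _ bl) // leq_addl.
have /forallP/(_ (Ordinal bn))/forallP/(_ (Ordinal ln))/implyP := H (Ordinal kd).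
by rewrite /= l0 bl => /(_ isT); rewrite /deviant -leNgt.
Qed.

(** Union bound over the choices of k, b and l. A deviant segment of l >= 1 pieces gains e^(-c l m),
    whereas the pieces around it lose at most e^(n m eta), and n eta <= c / 2. For large m the
    remaining e^(-m c / 2) beats the number of choices and the constant C^3. *)
Lemma regular_weight : exists m0, forall m, (m0 <= m)%N -> (0 < n * m)%N ->
  expR ((n * m)%:R * p) / 2 <= wsum (n * m) (fun x => (regular m x)%:R * q x).
Proof.
pose N3 : R := d%:R * (n%:R * n.+1%:R).
have N30 : 0 <= N3 by rewrite !mulr_ge0.
pose D := 2 * (N3 * C ^+ 3).
have D0 : 0 <= D by rewrite !mulr_ge0 ?exprn_ge0 // ltW.
exists (Num.truncn (D / (c / 2))).+1 => m mbig nm0.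
have Dm : D <= expR (m%:R * (c / 2)).
  apply: le_trans (expR_ge1Dx _); apply: (@le_trans _ _ (m%:R * (c / 2))); last by rewrite lerDr.
  rewrite -ler_pdivrMr ?divr_gt0 // (le_trans (ltW (truncnS_gt _))) // ler_nat //.
have bound k b l : (k < d)%N -> (0 < l)%N -> (b + l <= n)%N ->
    wsum (n * m) (fun x => (deviant m x k b l)%:R * q x) <=
    C ^+ 3 * expR ((n * m)%:R * p - m%:R * (c / 2)).
  move=> kd l0 bl; pose r := (n - (b + l))%N.
  have E : (n * m = b * m + (l * m + r * m))%N by rewrite -!mulnDl addnA subnKC.
  rewrite {1}E; pose f w : R := (rho * (l * m)%:R < `|Lf k w - (l * m)%:R * a k|)%R%:R.
  apply: (le_trans (wsum_middle _ _ _ (f := f) q0 qs _)); first by move=> w; exact: ler0n.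
  apply: (@le_trans _ _ ((C * expR ((b * m)%:R * (p + eta))) * (C * expR ((l * m)%:R * (p - c))) *
     (C * expR ((r * m)%:R * (p + eta))))).
    by rewrite ler_pM ?mulr_ge0 ?wsum_ge0 ?ler_pM ?wsum_ge0 ?Hdev // => w; rewrite mulr_ge0 ?ler0n.
  rewrite (_ : _ * _ * _ = C ^+ 3 * expR ((b * m)%:R * (p + eta) + (l * m)%:R * (p - c) + (r * m)%:R * (p + eta))); last first.
    by rewrite !expRD; ring.
  rewrite ler_wpM2l ?exprn_ge0 ?(ltW C0) // ler_expR E !natrD !natrM.
  have nE : n%:R = b%:R + l%:R + r%:R :> R by rewrite -!natrD subnKC.
  have m0 : 0 <= m%:R :> R by [].
  have l1 : 1 <= l%:R :> R by rewrite ler1n.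
  have h1 : (b%:R + r%:R) * eta <= c / 2.
    have : 2 * (n%:R * eta) <= c by rewrite mulrA -natrM.
    have : 0 <= l%:R * eta by rewrite mulr_ge0.
    rewrite nE; lra.
  have h2 : c <= l%:R * c by rewrite ler_peMl // ltW.
  rewrite -subr_ge0; rewrite (_ : _ - _ = m%:R * (l%:R * c - (b%:R + r%:R) * eta - c / 2)); last by ring.
  by rewrite mulr_ge0 //; lra.
have split_reg : wsum (n * m) q <= wsum (n * m) (fun x => (regular m x)%:R * q x) +
    wsum (n * m) (fun x => \sum_(i : 'I_d * ('I_n * 'I_n.+1) | (0 < i.2.2)%N && (i.2.1 + i.2.2 <= n)%N)
      (deviant m x i.1 i.2.1 i.2.2)%:R * q x).
  rewrite -wsumD; apply: le_wsum => x _; case: (boolP (regular m x)) => [_|].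
    by rewrite mul1r lerDl sumr_ge0 // => i _; rewrite mulr_ge0.
  rewrite mul0r add0r => /forallPn[k /forallPn[b /forallPn[l]]].
  rewrite negb_imply negbK => /andP[bl dv].
  rewrite (bigD1 (k, (b, l))) //= dv mul1r lerDl sumr_ge0 // => i _.
  by rewrite mulr_ge0.
rewrite wsum_sum in split_reg.
have : \sum_(i : 'I_d * ('I_n * 'I_n.+1) | (0 < i.2.2)%N && (i.2.1 + i.2.2 <= n)%N)
      wsum (n * m) (fun x => (deviant m x i.1 i.2.1 i.2.2)%:R * q x) <= expR ((n * m)%:R * p) / 2.
  apply: (@le_trans _ _ (\sum_(i : 'I_d * ('I_n * 'I_n.+1)) C ^+ 3 * expR ((n * m)%:R * p - m%:R * (c / 2)))).
    rewrite [leRHS](bigID (fun i : 'I_d * ('I_n * 'I_n.+1) => (0 < i.2.2)%N && (i.2.1 + i.2.2 <= n)%N)) /=.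
    rewrite ler_wpDr ?sumr_ge0 //; first by move=> i _; rewrite mulr_ge0 ?expR_ge0 ?exprn_ge0 ?ltW.
    by apply: ler_sum => i /andP[i1 i2]; exact: bound.
  rewrite sumr_const -[leLHS]mulr_natl !card_prod !card_ord expRD expRN.
  have Em0 : 0 < expR (m%:R * (c / 2)) by exact: expR_gt0.
  have Ep0 : 0 <= expR ((n * m)%:R * p) by exact: expR_ge0.
  move: Em0 Ep0 Dm; set Ep := expR ((n * m)%:R * p); set Em := expR _ => Em0 Ep0 Dm.
  rewrite ler_pdivlMr // !natrM -/N3.
  rewrite (_ : _ * 2 = D * Ep / Em); last by rewrite /D; field; rewrite gt_eqF.
  by rewrite ler_pdivrMr // mulrC ler_wpM2l.
have := Hlo nm0; lra.
Qed.

End Regular.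

(** * Truncated norms of products along words *)

Section Blocks.
Variables (R : realType) (K : finType) (d : nat) (a : K -> 'M[R]_d).

(** The letter read first acts first, as in the cocycle; concatenation therefore reverses the
    factors. *)
Definition mw (w : seq K) : 'M[R]_d := foldl (fun M c => a c *m M) 1%:M w.

Lemma mw_cat u v : mw (u ++ v) = mw v *m mw u.
Proof.
have foldM M : foldl (fun M c => a c *m M) M v = mw v *m M.
  elim/last_ind: v => [|v c IH]; first by rewrite mul1mx.
  by rewrite /mw -cats1 !foldl_cat /= IH mulmxA.
by rewrite /mw foldl_cat foldM.
Qed.

Lemma mw_seg m x b l : ((b + l) * m <= size x)%N ->
  mw (seg m x b l) = mprod (fun i => mw (seg m x (b + i) 1)) l.
Proof.
elim: l => [|l IH] H; first by rewrite /seg mul0n take0.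
rewrite /= -IH; last by apply: leq_trans H; rewrite leq_mul2r leq_add2l leqnSn orbT.
rewrite -mw_cat; congr mw.
by rewrite /seg mul1n mulSn [(m + _)%N]addnC takeD drop_drop -mulnDl [(l + b)%N]addnC.
Qed.

Lemma size_seg m (x : seq K) b l : ((b + l) * m <= size x)%N -> size (seg m x b l) = (l * m)%N.
Proof.
move=> H; rewrite /seg size_takel // size_drop leq_subRL; first by rewrite -mulnDl.
by apply: leq_trans H; rewrite leq_mul2r leq_addr orbT.
Qed.

Variable L : R.
Hypothesis L0 : 0 <= L.

(** The floor is exponential in the length, hence multiplicative under concatenation, so the
    truncated norm stays submultiplicative while its logarithm is finite. *)
Definition tnorm k w : R := Num.max (cnorm k (mw w)) (expR (- (L * (size w)%:R))).
Definition tlog k w : R := ln (tnorm k w).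

Lemma tnorm_gt0 k w : 0 < tnorm k w.
Proof. by rewrite lt_max expR_gt0 orbT. Qed.

Lemma expR_tlog k w : expR (tlog k w) = tnorm k w.
Proof. by rewrite lnK // posrE tnorm_gt0. Qed.

Lemma tnorm_submul k u v : tnorm k (u ++ v) <= tnorm k u * tnorm k v.
Proof.
rewrite {1}/tnorm ge_max; apply/andP; split.
  rewrite mw_cat mulrC (le_trans (cnorm_mul _ _ _)) //.
  by rewrite ler_pM ?cnorm_ge0 // le_max lexx.
rewrite size_cat natrD mulrDr opprD expRD.
by rewrite ler_pM ?expR_ge0 // le_max lexx orbT.
Qed.

Lemma tlog_sub k u v : tlog k (u ++ v) <= tlog k u + tlog k v.
Proof.
rewrite -lnM ?posrE ?tnorm_gt0 // ler_ln ?posrE ?mulr_gt0 ?tnorm_gt0 //.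
exact: tnorm_submul.
Qed.

Lemma cnorm_le_tnorm k w : cnorm k (mw w) <= tnorm k w.
Proof. by rewrite le_max lexx. Qed.

Lemma tnorm0 w : tnorm 0 w = 1.
Proof.
rewrite /tnorm cnorm0 max_l // -[leRHS]expR0 ler_expR oppr_le0 mulr_ge0 //.
Qed.

Lemma tnorm_top w : tnorm d.+1 w = expR (- (L * (size w)%:R)).
Proof. by rewrite /tnorm cnorm_gt // max_r // expR_ge0. Qed.

(* The rates al_1, ..., al_d are completed by al_0 = 0 and al_(d+1) = -L, the
   values that the truncated norms of the orders 0 and d+1 impose. *)
Definition rates (al : nat -> R) : Prop := al 0 = 0 /\ al d.+1 = - L.

Definition controlled (al : nat -> R) (rho : R) w := forall k, (k <= d.+1)%N ->
  expR ((size w)%:R * (al k - rho)) <= tnorm k w <= expR ((size w)%:R * (al k + rho)).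

(** The last condition keeps the rate clear of the floor: on controlled nonempty words the
    truncation is inactive at k. *)
Definition gap (al : nat -> R) (e rho : R) k :=
  [&& (0 < k <= d)%N, e <= 2 * al k - al k.-1 - al k.+1 & rho < al k + L].

Lemma controlled_gap al e rho k w : controlled al rho w -> gap al e rho k -> (0 < size w)%N ->
  cnorm k (mw w) = tnorm k w.
Proof.
move=> cw /and3P[/andP[k0 kd] _ kL] w0; have /andP[lo _] := cw k (leqW kd).
have s0 : 0 < (size w)%:R * (al k + L - rho).
  by rewrite mulr_gt0 ?ltr0n // subr_gt0.
rewrite /tnorm max_l //; move: lo; rewrite /tnorm le_max => /orP[|].
  by move=> lo; apply: le_trans lo; rewrite ler_expR; lra.
by rewrite ler_expR; lra.
Qed.

Lemma regular_controlled (ak al : nat -> R) rho n m x b l :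
  rates al -> (forall k, (k < d)%N -> al k.+1 = ak k) -> 0 <= rho -> 
  regular d (fun k => tlog k.+1) n ak rho m x -> size x = (n * m)%N ->
  (0 < l)%N -> (b + l <= n)%N -> controlled al rho (seg m x b l).
Proof.
move=> [al0 aldL] alE rho0 reg sx l0 bl.
have sz : size (seg m x b l) = (l * m)%N.
  by rewrite size_seg // sx leq_mul2r bl orbT.
move=> k kd; rewrite sz; case: k kd => [_|k].
  rewrite tnorm0 al0 sub0r add0r -expR0 !ler_expR mulr_ge0 // andbT.
  by rewrite mulrN oppr_le0 mulr_ge0.
rewrite ltnS leq_eqVlt => /predU1P[->|kd].
  rewrite tnorm_top sz aldL !ler_expR !mulrDr !mulrN mulrC gerDl oppr_le0 lerDl.
  by rewrite !mulr_ge0.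
have := regularP reg kd l0 bl; rewrite ler_norml alE // -expR_tlog !ler_expR.
by move=> /andP[h1 h2]; apply/andP; split; lra.
Qed.

(** By [cmp_minor2] the error is governed by the norms of orders k - 1 and k + 1 over the square of
    the norm of order k. The concavity defect e of the rates makes this quotient decay; the four
    controlled norms involved cost 4 rho. *)
Lemma near_rank1_of_gap al e rho : 0 <= rho -> 4 * rho <= e ->
  exists2 C : R, 0 < C & forall w m k, controlled al rho w -> (0 < m <= size w)%N ->
  gap al e rho k -> exists u v,
    near_rank1 (cmp (k := k) (mw w)) u v (C * expR (- (m%:R * (e - 4 * rho)))).
Proof.
move=> rho0 rhoe.
have ex k : exists C : R, 0 < C /\ forall w m, controlled al rho w -> (0 < m <= size w)%N ->
    gap al e rho k -> exists u v,
    near_rank1 (cmp (k := k) (mw w)) u v (C * expR (- (m%:R * (e - 4 * rho)))).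
  case: k => [|k]; first by exists 1; split.
  have [C C0 HC] := cmp_minor2 R d k.
  pose D : R := #|{: {ffun 'I_k.+1 -> 'I_d}}|%:R.
  exists (D ^+ 2 * C + 1); split; first by rewrite ltr_wpDl // mulr_ge0 ?sqr_ge0.
  move=> w m cw /andP[m0 mw'] gk; have w0 := leq_trans m0 mw'.
  have E := controlled_gap cw gk w0; have N0 := tnorm_gt0 k.+1 w.
  have /and3P[/andP[_ kd] ge _] := gk.
  have Npos : 0 < nrm (cmp (k := k.+1) (mw w)) by rewrite -/(cnorm _ _) E.
  have [u [v H]] := near_rank1_minor2 Npos (fun f f' g g' => HC (mw w) f f' g g').
  exists u, v; apply: near_rank1_le H; rewrite -/D -/(cnorm _ _) E.
  apply: (@le_trans _ _ (D ^+ 2 * C * expR (- (m%:R * (e - 4 * rho))))); last first.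
    by rewrite ler_wpM2r ?expR_ge0 // lerDl.
  rewrite mulrA -mulrA ler_wpM2l ?mulr_ge0 ?sqr_ge0 //.
  have /andP[lo _] := cw k.+1 (leqW kd).
  have /andP[_ h1] := cw k (leq_trans (leqnSn _) (leqW kd)).
  have /andP[_ h2] := cw k.+2 kd.
  rewrite ler_pdivrMr ?exprn_gt0 //.
  apply: (@le_trans _ _ (expR ((size w)%:R * (al k + rho)) * expR ((size w)%:R * (al k.+2 + rho)))).
    rewrite ler_pM ?cnorm_ge0 //.
      exact: le_trans (cnorm_le_tnorm _ _) h1.
    exact: le_trans (cnorm_le_tnorm _ _) h2.
  apply: (@le_trans _ _ (expR (- (m%:R * (e - 4 * rho))) * expR ((size w)%:R * (al k.+1 - rho)) ^+ 2)); last first.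
    by rewrite ler_wpM2l ?expR_ge0 // ler_pXn2r ?nnegrE ?expR_ge0 // ltW.
  rewrite expr2 -!expRD ler_expR.
  have mw2 : m%:R <= (size w)%:R :> R by rewrite ler_nat.
  have : m%:R * (e - 4 * rho) <= (size w)%:R * (e - 4 * rho) by rewrite ler_wpM2r // subr_ge0.
  have : 0 <= (size w)%:R * (2 * al k.+1 - al k - al k.+2 - e) by rewrite mulr_ge0 // subr_ge0.
  rewrite /= in ge *; lra.
have [f fP] := choice ex.
exists (1 + \sum_(k < d.+1) f k).
  by rewrite ltr_pwDl // sumr_ge0 // => k _; have [/ltW] := fP k.
move=> w m k cw mw' gk; have [_ /(_ w m cw mw' gk) [u [v H]]] := fP k.
exists u, v; apply: near_rank1_le H; rewrite ler_wpM2r ?expR_ge0 //.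
have kd : (k < d.+1)%N by case/and3P: gk => /andP[].
rewrite (bigD1 (Ordinal kd)) //= addrCA lerDl addr_ge0 // sumr_ge0 // => j _.
by have [/ltW] := fP j.
Qed.

End Blocks.

Section RegularBlock.
Variables (R : realType) (K : finType) (d : nat) (a : K -> 'M[R]_d) (L : R) (M : nat).
Hypothesis L0 : 0 <= L.

(** There is one piece more than the return length, because the state at the end of a block is read
    on the piece that follows it. *)
Definition npieces := (return_len d #|{: M.-bseq K}| d).+1.

Lemma exp_decay (C x : R) : 0 < x -> exists m0, forall m, (m0 <= m)%N ->
  C * expR (- (m%:R * x)) <= 1.
Proof.
move=> x0; exists (Num.truncn (C / x)).+1 => m mb.
rewrite expRN ler_pdivrMr ?expR_gt0 // mul1r.
apply: le_trans (expR_ge1Dx _); apply: (@le_trans _ _ (m%:R * x)); last by rewrite lerDr.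
by rewrite -ler_pdivrMr // (le_trans (ltW (truncnS_gt _))) // ler_nat.
Qed.

Lemma near_rank1_cmp0 (A : 'M[R]_d) t : 0 <= t ->
  near_rank1 (cmp (k := 0) A) (fun=> 1) (fun=> 1) t.
Proof.
move=> t0; split; try by move=> ?; rewrite normr1.
move=> f g; rewrite -/(cnorm 0 A) cnorm0 !mul1r /cmp det_mx00 fact0 divr1 subrr normr0.
exact: t0.
Qed.

(** [self_compatible] is applied to the pieces of x, the state of a piece being its first M letters.
    The rank 1 error e^(-m (eps - 4 rho)) has to beat k'^2, of order e^(-8 e rho m), with a spare
    e^(-rho m) for the constants; hence the factor 8 e + 6. *)
Lemma regular_block : exists (c : R) (e : nat), [/\ 0 < c, c <= 1 &
  forall al rho eps delta, 0 < rho -> (8 * e + 6)%:R * rho <= eps -> 0 < delta ->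
  rates d L al -> exists m0, forall m, (m0 <= m)%N -> forall x, size x = (npieces * m)%N ->
  let k' := c * expR (- (4 * e%:R * rho * m%:R)) in
  (forall b l, (0 < l)%N -> (b + l <= npieces)%N -> controlled a L al rho (seg m x b l)) ->
  exists b l, [/\ (0 < l)%N, (b + l < npieces)%N,
    take M (drop (b * m) x) = take M (drop ((b + l) * m) x) &
    forall k, gap d L al eps rho k -> exists u v,
      near_rank1 (cmp (k := k) (mw a (seg m x b l))) u v (delta * k' ^+ 2) /\
      k' <= `|dot v u|]].
Proof.
have [c [e [c0 [c1 Hsc]]]] := self_compatible R d {: M.-bseq K} d.
exists c, e; split=> // al rho eps delta rho0 heps delta0 hal.
have eps4 : 4 * rho <= eps.
  apply: le_trans heps; rewrite ler_wpM2r ?(ltW rho0) // ler_nat; lia.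
have [C C0 HC] := near_rank1_of_gap a L al (ltW rho0) eps4.
pose d' := Num.min c delta.
have d'0 : 0 < d' by rewrite lt_min c0.
have [m1 Hm1] := exp_decay (C / (d' * c ^+ 2)) rho0.
exists (maxn (maxn m1 M) 1) => m; rewrite !geq_max => /andP[/andP[m1m Mm] m0] x sx k' ctrl.

(* Two adjacent controlled pieces have norms at most e^(m (al + rho)), and their product at least
   e^(2 m (al - rho)); the quotient is e^(-4 rho m). *)
pose z := expR (- (4 * rho * m%:R)).
have zE : z ^+ e = expR (- (4 * e%:R * rho * m%:R)).
  by rewrite /z -expR_mul_nat; congr expR; ring.
have k'0 : 0 < k' by rewrite mulr_gt0 ?expR_gt0.
pose tau := C * expR (- (m%:R * (eps - 4 * rho))).
have tau0 : 0 <= tau by rewrite mulr_ge0 ?expR_ge0 ?(ltW C0).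
have taud : tau <= d' * k' ^+ 2.
  have dc0 : 0 < d' * c ^+ 2 by rewrite mulr_gt0 ?exprn_gt0.
  have -> : tau = d' * c ^+ 2 * (C / (d' * c ^+ 2) * expR (- (m%:R * rho))) *
      expR (- (m%:R * (eps - 5 * rho))).
    rewrite /tau (_ : - (m%:R * (eps - 4 * rho)) = - (m%:R * rho) - m%:R * (eps - 5 * rho)); last by ring.
    by rewrite expRD; field; rewrite !gt_eqF.
  rewrite /k' exprMn [leRHS]mulrA; apply: ler_pM.
  - exact: (mulr_ge0 (ltW dc0) (mulr_ge0 (divr_ge0 (ltW C0) (ltW dc0)) (expR_ge0 _))).
  - exact: expR_ge0.
  - by rewrite -[leRHS]mulr1 ler_wpM2l ?(ltW dc0) // Hm1.
  rewrite -expR_mul_nat ler_expR.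
  have := ler_wpM2l (ler0n R m) heps; have := mulr_ge0 (ler0n R m) (ltW rho0).
  rewrite natrD natrM; lra.
have sz_take (s : seq K) : (size (take M s) <= M)%N by rewrite size_take_min geq_minl.
pose st i : M.-bseq K := Bseq (sz_take (drop (i * m) x)).
(* Orders without a gap are replaced by 0, whose compound is the constant 1 and satisfies all
   requirements. The length of the list is then always d, so the constants do not depend on which
   orders are gaps. *)
pose Gam := [seq (if gap d L al eps rho k then k else 0)%N | k <- iota 1 d].
have sG : size Gam = d by rewrite size_map size_iota.
have inG k : k \in Gam -> k = 0%N \/ gap d L al eps rho k.
  by case/mapP => j _ ->; case: ifP => ?; [right | left].
have gapd k : gap d L al eps rho k -> (0 < k <= d)%N by case/and3P.
have Gd k : k \in Gam -> (k <= d)%N by case/inG => [->//|/gapd/andP[]].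
pose B i := mw a (seg m x i 1).
pose n := return_len d #|{: M.-bseq K}| d.
have PE b l : (b + l <= n.+1)%N -> mprod (fun i => B (b + i)%N) l = mw a (seg m x b l).
  by move=> bl; rewrite -mw_seg // sx leq_mul2r bl orbT.
have ssz b l : (b + l <= n.+1)%N -> size (seg m x b l) = (l * m)%N.
  by move=> bl; rewrite size_seg // sx leq_mul2r bl orbT.
have z0 : 0 < z := expR_gt0 _.
have z1 : z <= 1 by rewrite -[leRHS]expR0 ler_expR oppr_le0 !mulr_ge0 ?(ltW rho0).
pose t := d' * k' ^+ 2.
have t0 : 0 <= t by rewrite mulr_ge0 ?exprn_ge0 ?ltW.
have tc : t <= c * (c * z ^+ e) ^+ 2.
  by rewrite zE ler_wpM2r ?exprn_ge0 ?(ltW k'0) // ge_min lexx.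
have [] := Hsc z t Gam B st z0 z1 t0 tc sG Gd.
- move=> k /inG[->|gk] b l l0 bl; rewrite (PE _ _ bl).
    rewrite cnorm0; split=> //; exists (fun=> 1), (fun=> 1); exact: near_rank1_cmp0.
  have cb := ctrl b l l0 bl; have sb := ssz b l bl.
  have msz : (0 < m <= size (seg m x b l))%N by rewrite m0 sb leq_pmull.
  split.
    by rewrite (controlled_gap cb gk) ?tnorm_gt0 // (leq_trans m0) //; case/andP: msz.
  have [u [v H]] := HC _ _ _ cb msz gk; exists u, v.
  exact: near_rank1_le H.
- move=> k /inG[->|gk] i ilt; first by rewrite !cnorm0 !mulr1.
  have i2 : (i + 2 <= n.+1)%N by rewrite addn2 ltnS.
  have E2 : B i.+1 *m B i = mw a (seg m x i 2).
    by rewrite -(PE i 2%N i2) /= mulmx1 addn1 addn0.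
  have i1 : (i + 1 <= n.+1)%N by rewrite addn1 ltnW.
  have i11 : (i.+1 + 1 <= n.+1)%N by rewrite addn1 ltnS.
  have c2 := ctrl i 2%N isT i2.
  have sz2 := ssz i 2%N i2; have sz1 := ssz i 1%N i1; have sz11 := ssz i.+1 1%N i11.
  have kd : (k <= d.+1)%N by have /andP[_ /leqW] := gapd k gk.
  rewrite E2 (controlled_gap c2 gk) ?sz2 ?muln_gt0 ?m0 //.
  have /andP[lo _] := c2 k kd.
  have /andP[_ h1] := ctrl i 1%N isT i1 k kd.
  have /andP[_ h2] := ctrl i.+1 1%N isT i11 k kd.
  rewrite sz2 in lo; rewrite sz1 in h1; rewrite sz11 in h2.
  apply: le_trans lo.
  apply: (@le_trans _ _ (z * (expR ((1 * m)%:R * (al k + rho)) * expR ((1 * m)%:R * (al k + rho))))).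
    rewrite ler_wpM2l ?(ltW z0) // ler_pM ?cnorm_ge0 //.
      exact: le_trans (cnorm_le_tnorm _ _ _ _) h2.
    exact: le_trans (cnorm_le_tnorm _ _ _ _) h1.
  rewrite /z -!expRD ler_expR !natrM; lra.
move=> b [l [l0 bl stE Hk]]; exists b, l; split=> //.
  by have /(congr1 val) := stE.
move=> k gk; have kG : k \in Gam.
  have /andP[k0 kd] := gapd k gk.
  by apply/mapP; exists k; rewrite ?mem_iota ?k0 ?add1n ?ltnS ?kd // gk.
have [u [v [Hn Hd]]] := Hk k kG; exists u, v.
rewrite zE in Hd; rewrite PE in Hn; last exact: leqW.
split=> //; apply: near_rank1_le Hn; rewrite /t ler_wpM2r ?exprn_ge0 ?(ltW k'0) //.
by rewrite ge_min lexx orbT.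
Qed.
End RegularBlock.

(** * The horseshoe *)

Section Cells.
Variables (R : realType) (d : nat).
Implicit Types (A B : 'M[R]_d).

Definition cell_index : finType :=
  {k : 'I_d.+1 & ({ffun 'I_k -> 'I_d} * {ffun 'I_k -> 'I_d})%type}.

Definition unit_cmp k A (f g : {ffun 'I_k -> 'I_d}) : R := cmp A f g / cnorm k A.

Lemma unit_cmp_le1 k A f g : `|unit_cmp (k := k) A f g| <= 1.
Proof.
rewrite normrM normfV (ger0_norm (cnorm_ge0 _ _)).
have := cnorm_ge0 k A; rewrite le_eqVlt => /predU1P[<-|N0]; first by rewrite invr0 mulr0.
by rewrite ler_pdivrMr // mul1r le_nrm.
Qed.

(** The normalized compounds of all orders at most d are sorted into boxes of mesh h. Entries lie in
    [-1, 1], so N > 2 / h makes [inord] faithful. *)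
Definition cell (N : nat) (h : R) A : {ffun cell_index -> 'I_N.+1} :=
  [ffun i : cell_index => inord (Num.truncn ((unit_cmp A (tagged i).1 (tagged i).2 + 1) / h))].

Lemma cell_eq N h A B k (f g : {ffun 'I_k -> 'I_d}) : 0 < h -> 2 / h < N%:R -> (k <= d)%N ->
  cell N h A = cell N h B -> `|unit_cmp A f g - unit_cmp B f g| <= h.
Proof.
move=> h0 hN kd /ffunP E.
have bnd C (f' g' : {ffun 'I_k -> 'I_d}) : 0 <= (unit_cmp C f' g' + 1) / h < N%:R.
  have := unit_cmp_le1 C f' g'; rewrite ler_norml => /andP[h1 h2].
  rewrite divr_ge0 ?(ltW h0) -?lerBlDr ?sub0r //=; apply: le_lt_trans hN.
  by rewrite ler_pM2r ?invr_gt0 //; lra.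
have kd' : (k < d.+1)%N by [].
have := E (@Tagged _ (Ordinal kd') (fun k => ({ffun 'I_k -> 'I_d} * {ffun 'I_k -> 'I_d})%type) (f, g)).
have trN (x : R) : 0 <= x < N%:R -> (Num.truncn x < N.+1)%N.
  move=> /andP[x0 xN]; rewrite ltnS; apply: ltnW; rewrite -(ltr_nat R).
  by apply: le_lt_trans xN; have /andP[] := truncn_itv x0.
rewrite !ffunE /= => /(congr1 val); rewrite /= !inordK ?trN ?bnd // => E'.
have /andP[/truncn_itv/andP[a1 a2] _] := bnd A f g.
have /andP[/truncn_itv/andP[b1 b2] _] := bnd B f g.
move: a1 a2 b1 b2; rewrite -E' -natr1; set x := _ / h; set y := _ / h; set j := _%:R.
move=> a1 a2 b1 b2.
have -> : unit_cmp A f g - unit_cmp B f g = h * (x - y).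
  by rewrite /x /y; field; rewrite gt_eqF.
rewrite normrM gtr0_norm // ler_piMr ?(ltW h0) // ler_norml; lra.
Qed.

Lemma near_rank1_unit k A u v t : 0 < cnorm k A -> sub1 u -> sub1 v ->
  near_rank1 (cmp (k := k) A) u v t <->
  forall f g, `|unit_cmp A f g - u f * v g| <= t.
Proof.
move=> N0 su sv.
have E f g : cmp A f g - cnorm k A * (u f * v g) = cnorm k A * (unit_cmp A f g - u f * v g).
  by rewrite /unit_cmp; field; rewrite gt_eqF.
split=> [[_ _ H] f g|H].
  by have := H f g; rewrite -/(cnorm k A) E normrM gtr0_norm // ler_pM2l.
by split=> // f g; rewrite -/(cnorm k A) E normrM gtr0_norm // ler_pM2l.
Qed.

(** Words in one cell can share the rank 1 approximation of any one of them, at the price h. *)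
Lemma near_rank1_same_cell N h A B k u v t : 0 < h -> 2 / h < N%:R -> (k <= d)%N ->
  0 < cnorm k A -> 0 < cnorm k B -> cell N h A = cell N h B ->
  near_rank1 (cmp (k := k) A) u v t -> near_rank1 (cmp (k := k) B) u v (h + t).
Proof.
move=> h0 hN kd NA NB E /[dup] [[su sv _]] /(near_rank1_unit _ NA su sv) H.
apply/(near_rank1_unit _ NB su sv) => f g.
rewrite (_ : _ - _ = (unit_cmp B f g - unit_cmp A f g) + (unit_cmp A f g - u f * v g)); last by ring.
rewrite (le_trans (ler_normD _ _)) // lerD //.
by rewrite distrC (cell_eq _ _ h0 hN).
Qed.

End Cells.

Section Horseshoe.
Variables (R : realType) (K : finType) (d : nat) (a : K -> 'M[R]_d) (M : nat).
Variables (X : set (full_shift K)).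
Hypothesis Xshift : forall x, X x -> X (Defs.shift x).
Variable L : R.
Hypothesis L0 : 0 <= L.
Variable G : seq K -> R.
Hypotheses (G0 : forall w, 0 <= G w) (Gs : submul G).
Hypothesis Gallowed : forall w, G w != 0 -> classical_sets.nonempty (cyl X w).

Lemma cyl_drop_take w i j : classical_sets.nonempty (cyl X w) ->
  classical_sets.nonempty (cyl X (take j (drop i w))).
Proof.
case=> y; rewrite -{1}(cat_take_drop i w) => /(cyl_cat Xshift)[_].
rewrite -{1}(cat_take_drop j (drop i w)) => /(cyl_cat Xshift)[H _].
by exists (iter (size (take i w)) (@Defs.shift K) y).
Qed.

Local Notation n := (npieces K d M).
Local Notation B := (M.-bseq K).

(** Each regular word of n pieces contains a block given by [regular_block]. Its label consists of
    its position, its length, its first M letters and the cell of its matrix. There are only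
    e^(O(rho m)) labels, so one of them carries the weight up to this factor. The pieces outside the
    block are removed by the upper bound on the sums, and the tilt on the block is undone since its
    norms are known up to e^(rho n1). Blocks ending where [alpha] may follow and starting with
    [alpha] can be concatenated freely. *)
Lemma horseshoe : exists (c : R) (e E : nat), [/\ 0 < c, c <= 1 &
  forall (t al : nat -> R) (p eta C rho eps delta : R),
  (forall k, 0 <= t k) ->
  0 < rho -> (8 * e + 6)%:R * rho <= eps -> 0 < delta -> delta <= 1 ->
  0 <= eta -> n%:R * eta <= rho -> 0 < C -> rates d L al ->
  let q := tq d G (fun k => tlog a L k.+1) t in
  (forall i, wsum i q <= C * expR (i%:R * (p + eta))) ->
  (exists m0, forall m, (m0 <= m)%N -> (0 < n * m)%N -> expR ((n * m)%:R * p) / 2 <=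
    wsum (n * m) (fun x => (regular d (fun k => tlog a L k.+1) n (fun k => al k.+1) rho m x)%:R * q x)) ->
  exists m0, forall m, (m0 <= m)%N -> exists n1 (alpha : seq K) (F : pred (seq K))
    (u v : forall k, {ffun 'I_k -> 'I_d} -> R) (kap : R),
  [/\ (m <= n1)%N, 0 < kap <= 1, c * expR (- (4 * e%:R * rho * n1%:R)) <= kap,
    forall w, size w = n1 -> F w -> [/\ take M w = alpha,
      classical_sets.nonempty (cyl X (w ++ alpha)), controlled a L al rho w &
      forall k, gap d L al eps rho k ->
        near_rank1 (cmp (k := k) (mw a w)) (u k) (v k) (2 * delta * kap ^+ 2) /\
        kap <= `|dot (v k) (u k)|] &
    expR (n1%:R * (p - \sum_(k < d) t k * al k.+1 - (E%:R + \sum_(k < d) t k) * rho))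
    <= wsum n1 (fun w => (F w)%:R * G w)]].
Proof.
have [c [e [c0 c1 Hblock]]] := regular_block a M L0.
pose cs := #|cell_index d|.
(* The number of labels accounts for 8 e cs; one more rho absorbs the constants and another one the
   excess eta on the removed pieces. *)
exists c, e, (2 + 8 * e * cs)%N; split=> // t al p eta C rho eps delta t0 rho0 heps delta0 delta1
  eta0 etarho C0 hal q Hhi [m1 Hreg].
have [m2 Hm2] := Hblock al rho eps delta rho0 heps delta0 hal.
have q0 w : 0 <= q w by exact: tq_ge0.
have qs : submul q by apply: tq_submul => // k u v; exact: tlog_sub.
pose nT := (n * (n.+1 * #|{: B}|))%N.
(* The number of labels is at most T0 e^{8 e cs rho m}. *)
pose T0 : R := nT%:R * (4 / (delta * c ^+ 2)) ^+ cs.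
have n0 : (0 < n)%N by [].
have [m3 Hm3] := exp_decay (2 * C ^+ 2 * T0) rho0.
exists (maxn (maxn m1 m2) (maxn m3 (maxn M 1))) => m.
rewrite !geq_max => /andP[/andP[m1m m2m] /and3P[m3m Mm m0]].
have {}Hreg := Hreg m m1m; have {}Hm2 := Hm2 m m2m; have {}Hm3 := Hm3 m m3m.
pose kap := c * expR (- (4 * e%:R * rho * m%:R)).
have kap0 : 0 < kap by rewrite mulr_gt0 ?expR_gt0.
have kap1 : kap <= 1.
  rewrite -[leRHS]mulr1 ler_pM ?(ltW c0) ?expR_ge0 //.
  by rewrite -[leRHS]expR0 ler_expR oppr_le0 !mulr_ge0 ?(ltW rho0).
pose h := delta * kap ^+ 2.
have h0 : 0 < h by rewrite mulr_gt0 ?exprn_gt0.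
have h1 : h <= 1 by rewrite -[leRHS]mulr1 ler_pM ?(ltW delta0) ?exprn_ge0 ?exprn_ile1 ?(ltW kap0).
pose N := (Num.truncn (2 / h)).+1.
have hN : 2 / h < N%:R by exact: truncnS_gt.
have sz_take (s : seq K) : (size (take M s) <= M)%N by rewrite size_take_min geq_minl.
pose lab := ('I_n * ('I_n.+1 * B) * {ffun cell_index d -> 'I_N.+1})%type.
pose core (alpha : seq K) (W : seq K) := [/\ take M W = alpha,
   classical_sets.nonempty (cyl X (W ++ alpha)), controlled a L al rho W &
   forall k, gap d L al eps rho k -> exists u v,
      near_rank1 (cmp (k := k) (mw a W)) u v h /\ kap <= `|dot v u|].
pose good (x : lab) (W : seq K) : bool :=
  `[< core x.1.2.2 W >] && (cell N h (mw a W) == x.2).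
pose valid (x : lab) := (0 < x.1.2.1)%N && (x.1.1 + x.1.2.1 <= n)%N.
have cover x : size x = (n * m)%N ->
    (regular d (fun k => tlog a L k.+1) n (fun k => al k.+1) rho m x)%:R * q x <=
    \sum_(y : lab | valid y) (good y (seg m x y.1.1 y.1.2.1))%:R * q x.
  move=> sx; case: (boolP (regular _ _ _ _ _ _ _)) => [reg|_]; last first.
    by rewrite mul0r sumr_ge0 // => y _; rewrite mulr_ge0.
  have [->|qx] := eqVneq (q x) 0; first by rewrite mulr0 sumr_ge0 // => y _; rewrite mulr0.
  have ctrl b l : (0 < l)%N -> (b + l <= n)%N -> controlled a L al rho (seg m x b l).
    by apply: (regular_controlled L0 hal _ (ltW rho0) reg sx).
  have [b [l [l0 bl alE Hk]]] := Hm2 x sx ctrl.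
  have bn : (b < n)%N by rewrite (leq_trans _ bl) // ltnS leq_addr.
  have ln : (l < n.+1)%N by rewrite (leq_trans _ (leqW bl)) // ltnS leq_addl.
  pose alpha : B := Bseq (sz_take (drop (b * m) x)).
  pose y : lab := (Ordinal bn, (Ordinal ln, alpha), cell N h (mw a (seg m x b l))).
  rewrite mul1r (bigD1 y) /=; last by rewrite /valid /= l0 ltnW.
  have -> : good y (seg m x b l).
    rewrite /good /= eqxx andbT; apply/asboolP; split.
    - by rewrite /seg take_takel // (leq_trans Mm) // leq_pmull.
    - have Gx : G x != 0 by apply: contraNneq qx => G0x; rewrite /q /tq G0x mul0r.
      rewrite (_ : _ ++ _ = take (l * m + M) (drop (b * m) x)).
        by apply: cyl_drop_take; exact: Gallowed.
      by rewrite takeD drop_drop -mulnDl [(l + b)%N]addnC -alE.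
    - by apply: ctrl => //; exact: ltnW.
    - by move=> k gk; have [u [v H]] := Hk k gk; exists u, v.
  by rewrite mul1r lerDl sumr_ge0 // => y' _; rewrite mulr_ge0.
have nm0 : (0 < n * m)%N by rewrite muln_gt0 n0.
have := le_trans (Hreg nm0) (le_wsum (fun x sx => cover x sx)).
rewrite wsum_sum => tot.
have cardlab : #|{: lab}|%:R <= T0 * expR (8 * e%:R * cs%:R * rho * m%:R).
  rewrite !card_prod card_ffun !card_ord /T0 -/nT natrM -[leRHS]mulrA ler_wpM2l ?ler0n //.
  rewrite natrX -/cs.
  rewrite (_ : 8 * e%:R * cs%:R * rho * m%:R = cs%:R * (8 * e%:R * rho * m%:R)); last by ring.
  have dc0 : 0 < delta * c ^+ 2 by rewrite mulr_gt0 ?exprn_gt0.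
  have base0 : 0 <= 4 / (delta * c ^+ 2) * expR (8 * e%:R * rho * m%:R).
    exact: mulr_ge0 (divr_ge0 (ler0n R 4) (ltW dc0)) (expR_ge0 _).
  rewrite expR_mul_nat -exprMn; apply: lerXn2r; rewrite ?nnegrE //.
  have -> : 4 / (delta * c ^+ 2) * expR (8 * e%:R * rho * m%:R) = 4 / h.
    rewrite /h /kap exprMn -expR_mul_nat (_ : 2%:R * _ = - (8 * e%:R * rho * m%:R)); last by ring.
    by rewrite expRN; field; rewrite !gt_eqF ?expR_gt0.
  have N2 : N%:R <= 2 / h + 1.
    rewrite /N -natr1 lerD2r; have /truncn_itv/andP[] // : 0 <= 2 / h by rewrite divr_ge0 ?(ltW h0).
  have : 2 <= 2 / h by rewrite ler_pdivlMr // ler_piMr.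
  rewrite -natr1; have -> : 4 / h = 2 * (2 / h) by ring.
  lra.
have T0pos : 0 < T0.
  rewrite /T0 mulr_gt0 ?exprn_gt0 ?divr_gt0 ?mulr_gt0 ?exprn_gt0 // ltr0n /nT !muln_gt0 n0 /=.
  by apply/card_gt0P; exists (Bseq (isT : (size (nil : seq K) <= M)%N)).
(* Pigeonhole: some label carries at least the average weight. *)
have [y [vy Hy]] : exists y : lab, valid y /\
    expR ((n * m)%:R * p) / 2 / (T0 * expR (8 * e%:R * cs%:R * rho * m%:R)) <=
    wsum (n * m) (fun x => (good y (seg m x y.1.1 y.1.2.1))%:R * q x).
  apply: contrapT => /forallNP H.
  have Z0 : 0 < T0 * expR (8 * e%:R * cs%:R * rho * m%:R) by rewrite mulr_gt0 ?expR_gt0.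
  set A := _ / 2 in tot H; set Z := T0 * _ in Z0 H cardlab.
  have A0 : 0 < A by rewrite divr_gt0 ?expR_gt0.
  suff : \sum_(y : lab | valid y) wsum (n * m)
      (fun w => (good y (seg m w y.1.1 y.1.2.1))%:R * q w) < A by rewrite ltNge tot.
  have [y0 vy0|novalid] := pickP valid; last first.
    by rewrite big_pred0.
  apply: (@lt_le_trans _ _ (\sum_(y : lab | valid y) A / Z)).
    apply: ltr_sum; first by apply/hasP; exists y0; rewrite ?mem_index_enum.
    by move=> y vy; rewrite ltNge; apply/negP => le; apply: (H y).
  rewrite sumr_const -[leLHS]mulr_natl mulrA ler_pdivrMr // mulrC ler_wpM2l ?(ltW A0) //.
  by apply: le_trans cardlab; rewrite ler_nat max_card.
move: y vy Hy => [[b [l alpha]] ce]; rewrite /valid /= => /andP[l0 bl] Hy.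
set y : lab := (b, (l, alpha), ce) in Hy.
have lm0 : (0 < l * m)%N by rewrite muln_gt0 l0.
have goodP W : good y W -> core alpha W /\ cell N h (mw a W) = ce.
  by rewrite /good /= => /andP[/asboolP H /eqP].
(* The vectors of one word with this label serve for all of them: its own error h and the mesh h add
   up to 2 delta kap^2. *)
have uvP k : exists uv : ({ffun 'I_k -> 'I_d} -> R) * ({ffun 'I_k -> 'I_d} -> R),
    forall W, size W = (l * m)%N -> good y W -> gap d L al eps rho k ->
    near_rank1 (cmp (k := k) (mw a W)) uv.1 uv.2 (2 * delta * kap ^+ 2) /\
    kap <= `|dot uv.2 uv.1|.
  have [[W0 [sW0 gW0 gk]]|none] :=
    pselect (exists W0, [/\ size W0 = (l * m)%N, good y W0 & gap d L al eps rho k]).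
    have [[_ _ c0W H0] cell0] := goodP _ gW0.
    have [u [v [nW0 dW0]]] := H0 k gk; exists (u, v) => W sW gW _; split=> //=.
    have [[_ _ cW _] cellW] := goodP _ gW.
    have kd : (k <= d)%N by case/and3P: gk => /andP[].
    rewrite (_ : 2 * delta * kap ^+ 2 = h + h); last by rewrite /h; ring.
    apply: (near_rank1_same_cell h0 hN kd _ _ _ nW0); last by rewrite cell0 cellW.
      by rewrite (controlled_gap c0W gk) ?tnorm_gt0 // sW0.
    by rewrite (controlled_gap cW gk) ?tnorm_gt0 // sW.
  by exists (fun=> 0, fun=> 0) => W sW gW gk; exfalso; apply: none; exists W.
exists (l * m)%N, alpha, (good y), (fun k => (projT1 (cid (uvP k))).1),
  (fun k => (projT1 (cid (uvP k))).2), kap; split.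
- by rewrite leq_pmull.
- by rewrite kap0.
- rewrite /kap ler_wpM2l ?(ltW c0) // ler_expR lerN2 ler_wpM2l ?mulr_ge0 ?(ltW rho0) //.
  by rewrite ler_nat leq_pmull.
- move=> W sW gW; have [[H1 H2 H3 _] _] := goodP _ gW; split=> // k gk.
  exact: (projT2 (cid (uvP k)) W sW gW gk).
pose r := (n - (b + l))%N.
have nE : (n * m = b * m + (l * m + r * m))%N by rewrite -!mulnDl addnA subnKC.
pose f w : R := (good y w)%:R.
have f0 w : 0 <= f w by exact: ler0n.
have := wsum_middle (b * m) (l * m) (r * m) q0 qs f0; rewrite -nE => /(le_trans Hy) {}Hy.
pose St := \sum_(k < d) t k; pose Sa := \sum_(k < d) t k * al k.+1.
have qG : wsum (l * m) (fun w => f w * q w) <=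
    wsum (l * m) (fun w => f w * G w) * expR ((l * m)%:R * (Sa + St * rho)).
  rewrite -wsumZr; apply: le_wsum => w sw; rewrite -mulrA /f.
  case: (boolP (good y w)) => [/goodP[[_ _ cw _] _]|_]; last by rewrite !mul0r.
  rewrite !mul1r /q /tq ler_wpM2l // ler_expR mulrDr /Sa /St mulr_suml !mulr_sumr -big_split /=.
  apply: ler_sum => k _; have /andP[_] := cw k.+1 (leqW (ltn_ord k)).
  rewrite -expR_tlog ler_expR sw => /(ler_wpM2l (t0 k)).
  lra.
have Zb : wsum (b * m) q * wsum (r * m) q <= C ^+ 2 * expR ((b%:R + r%:R) * m%:R * (p + eta)).
  apply: (@le_trans _ _ ((C * expR ((b * m)%:R * (p + eta))) * (C * expR ((r * m)%:R * (p + eta))))).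
    by rewrite ler_pM ?wsum_ge0.
  rewrite mulrACA -expRD -expr2 !natrM ler_wpM2l ?exprn_ge0 ?(ltW C0) // ler_expR; lra.
set SG := wsum _ (fun w => _ * G w) in qG *.
have SG0 : 0 <= SG by apply: wsum_ge0 => w; rewrite mulr_ge0.
have main : expR ((n * m)%:R * p) / 2 / (T0 * expR (8 * e%:R * cs%:R * rho * m%:R)) <=
    C ^+ 2 * expR ((b%:R + r%:R) * m%:R * (p + eta)) * (SG * expR ((l * m)%:R * (Sa + St * rho))).
  apply: (le_trans Hy); rewrite mulrAC ler_pM ?mulr_ge0 ?wsum_ge0 // => w.
  by rewrite mulr_ge0.
move: main; rewrite ler_pdivrMr ?(mulr_gt0 T0pos (expR_gt0 _)) // ler_pdivrMr // => main.
pose Y := expR ((b%:R + r%:R) * m%:R * (p + eta) + (l * m)%:R * (Sa + St * rho) + 8 * e%:R * cs%:R * rho * m%:R).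
have {}main : expR ((n * m)%:R * p) <= (2 * C ^+ 2 * T0) * (SG * Y).
  apply: (le_trans main); rewrite /Y !expRD le_eqVlt; apply/orP; left; apply/eqP; ring.
have Y0 : 0 < Y := expR_gt0 _.
have const : 2 * C ^+ 2 * T0 <= expR (m%:R * rho).
  by move: Hm3; rewrite expRN ler_pdivrMr ?expR_gt0 // mul1r.
have {}main : expR ((n * m)%:R * p) <= expR (m%:R * rho) * (SG * Y).
  by apply: (le_trans main); rewrite ler_wpM2r // mulr_ge0 // ltW.
rewrite -(ler_pM2r Y0) -(ler_pM2l (expR_gt0 (m%:R * rho))); apply: le_trans main.
rewrite /Y -!expRD ler_expR.
have nR : n%:R = b%:R + l%:R + r%:R :> R by rewrite -!natrD subnKC.
rewrite natrD !natrM nR -/St -/Sa.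
have l1 : 1 <= l%:R :> R by rewrite ler1n.
have mr : 0 <= m%:R * rho by rewrite mulr_ge0 // ltW.
have x1 : (b%:R + r%:R) * (m%:R * eta) <= m%:R * rho.
  apply: (@le_trans _ _ (m%:R * (n%:R * eta))); last by rewrite ler_wpM2l.
  rewrite mulrCA ler_wpM2l // ler_wpM2r // nR; lra.
have x2 : m%:R * rho <= l%:R * (m%:R * rho) by rewrite ler_peMl.
have x3 : 8 * e%:R * cs%:R * (m%:R * rho) <= 8 * e%:R * cs%:R * (l%:R * (m%:R * rho)).
  by rewrite ler_wpM2l ?mulr_ge0.
lra.
Qed.
End Horseshoe.

(** * Concatenation inside a subshift of finite type *)

Section Gluing.
Variables (K : finType) (X : set (full_shift K)).
Hypothesis hX : subshift_of_finite_type X.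

Definition glue (n : nat) (x0 : K) (W : nat -> seq K) : full_shift K :=
  fun j : nat => nth x0 (W (j %/ n)%N) (j %% n).

Definition gluing_length (M : nat) : Prop := forall n x0 (W : nat -> seq K) alpha,
  (0 < n)%N -> (M <= n)%N ->
  (forall i, [/\ size (W i) = n, take M (W i) = alpha & cyl X (W i ++ alpha) !=set0]) ->
  X (glue n x0 W).

(* A window that is no longer than the overlap alpha lies in some w ++ alpha. *)
Lemma sft_glue : exists M : nat, gluing_length M.
Proof.
have [F XE] := hX; exists (\max_(w <- F) size w)%N.
set M := (\max_(w <- F) size w)%N => n x0 W alpha n0 Mn HW.
rewrite XE => w wF k occ.
have wM : (size w <= M)%N by rewrite /M (big_rem w) //= leq_maxl.
have [sW aW [x [Xx xE]]] := HW (k %/ n)%N.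
have [sW' aW' _] := HW (k %/ n).+1.
have sa : size alpha = M by rewrite -aW' size_takel // sW'.
have ex j : (j < size w)%N -> x (k %% n + j)%N = glue n x0 W (k + j)%N.
  move=> jw; have jM : (j < M)%N := leq_trans jw wM.
  have koff : (k %% n < n)%N by rewrite ltn_mod.
  have bnd : (k %% n + j < size (W (k %/ n)%N ++ alpha))%N.
    by rewrite size_cat sW sa; apply: leq_trans (leq_add koff (ltnW jM)); rewrite addSn.
  have -> : x (k %% n + j)%N = nth x0 (W (k %/ n)%N ++ alpha) (k %% n + j).
    by rewrite -xE nth_mkseq.
  rewrite nth_cat sW /glue.
  have kE : (k + j = (k %/ n) * n + (k %% n + j))%N by rewrite addnA -divn_eq.
  case: ltnP => [lt|ge].
    by rewrite kE divnMDl // modnMDl (divn_small lt) addn0 (modn_small lt).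
  have jn : (j < n)%N := leq_trans jM Mn.
  have rem : (k %% n + j - n < n)%N by move: koff jn ge; move: (k %% n)%N => i; lia.
  have kE' : (k + j = (k %/ n).+1 * n + (k %% n + j - n))%N.
    by rewrite kE mulSn [(n + _)%N]addnC -addnA subnKC.
  rewrite kE' divnMDl // modnMDl (divn_small rem) addn0 (modn_small rem).
  rewrite -{1}aW' nth_take //.
  by move: koff jM ge; move: (k %% n)%N => i; lia.
move: Xx; rewrite XE => /(_ w wF (k %% n)%N); apply => i.
by rewrite ex // occ.
Qed.

End Gluing.

Section Chunks.
Variables (R : realType) (K : finType).
Implicit Types (f : seq K -> R).

Lemma wsum_chunks n f r : wsum (r * n) (fun w => \prod_(i < r) f (seg n w i 1)) = wsum n f ^+ r.
Proof.
elim: r => [|r IH]; first by rewrite wsum0 big_ord0.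
rewrite mulSn wsum_add exprS -wsumZr; apply: eq_wsum => u su.
rewrite -IH -wsumZ; apply: eq_wsum => v sv.
rewrite big_ord_recl /seg mul0n drop0 mul1n take_size_cat //; congr (_ * _).
apply: eq_bigr => i _; congr f.
by rewrite lift0 mulSn addnC -drop_drop drop_size_cat.
Qed.

End Chunks.

(** * Perturbation of the cocycle *)

Section Perturbation.
Variables (R : realType) (d : nat).
Implicit Types (A B : 'M[R]_d) (F : 'M[R]_d -> R).

Definition close (e : R) A B := forall i j, `|A i j - B i j| <= e.

Lemma close_le e e' A B : e <= e' -> close e A B -> close e' A B.
Proof. by move=> ee' H i j; apply: le_trans ee'. Qed.

Definition cont_at A F := forall e, 0 < e -> exists2 h : R, 0 < h &
  forall B, close h A B -> `|F A - F B| <= e.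

Lemma uniform_radius (I : finType) (P : I -> R -> Prop) :
  (forall i, exists2 h, 0 < h & P i h) ->
  (forall i h h', 0 < h' -> h' <= h -> P i h -> P i h') ->
  exists2 h, 0 < h & forall i, P i h.
Proof.
move=> ex mono; have [f fP] := choice (fun i => let: ex_intro2 h h0 H := ex i in
  ex_intro (fun h => 0 < h /\ P i h) h (conj h0 H)).
exists (\big[Num.min/1]_i f i).
  by apply: (big_ind (fun x : R => 0 < x)) => // [x y x0 y0|i _]; [rewrite lt_min x0 | have [] := fP i].
move=> i; have [fi Pi] := fP i; apply: mono Pi.
  by apply: (big_ind (fun x : R => 0 < x)) => // [x y x0 y0|j _]; [rewrite lt_min x0 | have [] := fP j].
by rewrite (bigD1 i) //= ge_min lexx.
Qed.

Lemma cont_at_cst A c : cont_at A (fun=> c).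
Proof. by move=> e e0; exists 1 => // B _; rewrite subrr normr0 ltW. Qed.

Lemma cont_at_entry A i j : cont_at A (fun B => B i j).
Proof. by move=> e e0; exists e => // B /(_ i j). Qed.

Lemma cont_atD A F G : cont_at A F -> cont_at A G -> cont_at A (fun B => F B + G B).
Proof.
move=> hF hG e e0; have e20 : 0 < e / 2 by rewrite divr_gt0.
have [h h0 H] := hF _ e20; have [h' h'0 H'] := hG _ e20.
exists (Num.min h h') => [|B AB]; first by rewrite lt_min h0.
rewrite opprD addrACA (le_trans (ler_normD _ _)) // (splitr e) lerD //.
  by apply: H; apply: close_le AB; rewrite ge_min lexx.
by apply: H'; apply: close_le AB; rewrite ge_min lexx orbT.
Qed.

Lemma cont_atM A F G : cont_at A F -> cont_at A G -> cont_at A (fun B => F B * G B).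
Proof.
move=> hF hG e e0; pose N := `|F A| + `|G A| + 1.
have N0 : 0 < N by rewrite ltr_wpDl // addr_ge0.
pose e1 := Num.min 1 (e / (2 * N)).
have e10 : 0 < e1 by rewrite lt_min ltr01 divr_gt0 // mulr_gt0.
have [h h0 H] := hF _ e10; have [h' h'0 H'] := hG _ e10.
exists (Num.min h h') => [|B AB]; first by rewrite lt_min h0.
have {}H : `|F A - F B| <= e1 by apply: H; apply: close_le AB; rewrite ge_min lexx.
have {}H' : `|G A - G B| <= e1 by apply: H'; apply: close_le AB; rewrite ge_min lexx orbT.
have e11 : e1 <= 1 by rewrite ge_min lexx.
have GB : `|G B| <= N.
  have -> : G B = G A - (G A - G B) by ring.
  rewrite (le_trans (ler_normB _ _)) // /N; have := normr_ge0 (F A); lra.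
have -> : F A * G A - F B * G B = F A * (G A - G B) + (F A - F B) * G B by ring.
rewrite (le_trans (ler_normD _ _)) // !normrM.
apply: (@le_trans _ _ (N * e1 + e1 * N)).
  rewrite lerD // ler_pM // /N; have := normr_ge0 (G A); lra.
have e1e : e1 * (2 * N) <= e by rewrite -ler_pdivlMr ?mulr_gt0 // ge_min lexx orbT.
lra.
Qed.

Lemma cont_at_norm A F : cont_at A F -> cont_at A (fun B => `|F B|).
Proof.
move=> hF e e0; have [h h0 H] := hF e e0; exists h => // B /H.
exact: le_trans (ler_dist_dist _ _).
Qed.

Lemma cont_at_sum (I : Type) (r : seq I) (P : pred I) A (F : I -> 'M[R]_d -> R) :
  (forall i, cont_at A (F i)) -> cont_at A (fun B => \sum_(i <- r | P i) F i B).
Proof.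
move=> hF; elim: r => [|i r IH].
  have -> : (fun B => \sum_(i <- [::] | P i) F i B) = fun=> 0 by apply/funext => B; rewrite big_nil.
  exact: cont_at_cst.
have -> : (fun B => \sum_(j <- i :: r | P j) F j B) =
  (fun B => (if P i then F i B else 0) + \sum_(j <- r | P j) F j B).
  by apply/funext => B; rewrite big_cons; case: ifP => // _; rewrite add0r.
by apply: cont_atD => //; case: (P i) => //; exact: cont_at_cst.
Qed.

Lemma cont_at_prod (I : Type) (r : seq I) (P : pred I) A (F : I -> 'M[R]_d -> R) :
  (forall i, cont_at A (F i)) -> cont_at A (fun B => \prod_(i <- r | P i) F i B).
Proof.
move=> hF; elim: r => [|i r IH].
  have -> : (fun B => \prod_(i <- [::] | P i) F i B) = fun=> 1 by apply/funext => B; rewrite big_nil.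
  exact: cont_at_cst.
have -> : (fun B => \prod_(j <- i :: r | P j) F j B) =
  (fun B => (if P i then F i B else 1) * \prod_(j <- r | P j) F j B).
  by apply/funext => B; rewrite big_cons; case: ifP => // _; rewrite mul1r.
by apply: cont_atM => //; case: (P i) => //; exact: cont_at_cst.
Qed.

Lemma cont_at_cmp k A (f g : {ffun 'I_k -> 'I_d}) : cont_at A (fun B => cmp B f g).
Proof.
apply: cont_atM; last exact: cont_at_cst.
apply: cont_at_sum => s; apply: cont_atM; first exact: cont_at_cst.
apply: cont_at_prod => i.
have -> : (fun B => mxsub f g B i (s i)) = fun B => B (f i) (g (s i)).
  by apply/funext => B; rewrite mxE.
exact: cont_at_entry.
Qed.

Lemma cont_at_cnorm k A : cont_at A (cnorm k).
Proof.
by do 2!apply: cont_at_sum => ?; apply: cont_at_norm; exact: cont_at_cmp.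
Qed.

(** At x = 0 the radius is e^(1/t). Elsewhere h is such that t h / x = ln (1 + e / x^t), and ln (1 +
    u) <= u gives (1 + h / x)^t <= 1 + e / x^t. *)
Lemma powR_usc (x t e : R) : 0 <= x -> 0 <= t -> 0 < e ->
  exists2 h, 0 < h & forall y, 0 <= y -> y <= x + h -> y `^ t <= x `^ t + e.
Proof.
move=> x0; rewrite le_eqVlt => /predU1P[<- e0|t0 e0].
  by exists 1 => // y _ _; rewrite !powRr0 lerDl ltW.
move: x0; rewrite le_eqVlt => /predU1P[<-|x0].
  exists (e `^ t^-1) => [|y y0]; first exact: powR_gt0.
  rewrite add0r => /(le_powR (ltW t0) y0); rewrite -powRrM mulVf ?gt_eqF // powRr1 ?(ltW e0) //.
  by rewrite powR0 ?gt_eqF // add0r.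
have xt0 : 0 < x `^ t by exact: powR_gt0.
have z1 : 1 < 1 + e / x `^ t by rewrite ltrDl divr_gt0.
exists (x / t * ln (1 + e / x `^ t)) => [|y y0 yx].
  by rewrite mulr_gt0 ?divr_gt0 // ln_gt0.
set h := x / t * _ in yx.
have h0 : 0 < h by rewrite mulr_gt0 ?divr_gt0 // ln_gt0.
apply: (le_trans (le_powR (ltW t0) y0 yx)).
have -> : x + h = x * (1 + h / x) by field; rewrite gt_eqF.
rewrite powRM ?(ltW x0) ?addr_ge0 ?divr_ge0 ?(ltW x0) ?(ltW h0) //.
have -> : x `^ t + e = x `^ t * (1 + e / x `^ t) by field; rewrite gt_eqF.
rewrite ler_wpM2l ?powR_ge0 // /powR gt_eqF; last by rewrite ltr_pwDl // divr_ge0 ?ltW.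
rewrite -[leRHS]lnK ?posrE ?(lt_trans ltr01) // ler_expR.
apply: (@le_trans _ _ (t * (h / x))).
  rewrite ler_wpM2l ?(ltW t0) // le_ln1Dx // (lt_le_trans (ltrN10 _)) // divr_ge0 // ltW //.
by rewrite /h le_eqVlt; apply/orP; left; apply/eqP; field; rewrite !gt_eqF.
Qed.

Definition usc_at A F := forall e, 0 < e -> exists2 h : R, 0 < h &
  forall B, close h A B -> F B <= F A + e.

Lemma usc_atM A F G : (forall B, 0 <= F B) -> (forall B, 0 <= G B) ->
  usc_at A F -> usc_at A G -> usc_at A (fun B => F B * G B).
Proof.
move=> F0 G0 hF hG e e0; pose N := F A + G A + 1.
have N0 : 0 < N by rewrite ltr_wpDl // addr_ge0.
pose e1 := Num.min 1 (e / N).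
have e10 : 0 < e1 by rewrite lt_min ltr01 divr_gt0.
have [h h0 H] := hF _ e10; have [h' h'0 H'] := hG _ e10.
exists (Num.min h h') => [|B AB]; first by rewrite lt_min h0.
have {}H : F B <= F A + e1 by apply: H; apply: close_le AB; rewrite ge_min lexx.
have {}H' : G B <= G A + e1 by apply: H'; apply: close_le AB; rewrite ge_min lexx orbT.
have e11 : e1 <= 1 by rewrite ge_min lexx.
have e1e : e1 * N <= e by rewrite -ler_pdivlMr // ge_min lexx orbT.
apply: (le_trans (ler_pM (F0 B) (G0 B) H H')).
have : e1 * e1 <= e1 by rewrite ler_piMl // ltW.
rewrite /N in e1e; lra.
Qed.

Lemma usc_at_psi A t : (forall k, 0 <= t k) -> usc_at A (psi t).
Proof.
move=> t0; rewrite /psi; elim: (index_enum _) => [|i r IH].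
  by move=> e e0; exists 1 => // B _; rewrite !big_nil lerDl ltW.
move=> e e0.
have [|||h h0 H] := @usc_atM A (fun B => cnorm i.+1 B `^ t i) (fun B => \prod_(k <- r) cnorm k.+1 B `^ t k) _ _ _ IH e e0.
- by move=> B; exact: powR_ge0.
- by move=> B; apply: prodr_ge0 => *; exact: powR_ge0.
- move=> e' e'0; have [h h0 H] := powR_usc (cnorm_ge0 i.+1 A) (t0 i) e'0.
  have [h' h'0 H'] := cont_at_cnorm i.+1 A h0; exists h' => // B /H' AB.
  by apply: H; rewrite ?cnorm_ge0 //; move: AB; rewrite ler_norml; lra.
by exists h => // B /H; rewrite !big_cons.
Qed.

(** The entries and the norm N change by at most t N / 2 each, so the error becomes at most 2 t N,
    which is 4 t times the lower bound N / 2 of the new norm. *)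
Lemma near_rank1_stable k A u v t : 0 < t -> 0 < cnorm k A ->
  near_rank1 (cmp (k := k) A) u v t -> exists2 h : R, 0 < h &
  forall B, close h A B ->
    near_rank1 (cmp (k := k) B) u v (4 * t) /\ cnorm k A / 2 <= cnorm k B.
Proof.
move=> t0 N0 [su sv H]; set N := cnorm k A in N0.
have [h1 h10 H1] : exists2 h, 0 < h & forall fg : {ffun 'I_k -> 'I_d} * {ffun 'I_k -> 'I_d},
    forall B, close h A B -> `|cmp A fg.1 fg.2 - cmp B fg.1 fg.2| <= t * N / 2.
  apply: uniform_radius => [fg|fg h h' h'0 hh' HB B /(close_le hh')]; last exact: HB.
  by apply: cont_at_cmp; rewrite divr_gt0 ?mulr_gt0.
pose e := Num.min (t * N / 2) (N / 2).
have e0 : 0 < e by rewrite lt_min !divr_gt0 ?mulr_gt0.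
have [h2 h20 H2] := cont_at_cnorm k A e0.
exists (Num.min h1 h2) => [|B AB]; first by rewrite lt_min h10.
have {}H1 (f g : {ffun 'I_k -> 'I_d}) : `|cmp A f g - cmp B f g| <= t * N / 2.
  by apply: (H1 (f, g) B); apply: close_le AB; rewrite ge_min lexx.
have {}H2 : `|N - cnorm k B| <= e by apply: H2; apply: close_le AB; rewrite ge_min lexx orbT.
have ea : e <= t * N / 2 by rewrite ge_min lexx.
have eb : e <= N / 2 by rewrite ge_min lexx orbT.
have NB : N / 2 <= cnorm k B by move: H2; rewrite ler_norml; lra.
split=> //; split=> // f g; rewrite -/(cnorm k B).
have -> : cmp B f g - cnorm k B * (u f * v g) =
  (cmp A f g - N * (u f * v g)) - (cmp A f g - cmp B f g) + (N - cnorm k B) * (u f * v g) by ring.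
rewrite (le_trans (ler_normD _ _)) //.
have uv1 : `|(N - cnorm k B) * (u f * v g)| <= e.
  rewrite normrM -[leRHS]mulr1 ler_pM // normrM -[leRHS]mul1r ler_pM //.
have a1 : `|(cmp A f g - N * (u f * v g)) - (cmp A f g - cmp B f g)| <= N * t + t * N / 2.
  by rewrite (le_trans (ler_normB _ _)) // lerD //; exact: H.
have : t * (N / 2) <= t * cnorm k B by rewrite ler_wpM2l // ltW.
lra.
Qed.

End Perturbation.

Section CocyclePerturbation.
Variables (R : realType) (K : finType) (X : set (full_shift K)) (d : nat).
Hypothesis Xshift : forall x, X x -> X (Defs.shift x).
Variable A : full_shift K -> 'M[R]_d.
Hypothesis Ab : exists C : R, forall x i j, X x -> `|A x i j| <= C.

Lemma cocycle_close n (e : R) : 0 < e -> exists2 h : R, 0 < h &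
  forall B : full_shift K -> 'M[R]_d, (forall x, X x -> close h (A x) (B x)) ->
  forall x, X x -> close e (cocycle A x n) (cocycle B x n).
Proof.
have [C0 HC0] := Ab; pose C := Num.max C0 1.
have HC x i j : X x -> `|A x i j| <= C by move=> Xx; rewrite le_max HC0.
have C1 : 1 <= C by rewrite le_max lexx orbT.
have Cpos := lt_le_trans ltr01 C1.
have entry_bound m : exists2 D : R, 0 < D & forall x i j, X x -> `|cocycle A x m i j| <= D.
  elim: m => [|m [D D0 HD]].
    by exists 1 => // x i j _; rewrite mxE; case: eqP; rewrite ?normr1 ?normr0.
  exists (d%:R * (C * D) + 1) => [|x i j Xx /=]; first by rewrite ltr_wpDl // !mulr_ge0 // ltW.
  rewrite mxE (le_trans (ler_norm_sum _ _ _)) // ler_wpDr // mulr_natl -[X in _ *+ X](card_ord d) -sumr_const.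
  by apply: ler_sum => l _; rewrite normrM ler_pM // ?HC ?HD //; exact: iter_shift_in.
elim: n e => [|n IH] e e0.
  by exists 1 => // B _ x Xx i j; rewrite subrr normr0 ltW.
have [D D0 HD] := entry_bound n.
pose W := d%:R + 1 : R.
have W0 : 0 < W by rewrite ltr_wpDl.
pose e1 := Num.min 1 (e / (W * (2 * (C + 1)))).
have den0 : 0 < W * (2 * (C + 1)) by rewrite !mulr_gt0 // addr_gt0.
have e10 : 0 < e1 by rewrite lt_min ltr01 divr_gt0.
have [h h0 H] := IH e1 e10.
pose h1 := Num.min 1 (e / (W * (2 * D))).
have den1 : 0 < W * (2 * D) by rewrite !mulr_gt0.
have h10 : 0 < h1 by rewrite lt_min ltr01 divr_gt0.
exists (Num.min h h1) => [|B AB x Xx i j /=]; first by rewrite lt_min h0.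
have AB1 y : X y -> close h (A y) (B y) by move=> Xy; apply: close_le (AB y Xy); rewrite ge_min lexx.
have AB2 y : X y -> close h1 (A y) (B y) by move=> Xy; apply: close_le (AB y Xy); rewrite ge_min lexx orbT.
have XT := iter_shift_in Xshift n Xx.
rewrite !mxE -sumrB (le_trans (ler_norm_sum _ _ _)) //.
apply: (@le_trans _ _ (\sum_(l < d) (e / W))); last first.
  rewrite sumr_const card_ord -[leLHS]mulr_natl mulrCA ler_piMr ?(ltW e0) //.
  by rewrite ler_pdivrMr // mul1r lerDl.
apply: ler_sum => l _.
set a := A _ i l; set b := B _ i l; set p := cocycle A x n l j; set q := cocycle B x n l j.
have ab : `|a - b| <= h1 by exact: AB2.
have pq : `|p - q| <= e1 by exact: (H B AB1 x Xx l j).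
have pD : `|p| <= D by exact: HD.
have bC : `|b| <= C + 1.
  have -> : b = a - (a - b) by ring.
  rewrite (le_trans (ler_normB _ _)) // lerD //; first exact: HC.
  by rewrite (le_trans ab) // ge_min lexx.
have -> : a * p - b * q = (a - b) * p + b * (p - q) by ring.
rewrite (le_trans (ler_normD _ _)) // !normrM.
apply: (@le_trans _ _ (h1 * D + (C + 1) * e1)); first by rewrite lerD // ler_pM.
have x1 : h1 * (W * (2 * D)) <= e by rewrite -ler_pdivlMr // ge_min lexx orbT.
have x2 : e1 * (W * (2 * (C + 1))) <= e by rewrite -ler_pdivlMr // ge_min lexx orbT.
rewrite ler_pdivlMr //; lra.
Qed.

End CocyclePerturbation.

(** Adding eps k^2 makes the second difference off S at least eps > 0, so the maximum of the sum is
    attained on S. *)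
Lemma discrete_max (R : realDomainType) (e : nat -> R) (k1 : nat) (S : pred nat) (b eps : R) :
  0 < eps -> S 0%N -> S k1 -> (forall k, (k <= k1)%N -> S k -> e k <= b) ->
  (forall k, (0 < k < k1)%N -> ~~ S k -> 2 * e k - e k.-1 - e k.+1 <= eps) ->
  forall k, (k <= k1)%N -> e k <= b + eps * k1%:R ^+ 2.
Proof.
move=> eps0 S0 S1 HS HN k kk1.
pose f j := e j + eps * j%:R ^+ 2.
pose m := [arg max_(i > (ord0 : 'I_k1.+1)) f i]%O.
have mP (j : nat) : (j <= k1)%N -> f j <= f m.
  move=> jk; rewrite /m; case: arg_maxP => // i _ H.
  exact: (H (Ordinal (jk : (j < k1.+1)%N))).
have mk1 : (m <= k1)%N by rewrite -ltnS ltn_ord.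
have efk : e k <= f k by rewrite lerDl mulr_ge0 ?(ltW eps0) ?exprn_ge0.
apply: (le_trans efk); apply: (le_trans (mP k kk1)).
have [Sm|NSm] := boolP (S m).
  rewrite lerD ?HS // ler_wpM2l ?(ltW eps0) //.
  by rewrite ler_pXn2r ?nnegrE // ler_nat.
have m0 : (0 < m)%N by rewrite lt0n; apply: contraNneq NSm => ->.
have mlt : (m < k1)%N by rewrite ltn_neqAle mk1 andbT; apply: contraNneq NSm => ->.
have h1 := HN m; rewrite m0 mlt in h1; have {h1} := h1 isT NSm.
have h2 := mP m.+1 mlt; have h3 := mP m.-1 (leq_trans (leq_pred _) mk1).
move: h2 h3; rewrite /f; have -> : (m.-1)%:R = m%:R - 1 :> R.
  by rewrite -[in RHS](prednK m0) -natr1 addrK.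
rewrite -[m.+1%:R]natr1 => h2 h3 h4.
have : 2 * eps <= eps by nra.
by lra.
Qed.

(** * Lower bounds for concatenated blocks *)

Section MatrixLower.
Variables (R : realType) (d : nat).

Lemma cnorm_chain k (B : nat -> 'M[R]_d) r u v (kap t : R) : (0 < r)%N ->
  0 < kap -> kap <= 1 -> 8 * #|{: {ffun 'I_k -> 'I_d}}|%:R ^+ 2 * t <= kap ^+ 2 ->
  (forall i, (i < r)%N -> near_rank1 (cmp (k := k) (B i)) u v t /\ 0 < cnorm k (B i)) ->
  kap <= `|dot v u| ->
  kap * \prod_(i < r) (cnorm k (B i) * (kap / 2)) <= cnorm k (mprod B r).
Proof.
move=> r0 k0 k1 kt HB kd.
have [[su sv _] _] := HB 0%N r0.
apply: (@chain_nrm _ _ (fun i => cmp (B i.-1)) (fun=> u) (fun=> v) r kap t k0 k1 kt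
  (fun i ir => (HB i ir).1) (fun i ir => (HB i ir).2) su sv (fun _ _ => kd)
  (fun i => cmp (mprod B i))) => //.
  by rewrite /= mulmx1.
by move=> i _; rewrite -cmp_mul.
Qed.

(** [psi] pairs t k with the compound of order k + 1, so the vanishing of t from k1 on leaves only
    orders at most k1. The gap k1 is the upper end for the maximum principle. *)
Definition psi_lower_const (C : R) : Prop :=
  forall (L eps rho z b : R) (al t : nat -> R) (k1 : nat) (P : 'M[R]_d),
  al 0%N = 0 -> (k1 <= d)%N -> gap d L al eps rho k1 -> 0 < eps -> 0 < z -> 0 <= b ->
  (forall k, (k <= k1)%N -> rho < al k + L) ->
  (forall k, 0 <= t k) -> (forall k, (k1 <= k)%N -> t k = 0) ->
  (forall k, gap d L al eps rho k -> expR (z * al k - b) <= cnorm k P) ->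
  expR (z * (\sum_(k < d) t k * al k.+1) - (\sum_(k < d) t k) * (b + (z * eps + C) * d%:R ^+ 2))
  <= psi t P.

(* Orders k that are not gaps are handled by the discrete maximum principle:
   the defect z al_k - ln (cnorm k P) is nearly convex there, because
   ln (cnorm k P) is nearly concave in k and al nearly affine. *)
Lemma psi_lower : exists2 C : R, 0 <= C & psi_lower_const C.
Proof.
have ex k : exists C : R, 1 <= C /\ forall A : 'M[R]_d,
  cnorm k A * cnorm k.+2 A <= C * cnorm k.+1 A ^+ 2.
  by have [C C1 H] := cnorm_logconcave R d k; exists C.
have [c cP] := choice ex.
pose C := \sum_(k < d) ln (c k).
have C0 : 0 <= C by apply: sumr_ge0 => k _; rewrite ln_ge0 //; have [] := cP k.
exists C => // L eps rho z b al t k1 P al0 k1d gk1 eps0 z0 b0 alL t0 tk1 HP.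
(* Positivity descends from the order k1 to all smaller orders, so the logarithms below are
   genuine. *)
have stepP k : 0 < cnorm k.+1 P -> 0 < cnorm k P.
  have [C1 _ H] := cnormS_le R d k => lt; rewrite lt_neqAle cnorm_ge0 andbT eq_sym.
  apply: contraTneq lt => E; rewrite -leNgt (le_trans (H P)) // E mul0r mulr0 //.
have pos1 : 0 < cnorm k1 P by apply: lt_le_trans (HP k1 gk1); exact: expR_gt0.
have pos j : (j <= k1)%N -> 0 < cnorm (k1 - j) P.
  elim: j => [|j IH] jk; first by rewrite subn0.
  apply: stepP; rewrite subnSK //; exact: IH (ltnW jk).
have {}pos k : (k <= k1)%N -> 0 < cnorm k P.
  by move=> kk; have := pos (k1 - k)%N (leq_subr _ _); rewrite subKn.
pose e k := z * al k - ln (cnorm k P).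
have zC : 0 < z * eps + C by rewrite ltr_pwDl // mulr_gt0.
have main := @discrete_max R e k1 (fun k => (k == 0)%N || gap d L al eps rho k) b (z * eps + C) zC isT _ _ _.
have {main} main k : (k <= k1)%N -> e k <= b + (z * eps + C) * k1%:R ^+ 2.
  apply: main => //; first by rewrite gk1 orbT.
    move=> j jk /orP[/eqP->|gj]; first by rewrite /e al0 mulr0 cnorm0 ln1 subrr.
    rewrite /e lerBlDr -lerBlDl -ler_expR lnK ?posrE ?pos //.
    by rewrite (_ : _ - _ = z * al j - b) ?HP //; ring.
  move=> [//|j] /andP[_ jk]; rewrite negb_or => /andP[_].
  rewrite /gap alL ?(ltnW jk) // andbT negb_and /= (leq_trans (ltnW jk) k1d) /= -ltNge => ng.
  have jd : (j < d)%N := leq_trans (ltnW jk) k1d.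
  have [cj1 /(_ P) H] := cP j.
  have N0 := pos j (ltnW (ltnW jk)); have N1 := pos j.+1 (ltnW jk); have N2 := pos j.+2 jk.
  have lnH : ln (cnorm j P) + ln (cnorm j.+2 P) <= ln (c j) + 2 * ln (cnorm j.+1 P).
    have cj0 := lt_le_trans ltr01 cj1.
    rewrite -lnM ?posrE // mulr_natl -lnXn // -lnM ?posrE ?exprn_gt0 //.
    by rewrite ler_ln ?posrE ?mulr_gt0 ?exprn_gt0.
  have lnC : ln (c j) <= C.
    rewrite /C (bigD1 (Ordinal jd)) //= lerDl sumr_ge0 // => i _.
    by rewrite ln_ge0 //; have [] := cP i.
  have := ler_wpM2l (ltW z0) (ltW ng); rewrite /e /=; lra.
rewrite mulr_sumr mulr_suml -sumrB expR_sum /psi; apply: ler_prod => k _; rewrite expR_ge0 /=.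
have [kk|kk] := leqP k1 k; first by rewrite tk1 // !mul0r mulr0 subrr expR0 powRr0.
rewrite /powR gt_eqF ?pos // ler_expR.
have H := main k.+1 kk.
rewrite (_ : _ - _ = t k * (z * al k.+1 - (b + (z * eps + C) * d%:R ^+ 2))); last by ring.
have Hd : (z * eps + C) * k1%:R ^+ 2 <= (z * eps + C) * d%:R ^+ 2.
  by rewrite ler_wpM2l ?(ltW zC) // ler_pXn2r ?nnegrE // ler_nat.
rewrite ler_wpM2l //; move: H; rewrite /e => H.
by rewrite lerBlDr addrC -lerBlDr (le_trans H) // lerD2l.
Qed.

End MatrixLower.

Section BlockLower.
Variables (R : realType) (K : finType) (X : set (full_shift K)) (d : nat).
Hypothesis hX : subshift_of_finite_type X.
Variables (g : full_shift K -> R) (a : K -> 'M[R]_d).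
Hypothesis gb : exists C : R, forall x, X x -> `|g x| <= C.
Implicit Types (B : full_shift K -> 'M[R]_d) (t : nat -> R).
Local Notation T := (@Defs.shift K).
Let Xshift := sft_shift hX.

Definition gsum (w : seq K) : R := cylsup X (fun n y => expR (birkhoff_sum g n y)) w.

Lemma cocycle_blocks B y n r :
  cocycle B y (r * n) = mprod (fun i => cocycle B (iter (i * n) T y) n) r.
Proof. by elim: r => // r IH; rewrite mulSn addnC cocycle_add IH. Qed.

Lemma birkhoff_blocks y n r :
  birkhoff_sum g (r * n) y = \sum_(i < r) birkhoff_sum g n (iter (i * n) T y).
Proof.
elim: r => [|r IH]; first by rewrite /birkhoff_sum !big_ord0.
by rewrite mulSn addnC birkhoff_add IH big_ord_recr.
Qed.

Lemma initial_seg (w : seq K) y n r i : initial y (r * n) = w -> (i < r)%N ->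
  initial (iter (i * n) T y) n = seg n w i 1.
Proof.
move=> <- ir; rewrite /seg mul1n.
have E : (r * n = i * n + (n + (r - i.+1) * n))%N by rewrite -mulSn -mulnDl addnS -addSn subnKC.
rewrite E initial_add drop_size_cat ?size_initial // initial_add take_size_cat ?size_initial //.
Qed.

(** Every choice of r words from F is realized by a point of X, so the sum over words of length r n1
    contains an r-th power. At the gaps each block loses the factor kap / 4: kap / 2 from
    [cnorm_chain], and 1/2 from the perturbed norm. [psi_lower] fills in the other orders. *)
Lemma block_lower (t : nat -> R) (kap tau rho eps eg L : R) (al : nat -> R) (k1 n1 : nat)
    (alpha : seq K) (F : pred (seq K)) (u v : forall k, {ffun 'I_k -> 'I_d} -> R) B M C :
  gluing_length X M -> psi_lower_const d C ->
  (forall k, 0 <= t k) -> cbounded X B ->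
  al 0%N = 0 -> (k1 <= d)%N -> gap d L al eps rho k1 -> 0 < eps -> 0 <= rho ->
  (forall k, (k <= k1)%N -> rho < al k + L) -> (forall k, (k1 <= k)%N -> t k = 0) ->
  (0 < n1)%N -> (M <= n1)%N -> 0 < kap -> kap <= 1 ->
  (forall k, (k <= d)%N -> 8 * #|{: {ffun 'I_k -> 'I_d}}|%:R ^+ 2 * tau <= kap ^+ 2) ->
  (forall k, gap d L al eps rho k -> kap <= `|dot (v k) (u k)|) ->
  (forall w, size w = n1 -> F w -> take M w = alpha /\ cyl X (w ++ alpha) !=set0) ->
  (forall x y, X x -> X y -> initial x n1 = initial y n1 ->
     `|birkhoff_sum g n1 x - birkhoff_sum g n1 y| <= eg * n1%:R) ->
  (forall w y, size w = n1 -> F w -> X y -> initial y n1 = w -> forall k, gap d L al eps rho k ->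
     near_rank1 (cmp (k := k) (cocycle B y n1)) (u k) (v k) tau /\
     expR (n1%:R * (al k - rho)) / 2 <= cnorm k (cocycle B y n1)) ->
  forall r, (0 < r)%N ->
  (wsum n1 (fun w => (F w)%:R * gsum w) * expR (- (eg * n1%:R))) ^+ r *
  expR ((r * n1)%:R * (\sum_(k < d) t k * al k.+1) - (\sum_(k < d) t k) *
    ((r * n1)%:R * rho - r%:R * ln (kap / 4) - ln kap + ((r * n1)%:R * eps + C) * d%:R ^+ 2))
  <= Zpsi X g B t (r * n1).
Proof.
move=> Hglue Hlow t0 bB al0 k1d gk1 eps0 rho0 alL tk1 n10 Mn1 kap0 kap1 Ktau Hdot HF Hg HB r r0.
set Y := expR _; have Y0 : 0 < Y := expR_gt0 _.
rewrite -wsumZr -wsum_chunks -wsumZr.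
have gexp0 : forall n y, 0 <= (fun n y => expR (birkhoff_sum g n y)) n y by move=> *; exact: expR_ge0.
have gexpb : bounded_on X (fun n y => expR (birkhoff_sum g n y)).
  move=> n; have [D HD] := birkhoff_bound Xshift gb n; exists (expR D) => y Xy.
  by rewrite ler_expR (le_trans (ler_norm _)) // HD.
apply: le_wsum => w sw.
have [allF|] := boolP [forall i : 'I_r, F (seg n1 w i 1)]; last first.
  move=> /forallPn[i /negbTE Fi]; rewrite (bigD1 i) //= Fi !mul0r.
  exact: (cylsup_psi_ge0 Xshift gb).
have segF i : (i < r)%N -> F (seg n1 w i 1) by move=> ir; have /forallP/(_ (Ordinal ir)) := allF.
have ssz i : (i < r)%N -> size (seg n1 w i 1) = n1.
  by move=> ir; rewrite size_seg ?mul1n // sw leq_mul2r addn1 ir orbT.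
have x0 : K by case: (w) sw => [|c _ _] //; case: (r) r0 => // r' _; case: (n1) n10.
(* A point of X is infinite: after the r blocks of w its first block is repeated for ever. *)
pose W i := seg n1 w (if (i < r)%N then i else 0) 1.
have WP i : [/\ size (W i) = n1, take M (W i) = alpha & cyl X (W i ++ alpha) !=set0].
  have ltr' : ((if (i < r)%N then i else 0) < r)%N by case: ifP.
  by have [h1 h2] := HF _ (ssz _ ltr') (segF _ ltr'); split=> //; exact: ssz.
pose y := glue n1 x0 W.
have Xy : X y := Hglue n1 x0 W alpha n10 Mn1 WP.
have yw : initial y (r * n1) = w.
  apply: (@eq_from_nth _ x0); rewrite ?size_initial // => j jr.
  rewrite nth_mkseq // /y /glue /W.
  have -> : (j %/ n1 < r)%N by rewrite ltn_divLR.
  rewrite /seg mul1n nth_take ?ltn_mod // nth_drop; congr (nth _ _ _).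
  by rewrite -divn_eq.
have wy : cyl X w y by split=> //; rewrite sw.
have Hb := Hpsi_bounded Xshift gb t0 bB.
have := cylsup_ub Hb wy; rewrite sw; apply: le_trans.
rewrite /Hpsi birkhoff_blocks expR_sum; apply: ler_pM.
- by apply: prodr_ge0 => i _; rewrite mulr_ge0 ?expR_ge0 // mulr_ge0 // cylsup_ge0.
- exact: expR_ge0.
- apply: ler_prod => i _; rewrite mulr_ge0 ?expR_ge0 ?mulr_ge0 ?cylsup_ge0 //=.
  have ir := ltn_ord i; rewrite segF // mul1r /Y expRN ler_pdivrMr ?expR_gt0 // -expRD.
  apply: cylsup_le => [|x [Xx xE]]; first exact: expR_ge0.
  rewrite ssz // in xE *; rewrite ler_expR.
  have Xi : X (iter (i * n1) T y) by exact: iter_shift_in.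
  have : `|birkhoff_sum g n1 x - birkhoff_sum g n1 (iter (i * n1) T y)| <= eg * n1%:R.
    by apply: Hg => //; rewrite (initial_seg yw ir).
  by rewrite ler_norml; lra.
rewrite cocycle_blocks.
have rn0 : 0 < (r * n1)%:R :> R by rewrite ltr0n muln_gt0 r0.
have lnk : ln kap <= 0 by rewrite ln_le0.
have k40 : 0 < kap / 4 by rewrite divr_gt0.
have lnk4 : ln (kap / 4) <= 0 by rewrite ln_le0 //; lra.
have b0 : 0 <= (r * n1)%:R * rho - r%:R * ln (kap / 4) - ln kap.
  have := mulr_ge0 (ltW rn0) rho0; have := mulr_ge0_le0 (ler0n R r) lnk4; lra.
apply: (Hlow L eps rho (r * n1)%:R _ al t k1) => // k gk.
have kd : (k <= d)%N by case/and3P: gk => /andP[].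
have HBi i : (i < r)%N -> near_rank1 (cmp (k := k) (cocycle B (iter (i * n1) T y) n1)) (u k) (v k) tau /\
     expR (n1%:R * (al k - rho)) / 2 <= cnorm k (cocycle B (iter (i * n1) T y) n1).
  move=> ir; apply: (HB (seg n1 w i 1)) => //; [exact: ssz | exact: segF | exact: iter_shift_in |].
  exact: initial_seg yw ir.
have HBi' i : (i < r)%N -> near_rank1 (cmp (k := k) (cocycle B (iter (i * n1) T y) n1)) (u k) (v k) tau /\
     0 < cnorm k (cocycle B (iter (i * n1) T y) n1).
  move=> ir; have [? lo] := HBi i ir; split=> //; apply: lt_le_trans lo.
  by rewrite divr_gt0 ?expR_gt0.
apply: le_trans (cnorm_chain r0 kap0 kap1 (Ktau k kd) HBi' (Hdot k gk)).
apply: (@le_trans _ _ (kap * \prod_(i < r) (expR (n1%:R * (al k - rho)) * (kap / 4)))).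
  rewrite prodr_const card_ord -[kap / 4 in leRHS]lnK ?posrE // -expRD -expR_mul_nat.
  have ek : expR (ln kap) = kap by rewrite lnK ?posrE.
  rewrite -[in leRHS]ek -expRD ek ler_expR natrM; lra.
rewrite ler_wpM2l ?(ltW kap0) //; apply: ler_prod => i _.
rewrite mulr_ge0 ?expR_ge0 ?(ltW k40) //=.
have [_ lo] := HBi i (ltn_ord i).
rewrite (_ : _ * (kap / 4) = expR (n1%:R * (al k - rho)) / 2 * (kap / 2)); last by field.
by rewrite ler_wpM2r // divr_ge0 // ltW.
Qed.

End BlockLower.

(* Without a gap at the orders p, ..., the increments of al decrease too
   slowly for al to reach the value -L at order d + 1. *)
Lemma gap_above (R : realType) (d p : nat) (L rho eps M0 S H1 : R) (al : nat -> R) :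
  (0 < p <= d)%N -> 0 < rho <= 1 -> 0 < eps <= 1 -> 0 <= M0 -> 0 <= S -> 0 <= H1 ->
  2 + M0 + d%:R * S + d.+1%:R * (H1 + M0 + d.+1%:R) <= L ->
  al d.+1 = - L -> - M0 <= al p -> (forall k, (k < d)%N -> al k.+1 <= al k + S) ->
  (forall k, (k <= d)%N -> al k <= H1) ->
  exists k1, [/\ (p <= k1 <= d)%N, gap d L al eps rho k1 &
    forall k, (k <= k1)%N -> rho < al k + L].
Proof.
move=> /andP[p0 pd] /andP[rho0 rho1] /andP[eps0 eps1] M00 S0 H10 hL ad hp hS hH.
apply: contrapT => none.
have low j : (j <= p)%N -> - M0 - j%:R * S <= al (p - j)%N.
  elim: j => [|j IH] jp; first by rewrite subn0 mul0r subr0.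
  have := hS (p - j.+1)%N; rewrite subnSK // => /(_ (leq_trans (leq_subr _ _) pd)).
  by have := IH (ltnW jp); rewrite -natr1; lra.
have dS : 0 <= d%:R * S by rewrite mulr_ge0.
have dH : 0 <= d.+1%:R * (H1 + M0 + d.+1%:R) by rewrite mulr_ge0 // !addr_ge0.
have big k : (k <= p)%N -> rho < al k + L.
  move=> kp; have := low (p - k)%N (leq_subr _ _); rewrite subKn //.
  have : (p - k)%:R * S <= d%:R * S by rewrite ler_wpM2r // ler_nat (leq_trans (leq_subr _ _)).
  by lra.
pose D := H1 + M0 + d.+1%:R.
suff H i : (p + i <= d.+1)%N -> [/\ forall k, (k <= p + i)%N -> rho < al k + L,
    al (p + i).-1 - al (p + i)%N <= H1 + M0 + i%:R & - M0 - i%:R * D <= al (p + i)%N].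
  have [] := H (d.+1 - p)%N; first by rewrite subnKC // ltnW.
  rewrite subnKC 1?ltnW // => /(_ d.+1 (leqnn _)); rewrite ad => h _ _.
  by move: h; rewrite addNr ltNge (ltW rho0).
elim: i => [|i IH] ip.
  rewrite !addn0 mul0r subr0 addr0; split=> //.
  have := hH p.-1 (leq_trans (leq_pred _) pd); lra.
have {}ip : (p + i <= d)%N by rewrite addnS ltnS in ip.
have [h1 h2 h3] := IH (leqW ip).
have Ng : ~~ gap d L al eps rho (p + i).
  by apply/negP => g; apply: none; exists (p + i)%N; rewrite leq_addr ip.
move: Ng; rewrite /gap ip addn_gt0 p0 h1 //= andbT -ltNge => Ng.
have id1 : i.+1%:R <= d.+1%:R :> R by rewrite ler_nat ltnS (leq_trans (leq_addl p i)).
have D0 : 0 <= D by rewrite !addr_ge0.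
have iD : i.+1%:R * D <= d.+1%:R * D by rewrite ler_wpM2r.
have i1 : i.+1%:R = i%:R + 1 :> R by rewrite -natr1.
have low1 : - M0 - i.+1%:R * D <= al (p + i).+1 by move: id1 iD; rewrite i1 /D in h3 *; lra.
rewrite addnS /=; split=> //; last by rewrite i1; lra.
by move=> k; rewrite leq_eqVlt ltnS => /predU1P[->|/h1 //]; rewrite -/D in hL; lra.
Qed.

Section Distortion.
Variables (R : realType) (K : finType) (X : set (full_shift K)) (g : full_shift K -> R).
Hypotheses (hX : subshift_of_finite_type X) (hg : {within X, continuous g}).
Local Notation T := (@Defs.shift K).

(** The modulus of continuity applies to all terms except the last m, which cost at most 2 C0 each;
    for large n they are absorbed. *)
Lemma birkhoff_distortion (eg : R) : 0 < eg -> exists n0, forall n x y, (n0 <= n)%N ->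
  X x -> X y -> initial x n = initial y n ->
  `|birkhoff_sum g n x - birkhoff_sum g n y| <= eg * n%:R.
Proof.
move=> eg0; have eg20 : 0 < eg / 2 by rewrite divr_gt0.
have [m Hm] := uniform_modulus hX hg eg20; have [C0 HC] := bounded_of_modulus hX hg.
have Xs := sft_shift hX.
exists (Num.truncn (m%:R * (2 * C0) / (eg / 2))).+1 => n x y nn Xx Xy /initialP xy.
have C00 : 0 <= C0 by exact: le_trans (normr_ge0 _) (HC x Xx).
have term i : `|g (iter i T x) - g (iter i T y)| <= eg / 2 + (n < i + m)%N%:R * (2 * C0).
  have Xi := iter_shift_in Xs i Xx; have Yi := iter_shift_in Xs i Xy.
  have [ni|ni] := ltnP n (i + m).
    rewrite mul1r (le_trans (ler_normB _ _)) // ler_wpDl ?(ltW eg20) //.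
    have := HC _ Xi; have := HC _ Yi; lra.
  rewrite mul0r addr0 ltW // Hm //; apply/initialP => j jm.
  by rewrite !iter_shiftE xy // (leq_trans _ ni) // ltn_add2l.
rewrite /birkhoff_sum -sumrB (le_trans (ler_norm_sum _ _ _)) //.
apply: (@le_trans _ _ (\sum_(i < n) (eg / 2 + (n < i + m)%N%:R * (2 * C0)))).
  by apply: ler_sum => i _; exact: term.
rewrite big_split /= sumr_const card_ord -mulr_suml -natr_sum -[_ *+ n]mulr_natr.
have cnt : (\sum_(i < n) (n < i + m) <= m)%N.
  rewrite -(big_mkord xpredT (fun i => (n < i + m)%N : nat)).
  have [mn|nm] := leqP m n; last first.
    rewrite (leq_trans _ (ltnW nm)) // -[leqRHS](subn0 n) -[leqRHS]muln1 -sum_nat_const_nat.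
    by apply: leq_sum => i _; case: (_ < _)%N.
  rewrite (big_cat_nat (n := n - m)) ?leq_subr //= big_nat big1 => [|i /andP[_ h]]; last first.
    by rewrite ltnNge -leq_subRL ?(ltnW h) // ; move: h; case: ltnP => //; lia.
  rewrite add0n -[leqRHS](subKn mn) -[leqRHS]muln1 -sum_nat_const_nat.
  by apply: leq_sum => i _; case: (_ < _)%N.
have c1 : (\sum_(i < n) (n < i + m))%N%:R * (2 * C0) <= m%:R * (2 * C0).
  by rewrite ler_wpM2r ?mulr_ge0 // ler_nat.
have c2 : m%:R * (2 * C0) <= eg / 2 * n%:R.
  by rewrite [leRHS]mulrC -ler_pdivrMr // ltW // (lt_le_trans (truncnS_gt _)) // ler_nat.
by rewrite (splitr eg) mulrDl; lra.
Qed.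

End Distortion.

(** The slack s absorbs the constant D over many blocks. If the growth were below c,
    submultiplicativity would give Z n <= C e^(n c) for all n, against the bound at large multiples
    of n1. *)
Lemma growth_ge_of_blocks (R : realType) (Z : nat -> R) (n1 : nat) (c s D : R) :
  (forall n, 0 <= Z n) -> (forall n m, Z (n + m) <= Z n * Z m) -> (0 < n1)%N -> 0 < s ->
  (forall r, (0 < r)%N -> expR ((r * n1)%:R * (c + s) - D) <= Z (r * n1)%N) ->
  (c%:E <= growth Z)%E.
Proof.
move=> Z0 Zs n10 s0 H; apply/(growth_ge Z0) => n n0; rewrite leNgt; apply/negP => lt.
have [C C0 HC] := submul_bound Z0 Zs n0 (ltW lt).
pose r := (Num.truncn (`|D + ln C| / s)).+1.
have := le_trans (H r isT) (HC (r * n1)%N).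
rewrite -{1}[C]lnK ?posrE // -expRD ler_expR => le.
have : `|D + ln C| < r%:R * s by rewrite -ltr_pdivrMr // truncnS_gt.
have : r%:R * s <= (r * n1)%:R * s by rewrite ler_wpM2r ?(ltW s0) // ler_nat leq_pmulr.
by have := ler_norm (D + ln C); lra.
Qed.

(** * Locally constant cocycles as functions of letters *)

Section LetterCocycle.
Variables (R : realType) (K : finType) (X : set (full_shift K)) (d : nat).
Hypothesis Xshift : forall x, X x -> X (Defs.shift x).
Variable g : full_shift K -> R.
Hypothesis gb : exists C : R, forall x, X x -> `|g x| <= C.
Variables (A : full_shift K -> 'M[R]_d) (a : K -> 'M[R]_d).
Hypothesis Aa : forall x, X x -> A x = a (x 0%N).
Implicit Types (t : nat -> R).
Local Notation T := (@Defs.shift K).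

Lemma cocycle_letters x n : X x -> cocycle A x n = mw a (initial x n).
Proof.
move=> Xx; elim: n => [//|n IH]; rewrite -addn1 cocycle_add initial_add mw_cat IH.
congr (_ *m _); rewrite /= mulmx1 Aa ?iter_shiftE ?addn0; last exact: iter_shift_in.
by rewrite /mw /= mulmx1 iter_shiftE addn0.
Qed.

Lemma letters_cnorm_close (e : R) : 0 < e -> exists2 h : R, 0 < h &
  forall B : full_shift K -> 'M[R]_d, (forall x, X x -> close h (A x) (B x)) ->
  forall k x, (k <= d)%N -> X x -> `|cnorm k (A x) - cnorm k (B x)| <= e.
Proof.
move=> e0.
have [h h0 H] : exists2 h, 0 < h & forall ck : K * 'I_d.+1,
    forall M, close h (a ck.1) M -> `|cnorm ck.2 (a ck.1) - cnorm ck.2 M| <= e.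
  apply: uniform_radius => [ck|ck h h' h'0 hh' H M /(close_le hh')]; last exact: H.
  exact: cont_at_cnorm.
exists h => // B AB k x kd Xx; rewrite Aa //.
by apply: (H (x 0%N : K, Ordinal (kd : (k < d.+1)%N))); rewrite /= -Aa //; exact: AB.
Qed.

Lemma letters_cbounded : cbounded X A.
Proof.
exists (\sum_(c : K) \sum_(k < d.+1) cnorm k (a c)) => k x kd Xx; rewrite Aa //.
rewrite (bigD1 (x 0%N : K)) //= (bigD1 (Ordinal (kd : (k < d.+1)%N))) //= -addrA lerDl.
by rewrite addr_ge0 ?sumr_ge0 // => *; rewrite ?cnorm_ge0 // sumr_ge0 // => *; rewrite cnorm_ge0.
Qed.

Lemma letters_bounded : exists C : R, forall x i j, X x -> `|A x i j| <= C.
Proof.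
exists (\sum_(c : K) \sum_i \sum_j `|a c i j|) => x i j Xx; rewrite Aa //.
rewrite (bigD1 (x 0%N : K)) //= (bigD1 i) //= (bigD1 j) //= -!addrA lerDl.
rewrite !addr_ge0 ?sumr_ge0 // => *; rewrite ?sumr_ge0 // => *; rewrite ?sumr_ge0 // => *.
Qed.

Lemma close_cbounded : exists2 h : R, 0 < h & forall B : full_shift K -> 'M[R]_d,
  (forall x, X x -> close h (A x) (B x)) -> cbounded X B.
Proof.
have [h h0 H] := letters_cnorm_close ltr01; exists h => // B AB.
have [C HC] := letters_cbounded; exists (C + 1) => k x kd Xx.
by have := H B AB k x kd Xx; have := HC k x kd Xx; rewrite ler_norml; lra.
Qed.

Let gexp0 n (y : full_shift K) : 0 <= expR (birkhoff_sum g n y) := expR_ge0 _.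

Let gexpb : bounded_on X (fun n y => expR (birkhoff_sum g n y)).
Proof.
move=> n; have [D HD] := birkhoff_bound Xshift gb n; exists (expR D) => y Xy.
by rewrite ler_expR (le_trans (ler_norm _)) // HD.
Qed.

Lemma gsum_ge0 w : 0 <= gsum X g w.
Proof. exact: cylsup_ge0. Qed.

Lemma gsum_submul : submul (gsum X g).
Proof. by apply: cylsup_submul => // n m y Xy; rewrite birkhoff_add expRD. Qed.

Lemma gsum_nonempty w : gsum X g w != 0 -> cyl X w !=set0.
Proof. by move=> w0; apply: contrapT => /cylsup_empty E; rewrite /gsum E eqxx in w0. Qed.

Lemma gsum_growth : exists2 H : R, 0 <= H & forall n, wsum n (gsum X g) <= expR (n%:R * H).
Proof.
have Z0 n : 0 <= wsum n (gsum X g) by apply: wsum_ge0 => w; exact: gsum_ge0.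
exists (wsum 1 (gsum X g)) => // n.
have := submul_pow Z0 (fun n m => wsum_submul _ _ gsum_ge0 gsum_submul) 1 n 0.
rewrite muln1 addn0 => /le_trans; apply.
rewrite -[leRHS]mulr1 expR_mul_nat ler_pM ?exprn_ge0 //.
  by rewrite lerXn2r ?nnegrE ?expR_ge0 // (le_trans _ (expR_ge1Dx _)) // lerDr.
rewrite wsum0; apply: cylsup_le => // y _ /=.
by rewrite /birkhoff_sum big_ord0 expR0.
Qed.

Lemma letters_cnorm_growth : exists2 H : R, 0 <= H & forall k w, (0 < size w)%N ->
  cnorm k (mw a w) <= expR ((size w)%:R * H).
Proof.
pose H := \sum_(c : K) \sum_(k < d.+1) cnorm k (a c).
have S0 c : 0 <= \sum_(k < d.+1) cnorm k (a c) by apply: sumr_ge0 => *; exact: cnorm_ge0.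
have H0 : 0 <= H by exact: sumr_ge0.
exists H => // k; elim/last_ind => [//|w c IH] _.
have [kd|dk] := ltnP k d.+1; last by rewrite cnorm_gt // expR_ge0.
have cH : cnorm k (a c) <= expR H.
  apply: (@le_trans _ _ H); last by rewrite (le_trans _ (expR_ge1Dx _)) // lerDr.
  rewrite /H (bigD1 c) //= (bigD1 (Ordinal kd)) //= -addrA lerDl addr_ge0 ?sumr_ge0 // => *.
  exact: cnorm_ge0.
have mc : mw a [:: c] = a c by rewrite /mw /= mulmx1.
case: w IH => [|b w] IH; first by rewrite mc mul1r.
rewrite -cats1 mw_cat mc size_cat addn1 -natr1 mulrDl mul1r expRD mulrC.
by rewrite (le_trans (cnorm_mul _ _ _)) // ler_pM ?cnorm_ge0 // IH.
Qed.

Lemma cylsup_le_gsum t w : (forall k, 0 <= t k) ->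
  cylsup X (Hpsi g A t) w <= gsum X g w * psi t (mw a w).
Proof.
move=> t0; apply: cylsup_le => [|y wy]; first by rewrite mulr_ge0 ?gsum_ge0 ?psi_ge0.
have [Xy yw] := wy; rewrite /Hpsi cocycle_letters // yw ler_wpM2r ?psi_ge0 //.
exact: (cylsup_ub gexpb wy).
Qed.

(** Raising the exponents by 2 r loses little because the truncated norms are at least e^(-L n).
    This moves t off the boundary of the cone, as two-sided tilting requires. *)
Lemma cylsup_le_tilted t (L r : R) w : (forall k, 0 <= t k) -> 0 <= L -> 0 <= r ->
  cylsup X (Hpsi g A t) w * expR (- ((size w)%:R * (2 * r * L * d%:R))) <=
  tq d (gsum X g) (fun k => tlog a L k.+1) (fun k => t k + 2 * r) w.
Proof.
move=> t0 L0 r0.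
apply: le_trans (ler_wpM2r (expR_ge0 _) (cylsup_le_gsum w t0)) _.
rewrite /tq -[leLHS]mulrA ler_wpM2l ?gsum_ge0 //.
under [in leRHS]eq_bigr do rewrite mulrDl.
rewrite big_split expRD ler_pM ?psi_ge0 ?expR_ge0 //.
  rewrite expR_sum; apply: ler_prod => k _; rewrite powR_ge0 /=.
  apply: (le_trans (le_powR (t0 k) (cnorm_ge0 _ _) (cnorm_le_tnorm a L k.+1 w))).
  by rewrite /powR gt_eqF ?tnorm_gt0.
rewrite ler_expR -mulr_sumr.
have : \sum_(k < d) - (L * (size w)%:R) <= \sum_(k < d) tlog a L k.+1 w.
  apply: ler_sum => k _; rewrite -ler_expR expR_tlog.
  by rewrite le_max lexx orbT.
rewrite sumr_const card_ord -[leLHS]mulr_natr => /(ler_wpM2l (mulr_ge0 (ler0n R 2) r0)).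
by lra.
Qed.

End LetterCocycle.

Lemma controlled_bounds (R : realType) (K : finType) (d : nat) (a : K -> 'M[R]_d)
    (L H rho : R) (al : nat -> R) w : 0 <= L -> 0 <= H -> 0 <= rho ->
  (forall k w, (0 < size w)%N -> cnorm k (mw a w) <= expR ((size w)%:R * H)) ->
  (0 < size w)%N -> controlled a L al rho w ->
  forall k, (k <= d.+1)%N -> - L - rho <= al k <= H + rho.
Proof.
move=> L0 H0 rho0 hH w0 cw k kd; have /andP[lo hi] := cw k kd.
have n0 : 0 < (size w)%:R :> R by rewrite ltr0n.
apply/andP; split.
  have : expR (- (L * (size w)%:R)) <= expR ((size w)%:R * (al k + rho)).
    by apply: le_trans hi; rewrite le_max lexx orbT.
  rewrite ler_expR mulrC -mulrN ler_pM2l //; lra.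
have : expR ((size w)%:R * (al k - rho)) <= expR ((size w)%:R * H).
  apply: (le_trans lo); rewrite ge_max hH //= ler_expR mulrC -mulrN ler_pM2l //; lra.
rewrite ler_expR ler_pM2l //; lra.
Qed.

(** From [cnormS_le]: passing from order k to k + 1 multiplies the norm at most by a constant times
    the norm of order 1. The bound does not involve L, which is chosen later in terms of it. *)
Lemma controlled_slope (R : realType) (d : nat) : exists2 S : R, 0 <= S &
  forall (K : finType) (a : K -> 'M[R]_d) (L H rho : R) (al : nat -> R) w,
  0 <= L -> 0 <= H -> 0 <= rho ->
  (forall k w, (0 < size w)%N -> cnorm k (mw a w) <= expR ((size w)%:R * H)) ->
  (0 < size w)%N -> controlled a L al rho w ->
  forall k, (k < d)%N -> al k.+1 <= al k + (S + H + 2 * rho).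
Proof.
have ex k : exists C : R, 1 <= C /\ forall A : 'M[R]_d,
  cnorm k.+1 A <= C * (cnorm k A * cnorm 1 A).
  by have [C C1 H] := cnormS_le R d k; exists C.
have [C CP] := choice ex.
exists (\sum_(k < d) ln (C k)) => [|K a L H rho al w L0 H0 rho0 hH w0 cw k kd].
  by apply: sumr_ge0 => k _; rewrite ln_ge0 //; have [] := CP k.
have [C1 /(_ (mw a w)) hC] := CP k.
have lnC : ln (C k) <= \sum_(k < d) ln (C k).
  rewrite (bigD1 (Ordinal kd)) //= lerDl sumr_ge0 // => i _.
  by rewrite ln_ge0 //; have [] := CP i.
have lnC0 : 0 <= ln (C k) by rewrite ln_ge0.
set n : R := (size w)%:R; have n1 : 1 <= n by rewrite ler1n.
have n0 : 0 < n := lt_le_trans ltr01 n1.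
have /andP[lo _] := cw k.+1 (leqW kd).
have /andP[_ hi] := cw k (leqW (ltnW kd)).
have : expR (n * (al k.+1 - rho)) <= expR (n * (ln (C k) + al k + rho + H)).
  apply: (le_trans lo); rewrite ge_max; apply/andP; split.
    apply: (le_trans hC); rewrite -[C k in leLHS]lnK ?posrE ?(lt_le_trans ltr01) //.
    have -> : n * (ln (C k) + al k + rho + H) = n * ln (C k) + (n * (al k + rho) + n * H) by ring.
    rewrite 2!expRD; apply: ler_pM; rewrite ?expR_ge0 ?mulr_ge0 ?cnorm_ge0 //.
      by rewrite ler_expR ler_peMl.
    rewrite ler_pM ?cnorm_ge0 ?hH //.
    exact: le_trans (cnorm_le_tnorm a L k w) hi.
  rewrite ler_expR mulrC -mulrN ler_pM2l //.
  have /andP[lo' _] := controlled_bounds L0 H0 rho0 hH w0 cw (leqW (ltnW kd)); lra.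
rewrite ler_expR ler_pM2l //; lra.
Qed.

Section Core.
Variables (R : realType) (K : finType) (X : set (full_shift K)) (d : nat).
Variable g : full_shift K -> R.
Hypotheses (hX : subshift_of_finite_type X) (hg : {within X, continuous g}).
Variables (A : full_shift K -> 'M[R]_d) (a : K -> 'M[R]_d).
Hypothesis Aa : forall x, X x -> A x = a (x 0%N).
Local Notation T := (@Defs.shift K).

Let Xs := sft_shift hX.
Let gb := bounded_of_modulus hX hg.

Lemma blocks_stable (L eps rho tau : R) (al : nat -> R) (n1 : nat) (F : pred (seq K))
    (u v : forall k, {ffun 'I_k -> 'I_d} -> R) : 0 <= rho -> 0 < tau -> (0 < n1)%N ->
  (forall w, size w = n1 -> F w -> controlled a L al rho w /\
     forall k, gap d L al eps rho k -> near_rank1 (cmp (k := k) (mw a w)) (u k) (v k) tau) ->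
  exists2 h : R, 0 < h & forall B, (forall x, X x -> close h (A x) (B x)) ->
  forall w y, size w = n1 -> F w -> X y -> initial y n1 = w -> forall k, gap d L al eps rho k ->
     near_rank1 (cmp (k := k) (cocycle B y n1)) (u k) (v k) (4 * tau) /\
     expR (n1%:R * (al k - rho)) / 2 <= cnorm k (cocycle B y n1).
Proof.
move=> rho0 tau0 n10 HF.
pose P (wk : n1.-tuple K * 'I_d.+1) h := F wk.1 -> gap d L al eps rho wk.2 ->
  forall B, close h (mw a wk.1) B ->
    near_rank1 (cmp (k := wk.2) B) (u wk.2) (v wk.2) (4 * tau) /\
    expR (n1%:R * (al wk.2 - rho)) / 2 <= cnorm wk.2 B.
have [h h0 hP] : exists2 h, 0 < h & forall wk, P wk h.
  apply: uniform_radius => [[w k]|wk h h' h'0 hh' H Fw gk B /(close_le hh')]; last exact: H.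
  have [Fw|Fw] := boolP (F w); last by exists 1 => // /(negP Fw).
  have [gk|gk] := boolP (gap d L al eps rho k); last by exists 1 => // _ /(negP gk).
  have sw : size w = n1 := size_tuple w.
  have [cw /(_ k gk) nr] := HF w sw Fw.
  have w0 : (0 < size w)%N by rewrite sw.
  have Nw := controlled_gap cw gk w0.
  have N0 : 0 < cnorm k (mw a w) by rewrite Nw tnorm_gt0.
  have [h h0 H] := near_rank1_stable tau0 N0 nr.
  exists h => // _ _ B /H[? lo]; split=> //; apply: le_trans lo.
  rewrite ler_pM2r ?invr_gt0 // Nw.
  by have /andP[] := cw k (leq_trans (leq_ord k) (leqnSn d)); rewrite sw.
have [h' h'0 H'] := cocycle_close Xs (letters_bounded Aa) n1 h0.
exists h' => // B /H' AB w y sw Fw Xy yw k gk.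
have kd : (k < d.+1)%N by case/and3P: gk => /andP[].
have sw' : size w == n1 by rewrite sw.
apply: (hP (Tuple sw', Ordinal kd)) => //=.
by rewrite -yw -(cocycle_letters Xs Aa) //; exact: AB.
Qed.

End Core.

(** * Semicontinuity *)

Lemma rate_estimate (R : realType) (d : nat) (t t1 al : nat -> R)
    (p0 c ps L H r rho eps E e : R) : 0 <= L -> 0 <= H -> 0 <= r -> 0 <= rho <= 1 ->
  p0 - 2 * r * L * d%:R - rho <= ps -> (forall k, `|t1 k - t k| <= 3 * r) ->
  (forall k, (k <= d.+1)%N -> - L - rho <= al k <= H + rho) ->
  r * (3 * d%:R * (L + H + 1)) <= (p0 - c) / 8 ->
  rho * (1 + E + \sum_(k < d) t1 k + (\sum_(k < d) t k) * (4 * e + 2)) <= (p0 - c) / 8 ->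
  (\sum_(k < d) t k) * (eps * d%:R ^+ 2) <= (p0 - c) / 8 -> c <= p0 ->
  c + (p0 - c) / 4 <= ps - \sum_(k < d) t1 k * al k.+1 - (E + \sum_(k < d) t1 k) * rho
     - (p0 - c) / 8 + \sum_(k < d) t k * al k.+1
     - (\sum_(k < d) t k) * ((4 * e + 2) * rho + eps * d%:R ^+ 2).
Proof.
move=> L0 H0 r0 /andP[rho0 rho1] hps ht hal c1 c2 c3 cp.
have : \sum_(k < d) (t1 k - t k) * al k.+1 <= \sum_(k < d) (3 * r * (L + H + 1)).
  apply: ler_sum => k _; apply: (le_trans (ler_norm _)); rewrite normrM ler_pM //.
  by have /andP[] := hal k.+1 (leqW (ltn_ord k)); rewrite ler_norml; lra.
rewrite sumr_const card_ord -[leRHS]mulr_natr.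
have -> : \sum_(k < d) (t1 k - t k) * al k.+1 =
    \sum_(k < d) t1 k * al k.+1 - \sum_(k < d) t k * al k.+1.
  by rewrite -sumrB; apply: eq_bigr => k _; rewrite mulrBl.
have x1 : 0 <= r * d%:R * L by rewrite !mulr_ge0.
have x2 : 0 <= r * d%:R * H by rewrite !mulr_ge0.
have x3 : 0 <= r * d%:R by rewrite !mulr_ge0.
move: c1 c2 c3 hps; set s1 := \sum_(k < d) t1 k; set s := \sum_(k < d) t k.
set u1 := \sum_(k < d) _; set u := \sum_(k < d) _.
lra.
Qed.

(** The other rates are bounded above, so a weighted sum bounded below prevents a rate with positive
    weight from being very negative. The bound is again independent of L and provides the starting
    point for [gap_above]. *)
Lemma rate_lower (R : realType) (d : nat) (t t1 al : nat -> R) (k0 : nat)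
    (M H T1 : R) : (k0 < d)%N -> (forall k, 0 <= t k <= t1 k) -> 0 < t k0 ->
  0 <= M -> 0 <= H -> (forall k, (k < d)%N -> al k.+1 <= H) ->
  \sum_(k < d) t1 k <= T1 -> - M <= \sum_(k < d) t1 k * al k.+1 ->
  - ((M + T1 * H) / t k0) <= al k0.+1.
Proof.
move=> kd ht tk0 M0 H0 hal hT hM.
have t10 k : 0 <= t1 k by have /andP[/le_trans h /h] := ht k.
have T10 : 0 <= T1 by apply: le_trans hT; apply: sumr_ge0.
have [al0|al0] := leP 0 (al k0.+1).
  by apply: le_trans al0; rewrite oppr_le0 divr_ge0 ?(ltW tk0) // addr_ge0 ?mulr_ge0.
rewrite -mulNr ler_pdivrMr //.
have : al k0.+1 * t1 k0 <= al k0.+1 * t k0 by rewrite ler_wnM2l ?(ltW al0) //; have /andP[] := ht k0.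
suff : \sum_(k < d) t1 k * al k.+1 <= al k0.+1 * t1 k0 + T1 * H by lra.
rewrite (bigD1 (Ordinal kd)) //= [t1 k0 * _]mulrC lerD2l.
apply: (@le_trans _ _ ((\sum_(k < d) t1 k) * H)); last by rewrite ler_wpM2r.
rewrite mulr_suml [leRHS](bigD1 (Ordinal kd)) //= ler_wpDl ?mulr_ge0 //.
by apply: ler_sum => k _; rewrite ler_wpM2l // hal.
Qed.

Section LowerBound.
Variables (R : realType) (K : finType) (X : set (full_shift K)) (d : nat).
Variable g : full_shift K -> R.
Hypotheses (hX : subshift_of_finite_type X) (hg : {within X, continuous g}).
Variables (A : full_shift K -> 'M[R]_d) (a : K -> 'M[R]_d).
Hypothesis Aa : forall x, X x -> A x = a (x 0%N).
Local Notation T := (@Defs.shift K).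

Let Xs := sft_shift hX.
Let gb := bounded_of_modulus hX hg.

(** The exponents vanish after [k0], so only orders up to k0 + 1 enter psi and one gap at or above
    that order suffices. The level L is fixed first, then r, eps and rho, then the block length n1,
    and only then the radius h. *)
Lemma growth_lower (t : nat -> R) (c p0 : R) (k0 : nat) :
  (forall k, 0 <= t k) -> (k0 < d)%N -> 0 < t k0 -> (forall k, (k0 < k)%N -> t k = 0) ->
  c < p0 -> (p0%:E <= growth (Zpsi X g A t))%E ->
  exists2 h : R, 0 < h & forall B, (forall x, X x -> close h (A x) (B x)) ->
  (c%:E <= growth (Zpsi X g B t))%E.
Proof.
move=> t0 k0d tk0 tk0' cp /(growth_ge (fun n => Zpsi_ge0 Xs gb n t0 (letters_cbounded Aa))) hp0.
have [M Hglue] := sft_glue hX.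
have [Cl Cl0 Hlow] := psi_lower R d.
have [S S0 Hslope] := controlled_slope R d.
have [HG HG0 hHG] := gsum_growth Xs gb.
have [HN HN0 hHN] := letters_cnorm_growth a.
pose H := HG + HN.
have H0 : 0 <= H by rewrite addr_ge0.
pose st := \sum_(k < d) t k.
have st0 : 0 <= st by exact: sumr_ge0.
pose T1 := st + 3 * d%:R.
have T10 : 0 <= T1 by rewrite addr_ge0 ?mulr_ge0.
(* The weight of the horseshoe is at most e^(n1 H), so -M1 bounds the weighted sum of the rates from
   below; -M0 is the resulting bound for [al k0.+1]. *)
pose M1 := `|p0| + (p0 - c) + H.
have M10 : 0 <= M1 by rewrite addr_ge0 // addr_ge0 // subr_ge0 ltW.
pose M0 := (M1 + T1 * (H + 1)) / t k0.
have M00 : 0 <= M0 by apply: divr_ge0 (t0 k0); apply: addr_ge0 M10 _; apply: mulr_ge0 T10 _; exact: addr_ge0.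
pose S1 := S + H + 2.
have S10 : 0 <= S1 by rewrite !addr_ge0.
pose L := 2 + M0 + d%:R * S1 + d.+1%:R * (H + 1 + M0 + d.+1%:R).
have L0 : 0 <= L.
  apply: addr_ge0; first by apply: addr_ge0; rewrite ?mulr_ge0 // addr_ge0.
  by apply: mulr_ge0 => //; do !apply: addr_ge0 => //.
have LE : 2 + M0 + d%:R * S1 + d.+1%:R * (H + 1 + M0 + d.+1%:R) <= L by [].
clearbody L.
have gne : forall w, gsum X g w != 0 -> classical_sets.nonempty (cyl X w) by exact: gsum_nonempty.
have [c0 [e [E [c00 c01 Hhorse]]]] :=
  horseshoe a M Xs L0 (gsum_ge0 Xs gb) (gsum_submul Xs gb) gne.
set n := npieces K d M in Hhorse.
pose r := Num.min 1 ((p0 - c) / 8 / (3 * d%:R * (L + H + 1) + 1)).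
pose eps := Num.min 1 ((p0 - c) / 8 / (st * d%:R ^+ 2 + 1)).
pose Q := 1 + E%:R + T1 + st * (4 * e%:R + 2).
pose rho := Num.min 1 (Num.min (eps / (8 * e + 6)%:R) ((p0 - c) / 8 / Q)).
have pc0 : 0 < (p0 - c) / 8 by rewrite divr_gt0 // subr_gt0.
have Lden : 0 <= 3 * d%:R * (L + H + 1) by rewrite !mulr_ge0 // !addr_ge0.
have r0 : 0 < r by rewrite lt_min ltr01 divr_gt0 // ltr_wpDl.
have r1 : r <= 1 by rewrite ge_min lexx.
have rL : r * (3 * d%:R * (L + H + 1)) <= (p0 - c) / 8.
  have : r * (3 * d%:R * (L + H + 1) + 1) <= (p0 - c) / 8.
    by rewrite -ler_pdivlMr ?ltr_wpDl // ge_min lexx orbT.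
  by apply: le_trans; rewrite ler_wpM2l ?(ltW r0) // lerDl.
have eden : 0 <= st * d%:R ^+ 2 by rewrite mulr_ge0 ?exprn_ge0.
have eps0 : 0 < eps by rewrite lt_min ltr01 divr_gt0 // ltr_wpDl.
have eps1 : eps <= 1 by rewrite ge_min lexx.
have epsS : st * (eps * d%:R ^+ 2) <= (p0 - c) / 8.
  have : eps * (st * d%:R ^+ 2 + 1) <= (p0 - c) / 8.
    by rewrite -ler_pdivlMr ?ltr_wpDl // ge_min lexx orbT.
  by apply: le_trans; rewrite mulrCA ler_wpM2l ?(ltW eps0) // lerDl.
have Q1 : 1 <= Q by rewrite /Q -!addrA lerDl !addr_ge0 ?mulr_ge0 // addr_ge0 ?mulr_ge0.
have Q0 := lt_le_trans ltr01 Q1.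
have e60 : 0 < (8 * e + 6)%:R :> R by rewrite ltr0n addn_gt0 orbT.
have rho0 : 0 < rho by rewrite !lt_min ltr01 !divr_gt0 // subr_gt0.
have rho1 : rho <= 1 by rewrite ge_min lexx.
have rhoe : (8 * e + 6)%:R * rho <= eps.
  by rewrite mulrC -ler_pdivlMr // !ge_min lexx orbT.
have rhoQ : rho * Q <= (p0 - c) / 8.
  by rewrite -ler_pdivlMr // !ge_min lexx !orbT.
pose EE : R := 1 + \sum_(k < d.+1) #|{: {ffun 'I_k -> 'I_d}}|%:R ^+ 2.
have EE1 : 1 <= EE by rewrite lerDl sumr_ge0 // => k _; rewrite exprn_ge0.
(* The horseshoe has error 2 delta kap^2, the perturbation multiplies it by 4, and the chain asks
   for 8 D^2 times the error to be at most kap^2; hence 64. *)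
pose delta : R := (64 * EE)^-1.
have delta0 : 0 < delta by rewrite invr_gt0 mulr_gt0 // (lt_le_trans ltr01).
have delta1 : delta <= 1 by rewrite invf_le1 ?mulr_gt0 ?(lt_le_trans ltr01 EE1) //; lra.
have deltaE k : (k <= d)%N -> 64 * #|{: {ffun 'I_k -> 'I_d}}|%:R ^+ 2 * delta <= 1.
  move=> kd; rewrite ler_pdivrMr ?mulr_gt0 ?(lt_le_trans ltr01 EE1) // mul1r ler_pM2l //.
  rewrite /EE (bigD1 (Ordinal (kd : (k < d.+1)%N))) //= addrCA lerDl addr_ge0 //.
  apply: sumr_ge0 => i _; exact: exprn_ge0.
(* Centred at t + 2 r, the box of radius r stays above t + r: every t1 in it dominates t. *)
have hth : forall k, r <= t k + 2 * r by move=> k; have := t0 k; have := r0; lra.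
have hP i : (0 < i)%N -> expR (i%:R * (p0 - 2 * r * L * d%:R)) <=
    wsum i (tq d (gsum X g) (fun k => tlog a L k.+1) (fun k => t k + 2 * r)).
  move=> i0; apply: (@le_trans _ _ (Zpsi X g A t i * expR (- (i%:R * (2 * r * L * d%:R))))).
    by rewrite mulrBr expRD ler_wpM2r ?expR_ge0 ?hp0.
  rewrite -wsumZr; apply: le_wsum => w <-.
  exact: (cylsup_le_tilted Xs gb Aa w t0 L0 (ltW r0)).
have [t1 [al1 [ps [c' [eta [C1 [[ht1 hps c'0 eta0 [etac c'rho]] [C10 Hlo Hhi Hdev]]]]]]]] :=
  tilt (gsum_ge0 Xs gb) (gsum_submul Xs gb) (fun k u v => tlog_sub a L k.+1 u v)
    (2 * n) r0 rho0 hth hP.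
have tt1 k : t k <= t1 k by have := ht1 k; rewrite ler_norml; lra.
have t10 k : 0 <= t1 k := le_trans (t0 k) (tt1 k).
have t1t k : `|t1 k - t k| <= 3 * r by have := ht1 k; rewrite !ler_norml; have := r0; lra.
have st1 : \sum_(k < d) t1 k <= T1.
  apply: (@le_trans _ _ (\sum_(k < d) (t k + 3))).
    by apply: ler_sum => k _; have := t1t k; rewrite ler_norml; have := r1; lra.
  by rewrite big_split /= sumr_const card_ord /T1 -[3 *+ d]mulr_natr.
pose al j := if j is k.+1 then (if (k < d)%N then al1 k else - L) else 0.
have hal : rates d L al by split=> //; rewrite /al ltnn.
have etan : n%:R * eta <= rho.
  apply: le_trans c'rho; apply: le_trans etac; rewrite ler_wpM2r // ler_nat.
  by rewrite mul2n -addnn leq_addr.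
have q0 w : 0 <= tq d (gsum X g) (fun k => tlog a L k.+1) t1 w by apply: tq_ge0; exact: gsum_ge0.
have qs : submul (tq d (gsum X g) (fun k => tlog a L k.+1) t1).
  by apply: tq_submul => //; [exact: gsum_ge0 | exact: gsum_submul | move=> k u v; exact: tlog_sub].
have Hdev' k : (k < d)%N -> forall i,
    wsum i (fun w => (rho * i%:R < `|tlog a L k.+1 w - i%:R * al k.+1|)%R%:R *
       tq d (gsum X g) (fun k => tlog a L k.+1) t1 w) <= C1 * expR (i%:R * (ps - c')).
  by move=> kd i; rewrite /al kd; exact: Hdev.
have [m1 Hm1] := Hhorse t1 al ps eta C1 rho eps delta t10 rho0 rhoe delta0 delta1 eta0 etan C10 hal
  Hhi (regular_weight q0 qs c'0 eta0 etac C10 Hlo Hhi Hdev').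
have [m2 Hm2] := birkhoff_distortion hX hg pc0.
(* Blocks this long absorb the constants c0 and 4 into e^(rho n1). *)
pose m3 := (Num.truncn ((ln 4 - ln c0) / rho)).+1.
have [n1 [alpha [F [u [v [kap [n1m /andP[kap0 kap1] kapc HF HW]]]]]]] :=
  Hm1 (m1 + m2 + m3 + M)%N (leq_trans (leq_trans (leq_addr _ _) (leq_addr _ _)) (leq_addr _ _)).
have Mn1 : (M <= n1)%N := leq_trans (leq_addl _ _) n1m.
have m3n1 : (m3 <= n1)%N := leq_trans (leq_trans (leq_addl _ _) (leq_addr _ _)) n1m.
have m2n1 : (m2 <= n1)%N.
  apply: leq_trans n1m; apply: leq_trans (leq_addr _ _); apply: leq_trans (leq_addr _ _).
  exact: leq_addl.
have n10 : (0 < n1)%N by exact: leq_trans m3n1.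
have n1R : 0 < n1%:R :> R by rewrite ltr0n.
set s1 := \sum_(k < d) t1 k in HW st1.
set sa := \sum_(k < d) t1 k * al k.+1 in HW.
have s10 : 0 <= s1 by exact: sumr_ge0.
have Hsa : ps - sa - (E%:R + s1) * rho <= H.
  have : expR (n1%:R * (ps - sa - (E%:R + s1) * rho)) <= expR (n1%:R * H).
    apply: (le_trans HW); apply: (@le_trans _ _ (wsum n1 (gsum X g))).
      by apply: le_wsum => w _; case: (F w); rewrite ?mul1r ?mul0r ?gsum_ge0.
    by apply: (le_trans (hHG n1)); rewrite ler_expR ler_wpM2l // /H lerDl.
  by rewrite ler_expR ler_pM2l.
(* All bounds on the rates are read off one controlled word, which exists because F has positive
   weight. *)
have [w0 [sw0 Fw0]] : exists w0, size w0 = n1 /\ F w0.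
  apply: contrapT => /forallNP none; move: HW; rewrite leNgt => /negP; apply.
  rewrite (@eq_wsum _ _ _ _ (fun=> 0)); first by rewrite /wsum big1 ?expR_gt0.
  move=> w sw; case Fw: (F w); last by rewrite mul0r.
  by exfalso; apply: (none w).
have [_ _ cw0 nr0] := HF w0 sw0 Fw0.
have w00 : (0 < size w0)%N by rewrite sw0.
have hHN' k w : (0 < size w)%N -> cnorm k (mw a w) <= expR ((size w)%:R * H).
  move=> w1; apply: (le_trans (hHN k w w1)); rewrite ler_expR ler_wpM2l //.
  by rewrite /H lerDr.
have hal1 := controlled_bounds L0 H0 (ltW rho0) hHN' w00 cw0.
have hsl := Hslope _ _ _ _ _ _ _ L0 H0 (ltW rho0) hHN' w00 cw0.
have alH k : (k <= d)%N -> al k <= H + 1.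
  by move=> kd; have /andP[] := hal1 k (leqW kd); have := rho1; lra.
have rhoQ' : rho * (1 + E%:R + s1 + st * (4 * e%:R + 2)) <= (p0 - c) / 8.
  apply: le_trans rhoQ; rewrite ler_wpM2l ?(ltW rho0) // /Q; lra.
have r2L : 2 * r * L * d%:R <= (p0 - c) / 8.
  apply: le_trans rL; rewrite (_ : 2 * r * L * d%:R = r * (2 * d%:R * L)); last by ring.
  rewrite ler_wpM2l ?(ltW r0) //.
  have := mulr_ge0 (ler0n R d) L0; have := mulr_ge0 (ler0n R d) H0; have := ler0n R d; lra.
have hsa : - M1 <= sa.
  have x1 : rho * (1 + E%:R + s1) <= (p0 - c) / 8.
    apply: le_trans rhoQ'; rewrite ler_wpM2l ?(ltW rho0) // lerDl mulr_ge0 // addr_ge0 ?mulr_ge0 //.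
  have := lerNnormlW (lexx `|p0|); have := subr_ge0 c p0; rewrite (ltW cp) /M1; lra.
have low0 := rate_lower k0d _ tk0 M10 (addr_ge0 H0 ler01) (fun k kd => alH k.+1 kd) st1 hsa.
have {}low0 : - M0 <= al k0.+1 by apply: low0 => k; rewrite t0 tt1.
have [k1 [/andP[k0k1 k1d] gk1 big1]] : exists k1, [/\ (k0.+1 <= k1 <= d)%N, gap d L al eps rho k1 &
    forall k, (k <= k1)%N -> rho < al k + L].
  apply: (@gap_above R d k0.+1 L rho eps M0 S1 (H + 1) al) => //; rewrite ?rho0 ?eps0 //.
  - exact: addr_ge0.
  - exact: hal.2.
  - by move=> k kd; have := hsl k kd; rewrite /S1; have := rho1; lra.
have c0k : ln c0 - 4 * e%:R * rho * n1%:R <= ln kap.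
  by rewrite -ler_expR lnK ?posrE // expRD lnK ?posrE.
have ln40 : ln 4 - ln c0 <= rho * n1%:R.
  rewrite mulrC -ler_pdivrMr // ltW // (lt_le_trans (truncnS_gt _)) // ler_nat.
  exact: m3n1.
have lnk4 : ln (kap / 4) = ln kap - ln 4 by rewrite lnM ?posrE ?invr_gt0 // lnV ?posrE.
pose tau := 2 * delta * kap ^+ 2.
have tau0 : 0 < tau by apply: mulr_gt0; [exact: mulr_gt0 | exact: exprn_gt0].
have [h1 h10 Hh1] := @blocks_stable R K X d hX A a Aa L eps rho tau al n1 F u v
  (ltW rho0) tau0 n10 (fun w sw Fw => let: And4 _ _ cw nr := HF w sw Fw in
    conj cw (fun k gk => (nr k gk).1)).
have [h2 h20 Hh2] := close_cbounded Aa.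
exists (Num.min h1 h2) => [|B AB]; first by rewrite lt_min h10.
have AB1 x : X x -> close h1 (A x) (B x) by move=> Xx; apply: close_le (AB x Xx); rewrite ge_min lexx.
have AB2 x : X x -> close h2 (A x) (B x).
  by move=> Xx; apply: close_le (AB x Xx); rewrite ge_min lexx orbT.
have bB := Hh2 B AB2; have {}Hh1 := Hh1 B AB1.
apply: (@growth_ge_of_blocks R _ n1 c ((p0 - c) / 4)
  (st * (4 * e%:R * rho * n1%:R - ln c0 + Cl * d%:R ^+ 2))) => //.
- by move=> i; exact: Zpsi_ge0.
- by move=> i j; exact: Zpsi_submul.
- by rewrite divr_gt0 // subr_gt0.
move=> i i0.
have tk1 k : (k1 <= k)%N -> t k = 0 by move=> kk; apply: tk0'; exact: leq_trans kk.
have Ktau k : (k <= d)%N -> 8 * #|{: {ffun 'I_k -> 'I_d}}|%:R ^+ 2 * (4 * tau) <= kap ^+ 2.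
  move=> kd; rewrite (_ : _ * (4 * tau) =
    64 * #|{: {ffun 'I_k -> 'I_d}}|%:R ^+ 2 * delta * kap ^+ 2); last by rewrite /tau; ring.
  by rewrite ler_piMl ?exprn_ge0 ?(ltW kap0) // deltaE.
have main := @block_lower R K X d hX g gb t kap (4 * tau) rho eps ((p0 - c) / 8) L al k1 n1 alpha F
  u v B M Cl Hglue Hlow t0 bB hal.1 k1d gk1 eps0 (ltW rho0) big1 tk1 n10 Mn1 kap0 kap1 Ktau
  (fun k gk => (nr0 k gk).2) (fun w sw Fw => let: And4 al_ cy _ _ := HF w sw Fw in conj al_ cy)
  (fun x y => @Hm2 n1 x y m2n1) Hh1 i i0.
apply: le_trans main; rewrite -/st.
have HWr : expR (i%:R * (n1%:R * (ps - sa - (E%:R + s1) * rho) - (p0 - c) / 8 * n1%:R)) <=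
    (wsum n1 (fun w => (F w)%:R * gsum X g w) * expR (- ((p0 - c) / 8 * n1%:R))) ^+ i.
  rewrite expR_mul_nat lerXn2r ?nnegrE ?expR_ge0 //.
    by rewrite mulr_ge0 ?expR_ge0 // wsum_ge0 // => w; rewrite mulr_ge0 ?gsum_ge0.
  by rewrite expRD ler_wpM2r ?expR_ge0.
apply: le_trans (ler_wpM2r (expR_ge0 _) HWr); rewrite -expRD ler_expR natrM.
have rate := rate_estimate L0 H0 (ltW r0) (andb_true_intro (conj (ltW rho0) rho1)) hps t1t hal1 rL
  rhoQ' epsS (ltW cp).
rewrite -/st -/s1 -/sa in rate; set su := \sum_(k < d) t k * al k.+1 in rate *.
have iR : 0 <= i%:R :> R := ler0n R i.
have in0 : 0 <= i%:R * n1%:R :> R by rewrite mulr_ge0.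
have y1 := ler_wpM2l in0 rate.
have y2 : - ln (kap / 4) <= n1%:R * ((4 * e%:R + 1) * rho) by rewrite lnk4; lra.
have y3 := ler_wpM2l (mulr_ge0 st0 iR) y2.
have y4 := ler_wpM2l st0 c0k.
lra.
Qed.

End LowerBound.

Section Semicontinuity.
Variables (R : realType) (K : finType) (X : set (full_shift K)) (d : nat).
Variable g : full_shift K -> R.
Hypotheses (hX : subshift_of_finite_type X) (hg : {within X, continuous g}).
Variables (A : full_shift K -> 'M[R]_d) (a : K -> 'M[R]_d).
Hypothesis Aa : forall x, X x -> A x = a (x 0%N).
Implicit Types (t : nat -> R).
Local Notation T := (@Defs.shift K).

Let Xs := sft_shift hX.
Let gb := bounded_of_modulus hX hg.

(** If all exponents vanish, psi is 1 and the pressure ignores the cocycle; otherwise [growth_lower]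
    applies at the last positive exponent. *)
Lemma growth_lsc t (c : R) : (forall k, 0 <= t k) -> (forall k, (d <= k)%N -> t k = 0) ->
  (c%:E < growth (Zpsi X g A t))%E ->
  exists2 h : R, 0 < h & forall B, (forall x, X x -> close h (A x) (B x)) ->
  (c%:E <= growth (Zpsi X g B t))%E.
Proof.
move=> t0 td lt.
have [p0 [cp hp0]] : exists p0 : R, c < p0 /\ (p0%:E <= growth (Zpsi X g A t))%E.
  case: (growth _) lt => [p| |] // lt; first by exists p; rewrite -lte_fin.
  by exists (c + 1); rewrite leey ltrDl.
have [/existsP[i ti]|none] := boolP [exists i : 'I_d, 0 < t i].
  pose m := [arg max_(j > i | (0 < t j)%R) (j : nat)]%N.
  have [tm maxm] : 0 < t m /\ forall j : 'I_d, 0 < t j -> (j <= m)%N.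
    by rewrite /m; case: arg_maxnP.
  apply: (growth_lower hX hg Aa t0 (ltn_ord m) tm _ cp hp0) => k mk.
  have [kd|/td //] := ltnP k d; apply/eqP; rewrite eq_le t0 andbT leNgt; apply/negP => tk.
  by have := maxm (Ordinal kd) tk; rewrite leqNgt mk.
have psi1 (M : 'M[R]_d) : psi t M = 1.
  rewrite /psi big1 // => i _; move/existsPn: none => /(_ i); rewrite -leNgt => ti.
  by rewrite (_ : t i = 0) ?powRr0 //; apply/eqP; rewrite eq_le ti t0.
have psiE (B : full_shift K -> 'M[R]_d) : Hpsi g B t = Hpsi g A t.
  by apply/funext => i; apply/funext => y; rewrite /Hpsi !psi1.
exists 1 => [|B _]; first exact: ltr01.
have -> : Zpsi X g B t = Zpsi X g A t by rewrite /Zpsi (psiE B).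
by apply: (le_trans _ hp0); rewrite lee_fin ltW.
Qed.

(** A single n witnesses an infimum below c, and for that n the sum involves finitely many words, at
    whose products psi is upper semicontinuous. *)
Lemma growth_usc t (c : R) : (forall k, 0 <= t k) ->
  (growth (Zpsi X g A t) < c%:E)%E ->
  exists2 h : R, 0 < h & forall B, (forall x, X x -> close h (A x) (B x)) ->
  (growth (Zpsi X g B t) < c%:E)%E.
Proof.
move=> t0 lt; have bA := letters_cbounded Aa.
have [n n0 Zn] := growth_lt (fun n => Zpsi_ge0 Xs gb n t0 bA) lt.
have [D HD] := birkhoff_bound Xs gb n.
pose N := \sum_(w : n.-tuple K) expR D.
have N0 : 0 <= N by apply: sumr_ge0 => *; exact: expR_ge0.
pose e := (expR (n%:R * c) - Zpsi X g A t n) / 2 / (N + 1).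
have e0 : 0 < e by rewrite !divr_gt0 ?subr_gt0 // ltr_wpDl.
have [h h0 H] : exists2 h, 0 < h & forall w : n.-tuple K, forall M, close h (mw a w) M ->
    psi t M <= psi t (mw a w) + e.
  apply: uniform_radius => [w|w h h' h'0 hh' H M /(close_le hh')]; last exact: H.
  exact: usc_at_psi.
have [h' h'0 H'] := cocycle_close Xs (letters_bounded Aa) n h0.
have [h2 h20 Hh2] := close_cbounded Aa.
exists (Num.min h' h2) => [|B AB]; first by rewrite lt_min h'0.
have AB1 x : X x -> close h' (A x) (B x) by move=> Xx; apply: close_le (AB x Xx); rewrite ge_min lexx.
have AB2 x : X x -> close h2 (A x) (B x).
  by move=> Xx; apply: close_le (AB x Xx); rewrite ge_min lexx orbT.
have bB := Hh2 B AB2; have {}H' := H' B AB1.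
rewrite ltNge; apply/negP => /(growth_ge (fun n => Zpsi_ge0 Xs gb n t0 bB))/(_ n n0).
apply/negP; rewrite -ltNge.
have le : Zpsi X g B t n <= Zpsi X g A t n + N * e.
  rewrite /Zpsi /N mulr_suml /wsum -big_split; apply: ler_sum => w _ /=.
  apply: cylsup_le => [|y wy]; first by rewrite addr_ge0 ?cylsup_psi_ge0 // mulr_ge0 ?expR_ge0 ?ltW.
  have /= := cylsup_ub (Hpsi_bounded Xs gb t0 bA) wy.
  have [Xy] := wy; rewrite size_tuple => yw; rewrite /Hpsi => le.
  have close_y := H' y Xy; rewrite (cocycle_letters Xs Aa) // yw in close_y le.
  have := ler_wpM2l (expR_ge0 (birkhoff_sum g n y)) (H w _ close_y).
  have : expR (birkhoff_sum g n y) * e <= expR D * e.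
    by rewrite ler_wpM2r ?(ltW e0) // ler_expR (le_trans (ler_norm _)) ?HD.
  lra.
apply: (le_lt_trans le).
rewrite -ltrBrDl; apply: (@le_lt_trans _ _ (e * (N + 1))).
  by rewrite mulrC ler_wpM2l ?(ltW e0) // lerDl.
rewrite /e divfK; last by rewrite gt_eqF // ltr_wpDl.
by rewrite ltr_pdivrMr // ltr_pMr ?subr_gt0 // ltr1n.
Qed.

End Semicontinuity.

Lemma near_close (R : realType) (K : finType) (d : nat) (X : set (full_shift K))
    (A : matrix_cocycle R d X) (h : R) : 0 < h ->
  \forall B \near A, forall x, X x -> close h (A x) (B x).
Proof.
move=> h0; apply/uniform_nbhs; exists [set MN : 'M[R]_d * 'M[R]_d | ball MN.1 h MN.2]; split.
  by rewrite -entourage_ballE; exists h.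
move=> B /= AB x Xx i j; have [_ /(_ i j)] := AB x Xx.
by rewrite /ball /= => /ltW.
Qed.

Lemma near_row (R : realType) (d : nat) (s : 'rV[R]_d) (h : R) : 0 < h ->
  nbhs s [set s' : 'rV[R]_d | forall j, `|s 0 j - s' 0 j| <= h].
Proof.
move=> h0; apply: filterS (nbhsx_ballx s h h0) => s' [_ H] j.
exact: ltW (H 0 j).
Qed.

(** * Dependence on the exponents *)

Section Invertible.
Variables (R : realType) (d : nat).
Implicit Types (M : 'M[R]_d).

Lemma cont_at_det M : cont_at M (fun N => `|\det N|).
Proof.
apply: cont_at_norm; rewrite /determinant; apply: cont_at_sum => s.
apply: cont_atM; first exact: cont_at_cst.
by apply: cont_at_prod => i; exact: cont_at_entry.
Qed.

(** The top compound contains the determinant; each descent by one order costs a factor [cnorm 1].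
    Read backwards, a determinant away from 0 bounds every compound norm from below. *)
Lemma det_le_cnorm j : (j <= d)%N -> exists2 C : R, 1 <= C &
  forall M, `|\det M| <= C * (cnorm (d - j) M * cnorm 1 M ^+ j).
Proof.
elim: j => [_|j IH jd].
  exists d`!%:R => [|M]; first by rewrite ler1n fact_gt0.
  rewrite subn0 expr0 mulr1 mulrC -ler_pdivrMr ?factr_gt0 //.
  have := le_nrm (cmp (k := d) M) [ffun i => i] [ffun i => i].
  rewrite /cmp normrM normfV [`|d`!%:R|]ger0_norm ?ler0n //.
  have -> // : mxsub [ffun i : 'I_d => i] [ffun i => i] M = M.
  by apply/matrixP => i i'; rewrite !mxE !ffunE.
have [C C1 H] := IH (ltnW jd); have [C' C'1 H'] := cnormS_le R d (d - j.+1).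
exists (C * C') => [|M]; first by rewrite -[leLHS]mulr1 ler_pM.
apply: (le_trans (H M)); rewrite -[leRHS]mulrA ler_wpM2l ?(le_trans ler01) //.
apply: (@le_trans _ _ (C' * (cnorm (d - j.+1) M * cnorm 1 M) * cnorm 1 M ^+ j)).
  by rewrite ler_wpM2r ?exprn_ge0 ?cnorm_ge0 // -(subnSK jd).
by rewrite exprS !mulrA.
Qed.

Lemma powR_ratio (x t t' C : R) : expR (- C) <= x <= expR C ->
  x `^ t <= expR (`|t - t'| * C) * x `^ t'.
Proof.
move=> /andP[lo hi]; have x0 : 0 < x := lt_le_trans (expR_gt0 _) lo.
rewrite /powR gt_eqF // -expRD ler_expR -lerBlDr -mulrBl.
rewrite (le_trans (ler_norm _)) // normrM ler_wpM2l //.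
by rewrite ler_norml -ler_expR -(ler_expR _ C) lnK ?posrE // lo.
Qed.

Lemma psi_ratio (t t' : nat -> R) (C : R) M :
  (forall k, (k <= d)%N -> expR (- C) <= cnorm k M <= expR C) ->
  psi t M <= expR ((\sum_(k < d) `|t k - t' k|) * C) * psi t' M.
Proof.
move=> H; rewrite mulr_suml expR_sum -big_split; apply: ler_prod => k _.
by rewrite powR_ge0 powR_ratio // H.
Qed.

End Invertible.

Section InvertibleCocycle.
Variables (R : realType) (K : finType) (X : set (full_shift K)) (d : nat).
Hypothesis Xshift : forall x, X x -> X (Defs.shift x).
Variable g : full_shift K -> R.
Hypothesis gb : exists C : R, forall x, X x -> `|g x| <= C.
Variables (A : full_shift K -> 'M[R]_d) (a : K -> 'M[R]_d).
Hypothesis Aa : forall x, X x -> A x = a (x 0%N).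
Implicit Types (t : nat -> R) (B : full_shift K -> 'M[R]_d).

Definition temperate C B := forall k n x, (k <= d)%N -> (0 < n)%N -> X x ->
  expR (- (n%:R * C)) <= cnorm k (cocycle B x n) <= expR (n%:R * C).

Lemma close_temperate : (forall c, a c \in unitmx) -> exists h C : R, [/\ 0 < h, 0 <= C &
  forall B, (forall x, X x -> close h (A x) (B x)) -> temperate C B].
Proof.
move=> au.
have [h1 h10 H1] := letters_cnorm_close Aa ltr01.
have [C0 HC0] := letters_cbounded Aa.
have [m m0 Hm] : exists2 m, 0 < m & forall c, m <= `|\det (a c)| / 2 /\
    forall M, close m (a c) M -> `|\det (a c)| / 2 <= `|\det M|.
  apply: uniform_radius => [c|c h h' h'0 hh' [hc H]]; last first.
    by split=> [|M /(close_le hh')]; [exact: le_trans hc | exact: H].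
  have dc : 0 < `|\det (a c)| by rewrite normr_gt0 -unitfE -unitmxE.
  have dc2 : 0 < `|\det (a c)| / 2 by rewrite divr_gt0.
  have [h h0 H] := @cont_at_det R d (a c) _ dc2.
  exists (Num.min h (`|\det (a c)| / 2)); first by rewrite lt_min h0.
  split=> [|M aM]; first by rewrite ge_min lexx orbT.
  have : close h (a c) M by apply: close_le aM; rewrite ge_min lexx.
  by move=> /H; rewrite ler_norml; lra.
pose H := `|C0| + 1.
have H0 : 0 <= H by rewrite addr_ge0.
have ex j : exists C : R, (j <= d)%N -> 1 <= C /\
    forall M : 'M[R]_d, `|\det M| <= C * (cnorm (d - j) M * cnorm 1 M ^+ j).
  have [jd|] := leqP j d; last by exists 0.
  by have [C C1 HC] := det_le_cnorm R jd; exists C.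
have [D HD] := choice ex.
pose C := `|ln m| + d%:R * H + \sum_(j < d.+1) ln (D j) + H.
have lnD0 j : (j <= d)%N -> 0 <= ln (D j) by move=> /HD[D1 _]; exact: ln_ge0.
have S0 : 0 <= \sum_(j < d.+1) ln (D j) by apply: sumr_ge0 => j _; apply: lnD0; exact: leq_ord.
have dH0 : 0 <= d%:R * H by rewrite mulr_ge0.
have C1 : H <= C by rewrite /C lerDr !addr_ge0.
exists (Num.min h1 m), C; split; [by rewrite lt_min h10 | exact: le_trans C1 | move=> B AB].
have AB1 x : X x -> close h1 (A x) (B x) by move=> Xx; apply: close_le (AB x Xx); rewrite ge_min lexx.
have ABm x : X x -> m <= `|\det (B x)|.
  move=> Xx; have [h2 h3] := Hm (x 0%N); apply: (le_trans h2); apply: h3.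
  by rewrite -Aa //; apply: close_le (AB x Xx); rewrite ge_min lexx orbT.
have up k n x : (k <= d)%N -> (0 < n)%N -> X x -> cnorm k (cocycle B x n) <= expR (n%:R * H).
  move=> kd; have one y : X y -> cnorm k (B y) <= expR H.
    move=> Xy; have := H1 B AB1 k y kd Xy; have := HC0 k y kd Xy; have := ler_norm C0.
    by have := expR_ge1Dx H; rewrite ler_norml /H; lra.
  elim: n => [//|[|n] IH] _ Xx; first by rewrite /= mulmx1 mul1r one.
  rewrite (_ : cocycle B x n.+2 = B (iter n.+1 (@Defs.shift K) x) *m cocycle B x n.+1) //.
  rewrite (le_trans (cnorm_mul _ _ _)) // -natr1 mulrDl mul1r addrC expRD.
  by rewrite ler_pM ?cnorm_ge0 ?IH // one //; exact: iter_shift_in.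
have dt n x : X x -> m ^+ n <= `|\det (cocycle B x n)|.
  move=> Xx; elim: n => [|n IH]; first by rewrite det1 normr1.
  rewrite /= det_mulmx normrM exprS ler_pM ?exprn_ge0 ?(ltW m0) // ABm //.
  exact: iter_shift_in.
move=> k n x kd n0 Xx; have nR : 1 <= n%:R :> R by rewrite ler1n.
have nR0 := lt_le_trans ltr01 nR.
apply/andP; split; last first.
  by apply: (le_trans (up k n x kd n0 Xx)); rewrite ler_expR ler_wpM2l ?(ltW nR0).
have [D1 HDk] := HD (d - k)%N (leq_subr _ _); set N := cnorm k _.
have D0 := lt_le_trans ltr01 D1.
have le1 : expR (n%:R * ln m) <= expR (n%:R * (ln (D (d - k)%N) + d%:R * H)) * N.
  rewrite expR_mul_nat lnK ?posrE //; apply: (le_trans (dt n x Xx)).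
  apply: (le_trans (HDk _)); rewrite subKn // -/N mulrCA [leRHS]mulrC ler_wpM2l ?cnorm_ge0 //.
  rewrite mulrDr expRD; apply: ler_pM; rewrite ?exprn_ge0 ?cnorm_ge0 ?(ltW D0) //.
    by rewrite -[leLHS]lnK ?posrE // ler_expR ler_peMl // ln_ge0.
  have [d0|d0] := posnP d.
    by rewrite (_ : d - k = 0)%N ?expr0 ?d0 ?mul0r ?mulr0 ?expR0 //; lia.
  apply: (@le_trans _ _ (expR (n%:R * H) ^+ (d - k))).
    by rewrite lerXn2r ?nnegrE ?cnorm_ge0 ?expR_ge0 // up.
  rewrite -expR_mul_nat ler_expR mulrCA ler_wpM2l ?(ltW nR0) // ler_wpM2r //.
  by rewrite ler_nat leq_subr.
have N0 : 0 < N.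
  rewrite lt_neqAle cnorm_ge0 andbT eq_sym; apply: contraTneq le1 => ->.
  by rewrite mulr0 -ltNge expR_gt0.
rewrite -[N]lnK ?posrE // -expRD !ler_expR in le1 *.
have lD : ln (D (d - k)%N) <= \sum_(j < d.+1) ln (D j).
  have dk : (d - k < d.+1)%N by rewrite ltnS leq_subr.
  by rewrite (bigD1 (Ordinal dk)) //= lerDl sumr_ge0 // => j _; apply: lnD0; exact: leq_ord.
have lm : - `|ln m| <= ln m by rewrite lerNl ler_normr lexx orbT.
have : - C <= ln m - ln (D (d - k)%N) - d%:R * H by rewrite /C; lra.
by move=> /(ler_wpM2l (ltW nR0)); lra.
Qed.

Lemma growth_ratio t t' (c C e : R) B : (forall k, 0 <= t k) -> (forall k, 0 <= t' k) ->
  cbounded X B -> temperate C B -> (\sum_(k < d) `|t k - t' k|) * C <= e ->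
  (c%:E <= growth (Zpsi X g B t))%E -> ((c - e)%:E <= growth (Zpsi X g B t'))%E.
Proof.
move=> t0 t'0 bB tB le /(growth_ge (fun n => Zpsi_ge0 Xshift gb n t0 bB)) H.
apply/(growth_ge (fun n => Zpsi_ge0 Xshift gb n t'0 bB)) => n n0.
rewrite mulrBr expRD expRN ler_pdivrMr ?expR_gt0 //; apply: (le_trans (H n n0)).
rewrite mulrC -wsumZ; apply: le_wsum => w sw.
apply: cylsup_le => [|y wy]; first by rewrite mulr_ge0 ?expR_ge0 // cylsup_psi_ge0.
have [Xy _] := wy.
apply: (@le_trans _ _ (expR (n%:R * e) * Hpsi g B t' (size w) y)); last first.
  by rewrite ler_wpM2l ?expR_ge0 //; exact: (cylsup_ub (Hpsi_bounded Xshift gb t'0 bB) wy).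
rewrite /Hpsi mulrCA ler_wpM2l ?expR_ge0 // sw.
apply: (le_trans (psi_ratio t t' (fun k kd => tB k n y kd n0 Xy))).
by rewrite ler_wpM2r ?psi_ge0 // ler_expR mulrCA ler_wpM2l.
Qed.

End InvertibleCocycle.

Lemma gap_exp_close (R : realType) (d : nat) (s s' : 'rV[R]_d) (h : R) k : 0 <= h ->
  (forall j, `|s 0 j - s' 0 j| <= h) -> `|gap_exp s k - gap_exp s' k| <= 2 * h.
Proof.
move=> h0 H; have E j : `|sext s j - sext s' j| <= h.
  by rewrite /sext; case: insub => [i|]; rewrite ?H // subrr normr0.
have := E k; have := E k.+1; rewrite /gap_exp !ler_norml; lra.
Qed.

Lemma gap_exp_ge (R : realType) (d : nat) (s : 'rV[R]_d) k : (d <= k)%N -> gap_exp s k = 0.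
Proof. by move=> dk; rewrite /gap_exp !sext_ge ?subrr // leqW. Qed.

(** Letters that start no point of X receive the identity, so invertibility on X becomes
    invertibility at every letter. *)
Lemma locally_constant_letters (R : realType) (K : finType) (d : nat) (X : set (full_shift K))
    (A : full_shift K -> 'M[R]_d) : locally_constant X A ->
  exists2 a : K -> 'M[R]_d, forall x, X x -> A x = a (x 0%N) &
    GL_valued X A -> forall c, a c \in unitmx.
Proof.
move=> lA; exists (fun c => if pselect (exists x, X x /\ x 0%N = c) is left e
    then A (projT1 (cid e)) else 1%:M) => [x Xx|GA c].
  case: pselect => [e|none]; last by exfalso; apply: none; exists x.
  by case: (cid e) => y /= [Xy yx]; exact: lA.
case: pselect => [e|_]; last exact: unitmx1.
by case: (cid e) => y /= [Xy _]; exact: GA.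
Qed.

Lemma ereal_lt_between (R : realType) (c : R) (l : \bar R) : (c%:E < l)%E ->
  exists2 e : R, 0 < e & ((c + e)%:E < l)%E.
Proof.
case: l => [r| |] //; rewrite ?lte_fin => H; last by exists 1; rewrite ?ltry.
by exists ((r - c) / 2); rewrite ?lte_fin; lra.
Qed.

Lemma ereal_between_lt (R : realType) (c : R) (l : \bar R) : (l < c%:E)%E ->
  exists2 e : R, 0 < e & (l < (c - e)%:E)%E.
Proof.
case: l => [r| |] //; rewrite ?lte_fin => H; last by exists 1; rewrite ?ltNyr.
by exists ((c - r) / 2); rewrite ?lte_fin; lra.
Qed.

Theorem theorem5p1 (R : realType) (K : finType) (X : set (full_shift K))
    (g : full_shift K -> R) (d : nat)
    (hX : subshift_of_finite_type X) (hg : {within X, continuous g})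
    (hd : (1 <= d)%N) :
  (forall s : 'rV[R]_d, Lambda s ->
   forall A : matrix_cocycle R d X, locally_constant X A ->
     {for A, continuous (fun B : matrix_cocycle R d X => pressure X g B s)})
  /\
  (forall A : matrix_cocycle R d X, locally_constant X A -> GL_valued X A ->
   forall s : 'rV[R]_d, Lambda s ->
     pressure X g p.1 p.2
       @[p --> within [set q : matrix_cocycle R d X * 'rV[R]_d | Lambda q.2]
                 (nbhs (A, s))]
     --> pressure X g A s).
Proof.
have Xs := sft_shift hX; have gb := bounded_of_modulus hX hg.
split=> [s sL A /locally_constant_letters[a Aa _]|A /locally_constant_letters[a Aa Ga] GA s sL].
  have s0 k : 0 <= gap_exp s k := gap_exp_ge0 k sL.
  have [h1 h10 H1] := close_cbounded Aa.
  have PA := pressure_growth Xs gb sL (letters_cbounded Aa).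
  have nearP h : 0 < h -> \forall B \near A, cbounded X B /\ forall x, X x -> close h (A x) (B x).
    move=> h0; have h'0 : 0 < Num.min h h1 by rewrite lt_min h0.
    apply: filterS (near_close A h'0) => B AB; split=> [|x Xx].
      by apply: H1 => x Xx; apply: close_le (AB x Xx); rewrite ge_min lexx orbT.
    by apply: close_le (AB x Xx); rewrite ge_min lexx.
  apply: (@cvge_of_bounds R _ (nbhs A)) => c; rewrite PA => Hc.
    have [e e0 He] := ereal_lt_between Hc.
    have [h h0 H] := growth_lsc hX hg Aa s0 (gap_exp_ge s) He.
    apply: filterS (nearP h h0) => B [bB AB]; rewrite (pressure_growth Xs gb sL bB).
    by apply: (lt_le_trans _ (H B AB)); rewrite lte_fin ltrDl.
  have [h h0 H] := growth_usc hX hg Aa s0 Hc.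
  apply: filterS (nearP h h0) => B [bB AB]; rewrite (pressure_growth Xs gb sL bB).
  exact: H.
have s0 k : 0 <= gap_exp s k := gap_exp_ge0 k sL.
have [h1 h10 H1] := close_cbounded Aa.
have [h2 [C [h20 C0 H2]]] := close_temperate Xs Aa (Ga GA).
have PA := pressure_growth Xs gb sL (letters_cbounded Aa).
have near_exp (e h : R) : 0 < e -> 0 < h ->
    \forall p \near within [set q : matrix_cocycle R d X * 'rV[R]_d | Lambda q.2] (nbhs (A, s)),
    [/\ Lambda p.2, cbounded X p.1, temperate X C p.1, forall x, X x -> close h (A x) (p.1 x) &
      (\sum_(k < d) `|gap_exp s k - gap_exp p.2 k|) * C <= e].
  (* Each of the d gap exponents moves by at most 2 e1, and the growth by C times their total; the 1
     keeps the denominator positive. *)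
  move=> e0 h0; pose e1 := e / (d%:R * 2 * C + 1).
  have den0 : 0 < d%:R * 2 * C + 1 by rewrite ltr_wpDl // !mulr_ge0.
  have e10 : 0 < e1 by rewrite divr_gt0.
  pose h' := Num.min h (Num.min h1 h2).
  have h'0 : 0 < h' by rewrite !lt_min h0 h10.
  suff H : nbhs (A, s) [set p : matrix_cocycle R d X * 'rV[R]_d | Lambda p.2 ->
    [/\ Lambda p.2, cbounded X p.1, temperate X C p.1, forall x, X x -> close h (A x) (p.1 x) &
      (\sum_(k < d) `|gap_exp s k - gap_exp p.2 k|) * C <= e]] by exact: H.
  apply: (@filterS2 _ (nbhs (A, s)) _ [set p : matrix_cocycle R d X * 'rV[R]_d |
      forall x, X x -> close h' (A x) (p.1 x)]
    [set p : matrix_cocycle R d X * 'rV[R]_d | forall j, `|s 0 j - p.2 0 j| <= e1]).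
  - move=> [B s'] /= AB ss' s'L; split=> //.
    + by apply: H1 => x Xx; apply: close_le (AB x Xx); rewrite !ge_min lexx !orbT.
    + by apply: H2 => x Xx; apply: close_le (AB x Xx); rewrite !ge_min lexx !orbT.
    + by move=> x Xx; apply: close_le (AB x Xx); rewrite ge_min lexx.
    apply: (@le_trans _ _ ((\sum_(k < d) (2 * e1)) * C)).
      by rewrite ler_wpM2r // ler_sum // => k _; exact: gap_exp_close (ltW e10) ss'.
    have : e1 * (d%:R * 2 * C + 1) = e by rewrite divfK // gt_eqF.
    rewrite sumr_const card_ord -[_ *+ d]mulr_natr; have := e10; lra.
  - by apply: (cvg_fst (near_close A h'0)).
  by apply: (cvg_snd (near_row s e10)).
apply: cvge_of_bounds => c; rewrite PA => Hc.
  have [e e0 He] := ereal_lt_between Hc; have e20 : 0 < e / 2 by rewrite divr_gt0.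
  have [h h0 H] := growth_lsc hX hg Aa s0 (gap_exp_ge s) He.
  apply: filterS (near_exp _ _ e20 h0) => -[B s'] [/= s'L bB tB AB es].
  rewrite (pressure_growth Xs gb s'L bB).
  have s'0 k : 0 <= gap_exp s' k := gap_exp_ge0 k s'L.
  apply: lt_le_trans (growth_ratio Xs gb s0 s'0 bB tB es (H B AB)).
  by rewrite lte_fin; lra.
have [e e0 He] := ereal_between_lt Hc; have e20 : 0 < e / 2 by rewrite divr_gt0.
have [h h0 H] := growth_usc hX hg Aa s0 He.
apply: filterS (near_exp _ _ e20 h0) => -[B s'] [/= s'L bB tB AB es].
(* Upper bounds are transferred by contradiction: a large pressure at s' would force one at s for
   the same cocycle. *)
rewrite (pressure_growth Xs gb s'L bB) ltNge; apply/negP => le.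
have s'0 k : 0 <= gap_exp s' k := gap_exp_ge0 k s'L.
have es' : (\sum_(k < d) `|gap_exp s' k - gap_exp s k|) * C <= e / 2.
  by apply: le_trans es; under eq_bigr do rewrite distrC.
have := growth_ratio Xs gb s'0 s0 bB tB es' le.
apply/negP; rewrite -ltNge; apply: (lt_le_trans (H B AB)).
by rewrite lee_fin; lra.
Qed.
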